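(* Let $\varphi_L(z):=\sqrt{1+z}$ for $z\in\mathbb{D}$, where the branch of the square root is chosen so that $\varphi_L(0)=1$, and let $\varphi_{Ne}(z):=1+z-z^3/3$. Let $p\in\mathcal{H}$ satisfy $p(0)=1$ and let $\beta\in\mathbb{R}$. Then each of the following subordinations implies $p(z)\prec\varphi_{Ne}(z)$: (a) $1+\beta zp'(z)\prec\varphi_L(z)$, for $\beta\geq 3(1-\log 2)\approx 0.920558$; (b) $1+\beta\,\dfrac{zp'(z)}{p(z)}\prec\varphi_L(z)$, for $\beta\geq\dfrac{2\left(\sqrt2+\log2-1-\log(1+\sqrt2)\right)}{\log(5/3)}\approx 0.884792$; (c) $1+\beta\,\dfrac{zp'(z)}{p^2(z)}\prec\varphi_L(z)$, for $\beta\geq5\left(\sqrt2+\log2-1-\log(1+\sqrt2)\right)\approx1.12994$. Each estimate on $\beta$ is sharp.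
   Context: $\mathbb{D}=\{z\in\mathbb{C}:|z|<1\}$ and $\mathcal{H}$ is the set of all analytic functions on $\mathbb{D}$. For $f,g\in\mathcal{H}$, $f\prec g$ ($f$ is subordinate to $g$) means that there is $w\in\mathcal{H}$ with $w(0)=0$ and $|w(z)|<1$ for $z\in\mathbb{D}$ such that $f(z)=g(w(z))$ on $\mathbb{D}$; in particular, writing a subordination presupposes that both sides are analytic in $\mathbb{D}$. $\log$ of a positive number is the natural logarithm. That an estimate $\beta\ge\beta_0$ is sharp means that $\beta_0$ cannot be replaced by any smaller real number so that the implication remains valid for all such $p$ and all $\beta$ at least that number. *)

(* Defs.v *)
From Stdlib Require Import Reals Lra.
From Coquelicot Require Import Coquelicot.

Open Scope R_scope.

Definition unit_disk (z : C) : Prop := Cmod z < 1.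

(* A function on the disk is encoded as a total function C -> C, of which only
   the values on the disk matter.  Analytic means complex differentiable at
   every point of the disk. *)
Definition analytic (f : C -> C) : Prop :=
  forall z : C, unit_disk z ->
    ex_derive (K := C_AbsRing) (V := C_NormedModule) f z.

Definition subordinate (f g : C -> C) : Prop :=
  analytic f /\ analytic g /\
  exists w : C -> C,
    analytic w /\ w 0%C = 0%C /\
    (forall z, unit_disk z -> Cmod (w z) < 1) /\
    (forall z, unit_disk z -> f z = g (w z)).

(* Principal branch (nonnegative real part, cut along the negative reals). *)
Definition Csqrt (z : C) : C :=
  (sqrt ((Cmod z + Re z) / 2),
   if Rlt_dec (Im z) 0 then - sqrt ((Cmod z - Re z) / 2)
   else sqrt ((Cmod z - Re z) / 2)).

Definition phi_L (z : C) : C := Csqrt (1 + z).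

Definition phi_Ne (z : C) : C := (1 + z - z ^ 3 / 3)%C.

(* In [expr_b] and [expr_c], [x / 0 = 0] in C.  This convention cannot produce
   a spurious subordination when [beta <> 0]: at a zero of [p] in the disk the
   quotients have a pole, so the expression is not continuous there and
   [analytic], which is part of [subordinate], fails. *)
Definition expr_a (beta : R) (p : C -> C) (z : C) : C :=
  (1 + beta * (z * C_derive p z))%C.

Definition expr_b (beta : R) (p : C -> C) (z : C) : C :=
  (1 + beta * (z * C_derive p z / p z))%C.

Definition expr_c (beta : R) (p : C -> C) (z : C) : C :=
  (1 + beta * (z * C_derive p z / p z ^ 2))%C.

Definition implication_from (expr : R -> (C -> C) -> C -> C) (b : R) : Prop :=
  forall (p : C -> C) (beta : R),
    analytic p -> p 0%C = 1%C -> b <= beta ->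
    subordinate (expr beta p) phi_L -> subordinate p phi_Ne.

Definition sharp (P : R -> Prop) (b0 : R) : Prop :=
  forall b : R, b < b0 -> ~ P b.

(* [phi_L] is the analytic branch of sqrt (1 + z) on the disk with value 1 at
   the origin. *)

Lemma Csqrt_sqr (z : C) : (Csqrt z * Csqrt z)%C = z.
Proof.
pose proof (proj1 (Rabs_le_between _ _) (re_le_Cmod z)) as [H1 H2].
assert (Hm : Cmod z * Cmod z = Re z * Re z + Im z * Im z).
{ pose proof (Cmod2_alt z); simpl in *; lra. }
assert (Ha : 0 <= (Cmod z + Re z) / 2) by lra.
assert (Hb : 0 <= (Cmod z - Re z) / 2) by lra.
assert (Hp : sqrt ((Cmod z + Re z) / 2) * sqrt ((Cmod z - Re z) / 2)
             = Rabs (Im z) / 2).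
{ rewrite <- sqrt_mult by assumption.
  replace ((Cmod z + Re z) / 2 * ((Cmod z - Re z) / 2))
    with (Rsqr (Im z / 2)) by (unfold Rsqr; lra).
  rewrite sqrt_Rsqr_abs. unfold Rdiv. rewrite Rabs_mult.
  rewrite (Rabs_pos_eq (/ 2)); lra. }
pose proof (sqrt_sqrt _ Ha) as Sa.
pose proof (sqrt_sqrt _ Hb) as Sb.
unfold Csqrt, Cmult; simpl.
rewrite (surjective_pairing z) at 13.
destruct (Rlt_dec (Im z) 0) as [Hi | Hi];
  [rewrite Rabs_left in Hp by lra | rewrite Rabs_pos_eq in Hp by lra];
  f_equal; unfold Re, Im in *; lra.
Qed.

Lemma Re_Csqrt_ge0 (z : C) : 0 <= Re (Csqrt z).
Proof. apply sqrt_pos. Qed.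

Lemma Re_Csqrt_gt0 (z : C) : 0 < Re z -> 0 < Re (Csqrt z).
Proof.
intro H. apply sqrt_lt_R0. pose proof (Cmod_ge_0 z). lra.
Qed.

Lemma is_derive_Csqrt (z : C) : 0 < Re z ->
  is_derive (K := C_AbsRing) (V := C_NormedModule) Csqrt z (/ (2 * Csqrt z))%C.
Proof.
intro Hz.
pose proof (Re_Csqrt_gt0 z Hz) as Hc.
set (c := Re (Csqrt z)) in *.
assert (Hs : Csqrt z <> 0%C).
{ intro E. unfold c in Hc. rewrite E in Hc. simpl in Hc. lra. }
split; [apply is_linear_scal_l|].
intros x Hx eps.
apply (is_filter_lim_locally_unique (K := C_AbsRing)
         (V := AbsRing_NormedModule C_AbsRing)) in Hx.
subst x.
assert (Hd : 0 < 2 * c * c * c * eps).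
{ repeat apply Rmult_lt_0_compat; try lra. apply cond_pos. }
exists (mkposreal _ Hd); intros y Hy.
change (Cmod (y - z) < 2 * c * c * c * eps) in Hy.
change (Cmod ((Csqrt y - Csqrt z) - (y - z) * / (2 * Csqrt z))
        <= eps * Cmod (y - z)).
assert (Hcz : c <= Cmod (Csqrt z)).
{ unfold c. eapply Rle_trans; [apply Rle_abs|apply re_le_Cmod]. }
assert (Hsum : c <= Cmod (Csqrt y + Csqrt z)).
{ eapply Rle_trans; [|eapply Rle_trans; [apply Rle_abs|apply re_le_Cmod]].
  pose proof (Re_Csqrt_ge0 y). unfold c, Re, Cplus in *; simpl in *; lra. }
assert (Hprod : ((Csqrt y - Csqrt z) * (Csqrt y + Csqrt z))%C = (y - z)%C).
{ transitivity (Csqrt y * Csqrt y - Csqrt z * Csqrt z)%C; [ring|].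
  now rewrite !Csqrt_sqr. }
assert (Hdiff : c * Cmod (Csqrt y - Csqrt z) <= Cmod (y - z)).
{ rewrite <- Hprod, Cmod_mult.
  pose proof (Cmod_ge_0 (Csqrt y - Csqrt z)). nra. }
replace ((Csqrt y - Csqrt z) - (y - z) * / (2 * Csqrt z))%C
  with (- ((Csqrt y - Csqrt z) * (Csqrt y - Csqrt z) / (2 * Csqrt z)))%C
  by (rewrite <- Hprod; field; exact Hs).
rewrite Cmod_opp, Cmod_div, !Cmod_mult.
2: { apply Cmult_neq_0; [|exact Hs].
     intro E; apply RtoC_inj in E; lra. }
rewrite Cmod_R, (Rabs_pos_eq 2) by lra.
set (d := Cmod (Csqrt y - Csqrt z)) in *.
assert (0 <= d) by apply Cmod_ge_0.
pose proof (Cmod_ge_0 (y - z)) as Hn.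
set (n := Cmod (y - z)) in *.
apply Rle_div_l; [lra|].
pose proof (cond_pos eps) as He.
assert (c * c * (d * d) <= n * n).
{ replace (c * c * (d * d)) with ((c * d) * (c * d)) by ring.
  assert (0 <= c * d) by (apply Rmult_le_pos; lra).
  now apply Rmult_le_compat. }
assert (n * n <= n * (2 * c * c * c * eps))
  by (apply Rmult_le_compat_l; [exact Hn|]; apply Rlt_le; exact Hy).
assert (Hk : d * d <= n * (2 * c * eps)).
{ apply Rmult_le_reg_l with (c * c); [nra|]. lra. }
apply Rle_trans with (1 := Hk).
assert (0 <= eps * n) by nra.
replace (n * (2 * c * eps)) with (eps * n * (2 * c)) by ring.
apply Rmult_le_compat_l; lra.
Qed.

Lemma phi_L_sqr (z : C) : (phi_L z ^ 2)%C = (1 + z)%C.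
Proof. unfold phi_L; simpl. rewrite Cmult_1_r. apply Csqrt_sqr. Qed.

Lemma phi_L_0 : phi_L 0 = 1%C.
Proof.
unfold phi_L, Csqrt. rewrite Cplus_0_r, Cmod_1. simpl.
destruct (Rlt_dec 0 0); [lra|].
replace ((1 + 1) / 2) with 1 by lra.
replace ((1 - 1) / 2) with 0 by lra.
rewrite sqrt_1, sqrt_0. reflexivity.
Qed.

Lemma phi_L_analytic : analytic phi_L.
Proof.
intros z Hz.
apply (ex_derive_comp (K := C_AbsRing) (V := C_NormedModule)
         Csqrt (fun u : C => (1 + u)%C)).
- eexists. apply is_derive_Csqrt.
  pose proof (re_le_Cmod z) as H. unfold unit_disk in Hz.
  apply Rabs_le_between in H. unfold Re in *; simpl; lra.
- apply (ex_derive_plus (K := C_AbsRing)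
           (V := AbsRing_NormedModule C_AbsRing)
           (fun _ => RtoC 1) (fun u => u)).
  + apply ex_derive_const.
  + apply ex_derive_id.
Qed.

(* Main.v *)
(* Put T z = z p'(z) and write the hypothesis as expr = phi_L(w).  Schwarz's lemma for
   w gives |w z| <= |z|, hence |sqrt(1+w) - 1| <= 1 - sqrt(1-|z|) and
   Re sqrt(1+w) <= sqrt(1+|z|).  Integrating along rays bounds u = p - 1, log p or
   1 - 1/p (in cases a, b, c) by |u| < 2(1 - ln 2)/beta and Re u < 2L/beta, where
   L = sqrt 2 + ln 2 - 1 - ln(1 + sqrt 2).  In all three cases p then takes its values
   in the region 1/3 < Re v, |v| < 5/3, |Im v| < 1, which lies inside the nephroid;
   phi_Ne is injective with derivative 1 - z^2, so p = phi_Ne o w1 with w1 analytic.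
   The extremal functions are those with expr = phi_L; they leave the nephroid through
   the cusp 1/3 (case a) or 5/3 (cases b, c).

   No Cauchy theory is used.  As T is differentiable, p is twice differentiable off 0,
   and for such functions the maximum principle follows from the strict subharmonicity
   of |k|^2 + eps |z|^2.  Schwarz's lemma for w, only once differentiable, is obtained by
   replacing z p'(z) with the quotients (p(e^{it} z) - p(z)) / (it). *)

Require Import Defs.
From Stdlib Require Import Reals Lra Classical ClassicalEpsilon FunctionalExtensionality.
From Coquelicot Require Import Coquelicot.

Open Scope R_scope.

(** The three constants say when an extremal function reaches a cusp. The integral over [0,1] of (1
    - sqrt(1-t))/t is 2(1 - ln 2), that of (sqrt(1+t) - 1)/t is 2L. Staying between the cusps 1/3
    and 5/3 asks for |p - 1| < 2/3 in case a, ln |p| < ln(5/3) in case b and Re(1 - 1/p) < 2/5 in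
    case c. Only this estimate is tight in each case; crude numerical bounds give the remaining
    sides of the region in cases b and c.

    Division being total, zeros of p have to be excluded before cases b and c can start; a Gronwall
    argument for |p|^2 does it. In case b no holomorphic logarithm of p is built: ln |p| serves as
    its real part, and a real function of p replaces the bound on its modulus.

    That the region lies in the nephroid is shown by minimising the distance from phi_Ne to a point
    v over the closed disk. A minimiser inside the disk can be improved unless it is a preimage of
    v. One on the circle is either a cusp, which is never nearest, or puts v on an outer normal of
    the boundary curve, and these normals avoid the region. *)

(** * Elementary inequalities for the modulus *)

Lemma Cmod_sub_sym (a b : C) : Cmod (a - b)%C = Cmod (b - a)%C.
Proof. rewrite <- Cmod_opp. f_equal. ring. Qed.

Lemma Cmod_sub_triangle (a b : C) : Cmod (a - b)%C <= Cmod a + Cmod b.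
Proof.
replace (a - b)%C with (a + - b)%C by ring.
rewrite <- (Cmod_opp b). apply Cmod_triangle.
Qed.

Lemma Cmod_ge_sub (a b : C) : Cmod a - Cmod b <= Cmod (a - b)%C.
Proof.
pose proof (Cmod_triangle (a - b) b) as H.
replace (a - b + b)%C with a in H by ring. lra.
Qed.

Lemma Cmod_sqr (z : C) : Cmod z * Cmod z = Re z * Re z + Im z * Im z.
Proof. pose proof (Cmod2_alt z) as H. simpl in H. lra. Qed.

Lemma im_le_Cmod (z : C) : Rabs (Im z) <= Cmod z.
Proof. eapply Rle_trans; [apply Rmax_r | apply (Rmax_Cmod z)]. Qed.

Lemma Re_le_Cmod' (z : C) : Re z <= Cmod z.
Proof. eapply Rle_trans; [apply Rle_abs | apply re_le_Cmod]. Qed.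

Lemma Cmod_le_sqr (z : C) (r : R) : 0 <= r ->
  Re z * Re z + Im z * Im z <= r * r -> Cmod z <= r.
Proof. intros Hr H. pose proof (Cmod_sqr z). pose proof (Cmod_ge_0 z). nra. Qed.

Lemma le_of_le_eps (a b k : R) : 0 <= k ->
  (forall e, 0 < e -> e <= 1 -> a <= b + k * e) -> a <= b.
Proof.
intros Hk H. apply Rnot_lt_le; intro Hl.
set (e := Rmin 1 ((a - b) / (2 * (k + 1)))).
assert (He : 0 < e).
{ unfold e. apply Rmin_glb_lt; [lra|]. apply Rdiv_lt_0_compat; lra. }
assert (He2 : e <= (a - b) / (2 * (k + 1))) by apply Rmin_r.
assert (He1 : e <= 1) by apply Rmin_l.
specialize (H e He He1).
assert (k * e <= k * ((a - b) / (2 * (k + 1)))) by (apply Rmult_le_compat_l; lra).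
assert (k * ((a - b) / (2 * (k + 1))) < a - b).
{ replace (k * ((a - b) / (2 * (k + 1)))) with ((a - b) * (k / (2 * (k + 1))))
    by (field; lra).
  assert (k / (2 * (k + 1)) < 1) by (apply Rlt_div_l; lra).
  nra. }
lra.
Qed.

(** * Complex derivatives *)

Notation is_Cderive := (is_derive (K := C_AbsRing) (V := C_NormedModule)).
Notation ex_Cderive := (ex_derive (K := C_AbsRing) (V := C_NormedModule)).

(** Trades the filter definition for an estimate on increments. The non-strict bound includes
    [h = 0], so later proofs need not single it out. *)
Lemma is_Cderive_iff (f : C -> C) (z l : C) :
  is_Cderive f z l <->
  forall e, 0 < e -> exists d, 0 < d /\ forall h, Cmod h < d ->
    Cmod (f (z + h)%C - f z - l * h)%C <= e * Cmod h.
Proof.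
split.
- intros [_ H] e He.
  destruct (H z (fun P HP => HP) (mkposreal e He)) as [d Hd].
  exists d; split; [apply cond_pos|]. intros h Hh.
  specialize (Hd (z + h)%C).
  assert (Hb : ball (M := AbsRing_UniformSpace C_AbsRing) z d (z + h)%C).
  { change (Cmod (z + h - z)%C < d). now replace (z + h - z)%C with h by ring. }
  specialize (Hd Hb).
  change (Cmod ((f (z + h)%C - f z) - (z + h - z) * l)%C <= e * Cmod (z + h - z)%C) in Hd.
  replace (z + h - z)%C with h in Hd by ring.
  replace (f (z + h)%C - f z - l * h)%C with ((f (z + h)%C - f z) - h * l)%C by ring.
  exact Hd.
- intro H. split; [apply is_linear_scal_l|].
  intros x Hx eps.
  apply (is_filter_lim_locally_unique (K := C_AbsRing)
           (V := AbsRing_NormedModule C_AbsRing)) in Hx.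
  subst x.
  destruct (H eps (cond_pos eps)) as [d [Hd Hb]].
  exists (mkposreal d Hd). change (forall y : C, Cmod (y - z)%C < d ->
    Cmod ((f y - f z) - (y - z) * l)%C <= eps * Cmod (y - z)%C).
  intros y Hy.
  specialize (Hb (y - z)%C Hy).
  replace (z + (y - z))%C with y in Hb by ring.
  replace (f y - f z - (y - z) * l)%C with (f y - f z - l * (y - z))%C by ring.
  exact Hb.
Qed.

Definition Ccont (f : C -> C) (z : C) : Prop :=
  forall e, 0 < e -> exists d, 0 < d /\ forall h, Cmod h < d ->
    Cmod (f (z + h)%C - f z)%C <= e.

Lemma is_Cderive_local_lipschitz (f : C -> C) (z l : C) : is_Cderive f z l ->
  exists d, 0 < d /\ forall h, Cmod h < d ->
    Cmod (f (z + h)%C - f z)%C <= (Cmod l + 1) * Cmod h.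
Proof.
intro H. rewrite is_Cderive_iff in H.
destruct (H 1 Rlt_0_1) as [d [Hd Hb]]. exists d; split; [exact Hd|].
intros h Hh. specialize (Hb h Hh).
pose proof (Cmod_triangle (f (z + h)%C - f z - l * h) (l * h)) as T.
replace (f (z + h)%C - f z - l * h + l * h)%C with (f (z + h)%C - f z)%C in T by ring.
rewrite Cmod_mult in T. lra.
Qed.

Lemma Ccont_of_local_lipschitz (f : C -> C) (z : C) (L d : R) : 0 < L -> 0 < d ->
  (forall h, Cmod h < d -> Cmod (f (z + h)%C - f z)%C <= L * Cmod h) -> Ccont f z.
Proof.
intros HL Hd H e He.
exists (Rmin d (e / L)). split.
- apply Rmin_glb_lt; [exact Hd|]. now apply Rdiv_lt_0_compat.
- intros h Hh.
  pose proof (Rmin_l d (e / L)). pose proof (Rmin_r d (e / L)).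
  eapply Rle_trans; [apply H; lra|].
  apply Rle_trans with (L * (e / L)).
  + apply Rmult_le_compat_l; lra.
  + right; field; lra.
Qed.

Lemma is_Cderive_Ccont (f : C -> C) (z l : C) : is_Cderive f z l -> Ccont f z.
Proof.
intro H. destruct (is_Cderive_local_lipschitz f z l H) as [d [Hd Hb]].
pose proof (Cmod_ge_0 l).
apply (Ccont_of_local_lipschitz f z (Cmod l + 1) d); auto; lra.
Qed.

Lemma is_Cderive_eq (f : C -> C) (z l l' : C) :
  is_Cderive f z l -> l = l' -> is_Cderive f z l'.
Proof. now intros H <-. Qed.

(* [C_NormedModule] and the ring [C] seen as a normed module over itself have
   the same norm but are not convertible structures. *)
Lemma is_Cderive_ring (f : C -> C) (z l : C) :
  is_derive (K := C_AbsRing) (V := AbsRing_NormedModule C_AbsRing) f z l <->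
  is_Cderive f z l.
Proof.
split; intros [_ H]; (split; [apply is_linear_scal_l|exact H]).
Qed.

Lemma is_Cderive_const (a z : C) : is_Cderive (fun _ => a) z (RtoC 0).
Proof. exact (is_derive_const (K := C_AbsRing) (V := C_NormedModule) a z). Qed.

Lemma is_Cderive_id (z : C) : is_Cderive (fun x => x) z (RtoC 1).
Proof. apply is_Cderive_ring. exact (is_derive_id (K := C_AbsRing) z). Qed.

Lemma is_Cderive_plus (f g : C -> C) (z a b : C) :
  is_Cderive f z a -> is_Cderive g z b ->
  is_Cderive (fun x => (f x + g x)%C) z (a + b)%C.
Proof. exact (is_derive_plus (K := C_AbsRing) (V := C_NormedModule) f g z a b). Qed.

Lemma is_Cderive_minus (f g : C -> C) (z a b : C) :
  is_Cderive f z a -> is_Cderive g z b ->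
  is_Cderive (fun x => (f x - g x)%C) z (a - b)%C.
Proof. exact (is_derive_minus (K := C_AbsRing) (V := C_NormedModule) f g z a b). Qed.

Lemma is_Cderive_mult (f g : C -> C) (z a b : C) :
  is_Cderive f z a -> is_Cderive g z b ->
  is_Cderive (fun x => (f x * g x)%C) z (a * g z + f z * b)%C.
Proof.
rewrite <- !is_Cderive_ring. intros Hf Hg.
exact (is_derive_mult (K := C_AbsRing) f g z a b Hf Hg Cmult_comm).
Qed.

Lemma is_Cderive_comp (f g : C -> C) (z a b : C) :
  is_Cderive f (g z) a -> is_Cderive g z b ->
  is_Cderive (fun x => f (g x)) z (b * a)%C.
Proof.
intros Hf Hg. apply is_Cderive_ring in Hg.
exact (is_derive_comp (K := C_AbsRing) (V := C_NormedModule) f g z a b Hf Hg).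
Qed.

Lemma is_Cderive_ext_loc (f g : C -> C) (z l : C) (d : R) : 0 < d ->
  (forall h, Cmod h < d -> f (z + h)%C = g (z + h)%C) ->
  is_Cderive f z l -> is_Cderive g z l.
Proof.
intros Hd He H. rewrite is_Cderive_iff in *. intros e Hpe.
destruct (H e Hpe) as [d' [Hd' Hb]].
exists (Rmin d d'). split; [now apply Rmin_glb_lt|].
intros h Hh. pose proof (Rmin_l d d'). pose proof (Rmin_r d d').
rewrite <- He by lra.
replace (g z) with (f z).
- apply Hb; lra.
- specialize (He 0%C). rewrite Cplus_0_r in He. apply He. rewrite Cmod_0; lra.
Qed.

(* Carathéodory's form: a difference times a merely continuous factor. *)
Lemma is_Cderive_increment_mult (f n : C -> C) (z l : C) :
  is_Cderive f z l -> Ccont n z ->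
  is_Cderive (fun x => ((f x - f z) * n x)%C) z (l * n z)%C.
Proof.
intros Hf Hn. rewrite is_Cderive_iff in *. intros e He.
pose proof (Cmod_ge_0 (n z)) as Nz. pose proof (Cmod_ge_0 l) as Nl.
set (e1 := e / (2 * (Cmod (n z) + 1))).
set (e2 := Rmin 1 (e / (2 * (Cmod l + 1)))).
assert (He1 : 0 < e1) by (apply Rdiv_lt_0_compat; lra).
assert (He2 : 0 < e2).
{ apply Rmin_glb_lt; [lra|]. apply Rdiv_lt_0_compat; lra. }
destruct (Hf e1 He1) as [d1 [Hd1 H1]].
destruct (Hn e2 He2) as [d2 [Hd2 H2]].
exists (Rmin d1 d2). split; [now apply Rmin_glb_lt|].
intros h Hh.
pose proof (Rmin_l d1 d2). pose proof (Rmin_r d1 d2).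
specialize (H1 h ltac:(lra)). specialize (H2 h ltac:(lra)).
replace ((f (z + h)%C - f z) * n (z + h)%C - (f z - f z) * n z - l * n z * h)%C
  with ((f (z + h)%C - f z - l * h) * n (z + h)%C + l * h * (n (z + h)%C - n z))%C by ring.
eapply Rle_trans; [apply Cmod_triangle|]. rewrite !Cmod_mult.
assert (Hnn : Cmod (n (z + h)%C)%C <= Cmod (n z) + 1).
{ pose proof (Cmod_ge_sub (n (z + h)%C) (n z)). pose proof (Rmin_l 1 (e / (2 * (Cmod l + 1)))).
  unfold e2 in H2. lra. }
pose proof (Cmod_ge_0 h) as Nh.
assert (A : Cmod (f (z + h)%C - f z - l * h)%C * Cmod (n (z + h)%C)%C <= e / 2 * Cmod h).
{ apply Rle_trans with (e1 * Cmod h * (Cmod (n z) + 1)).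
  - apply Rmult_le_compat; auto using Cmod_ge_0.
  - right; unfold e1; field; lra. }
assert (B : Cmod l * Cmod h * Cmod (n (z + h)%C - n z)%C <= e / 2 * Cmod h).
{ apply Rle_trans with ((Cmod l + 1) * Cmod h * (e / (2 * (Cmod l + 1)))).
  - apply Rmult_le_compat; auto using Cmod_ge_0, Rmult_le_pos.
    + apply Rmult_le_compat_r; lra.
    + eapply Rle_trans; [exact H2|apply Rmin_r].
  - right; field; lra. }
lra.
Qed.

Lemma Ccont_mult (f g : C -> C) (z : C) :
  Ccont f z -> Ccont g z -> Ccont (fun x => (f x * g x)%C) z.
Proof.
intros Hf Hg e He.
pose proof (Cmod_ge_0 (f z)) as Nf. pose proof (Cmod_ge_0 (g z)) as Ng.
set (e1 := e / (2 * (Cmod (g z) + 1))).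
set (e2 := Rmin 1 (e / (2 * (Cmod (f z) + 1)))).
assert (He1 : 0 < e1) by (apply Rdiv_lt_0_compat; lra).
assert (He2 : 0 < e2).
{ apply Rmin_glb_lt; [lra|]. apply Rdiv_lt_0_compat; lra. }
destruct (Hf e1 He1) as [d1 [Hd1 H1]].
destruct (Hg e2 He2) as [d2 [Hd2 H2]].
exists (Rmin d1 d2). split; [now apply Rmin_glb_lt|].
intros h Hh.
pose proof (Rmin_l d1 d2). pose proof (Rmin_r d1 d2).
specialize (H1 h ltac:(lra)). specialize (H2 h ltac:(lra)).
replace (f (z + h)%C * g (z + h)%C - f z * g z)%C
  with ((f (z + h)%C - f z) * g (z + h)%C + f z * (g (z + h)%C - g z))%C by ring.
eapply Rle_trans; [apply Cmod_triangle|]. rewrite !Cmod_mult.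
assert (Hnn : Cmod (g (z + h)%C)%C <= Cmod (g z) + 1).
{ pose proof (Cmod_ge_sub (g (z + h)%C) (g z)).
  pose proof (Rmin_l 1 (e / (2 * (Cmod (f z) + 1)))). unfold e2 in H2. lra. }
assert (A : Cmod (f (z + h)%C - f z)%C * Cmod (g (z + h)%C)%C <= e / 2).
{ apply Rle_trans with (e1 * (Cmod (g z) + 1)).
  - apply Rmult_le_compat; auto using Cmod_ge_0.
  - right; unfold e1; field; lra. }
assert (B : Cmod (f z) * Cmod (g (z + h)%C - g z)%C <= e / 2).
{ apply Rle_trans with ((Cmod (f z) + 1) * (e / (2 * (Cmod (f z) + 1)))).
  - apply Rmult_le_compat; auto using Cmod_ge_0; [lra|].
    eapply Rle_trans; [exact H2|apply Rmin_r].
  - right; field; lra. }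
lra.
Qed.

Lemma Ccont_inv (f : C -> C) (z : C) :
  Ccont f z -> f z <> 0%C -> Ccont (fun x => (/ f x)%C) z.
Proof.
intros Hf Hz e He.
pose proof (proj1 (Cmod_gt_0 _) Hz) as Np. set (m := Cmod (f z)) in *.
(* The first entry keeps the modulus of [f (z + h)] above [m / 2]; the second then bounds the
   difference of the inverses by [e]. *)
set (e1 := Rmin (m / 2) (e * m * m / 2)).
assert (He1 : 0 < e1).
{ apply Rmin_glb_lt; [lra|]. assert (0 < e * m * m) by (repeat apply Rmult_lt_0_compat; lra). lra. }
destruct (Hf e1 He1) as [d [Hd H1]].
exists d; split; [exact Hd|]. intros h Hh. specialize (H1 h Hh).
pose proof (Rmin_l (m / 2) (e * m * m / 2)). pose proof (Rmin_r (m / 2) (e * m * m / 2)).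
assert (Hl : m / 2 <= Cmod (f (z + h)%C)%C).
{ pose proof (Cmod_ge_sub (f z) (f (z + h)%C)) as T.
  rewrite Cmod_sub_sym in T. fold m in T. fold e1 in H. lra. }
assert (Hnz : f (z + h)%C <> 0%C) by (apply Cmod_gt_0; lra).
replace (/ f (z + h)%C - / f z)%C with (- (f (z + h)%C - f z) / (f (z + h)%C * f z))%C
  by (field; auto).
rewrite Cmod_div by (now apply Cmult_neq_0). rewrite Cmod_opp, Cmod_mult. fold m.
apply Rle_div_l; [nra|]. fold e1 in H, H0.
apply Rle_trans with (e * m * m / 2); [lra|].
assert (0 <= e * m) by nra.
assert (e * m * (m / 2) <= e * m * Cmod (f (z + h)%C)%C) by (apply Rmult_le_compat_l; lra).
lra.
Qed.

(** Near [z] one has 1/f = 1/f(z) - (1/f(z)) (f - f(z)) (1/f). The last factor is so far only known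
    to be continuous, which is what Carathéodory's form asks for. *)
Lemma is_Cderive_inv (f : C -> C) (z l : C) :
  is_Cderive f z l -> f z <> 0%C ->
  is_Cderive (fun x => (/ f x)%C) z (- l / (f z * f z))%C.
Proof.
intros Hf Hz.
pose proof (is_Cderive_Ccont _ _ _ Hf) as Hc.
assert (Hn : Ccont (fun x => (/ f x)%C) z) by now apply Ccont_inv.
pose proof (is_Cderive_increment_mult _ _ _ _ Hf Hn) as H1.
assert (exists d, 0 < d /\ forall h, Cmod h < d -> f (z + h)%C <> 0%C)
  as [d [Hd Hnz]].
{ pose proof (proj1 (Cmod_gt_0 _) Hz) as Np.
  destruct (Hc (Cmod (f z) / 2)) as [d [Hd H2]]; [lra|].
  exists d; split; [exact Hd|]. intros h Hh E.
  specialize (H2 h Hh). rewrite E in H2.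
  replace (0 - f z)%C with (- f z)%C in H2 by ring. rewrite Cmod_opp in H2. lra. }
apply (is_Cderive_ext_loc
  (fun x => (/ f z + (- / f z) * ((f x - f z) * / f x))%C)) with d; [exact Hd| |].
- intros h Hh. specialize (Hnz h Hh). field. auto.
- eapply is_Cderive_eq.
  + apply is_Cderive_plus; [apply is_Cderive_const|].
    apply is_Cderive_mult; [apply is_Cderive_const|exact H1].
  + simpl. field. auto.
Qed.

(** * Curves *)

Definition curve_derive (c : R -> C) (t : R) (l : C) : Prop :=
  forall e, 0 < e -> exists d, 0 < d /\ forall h, Rabs h < d ->
    Cmod (c (t + h)%R - c t - l * h)%C <= e * Rabs h.

Lemma curve_derive_comp (f : C -> C) (c : R -> C) (t : R) (l v : C) :
  is_Cderive f (c t) l -> curve_derive c t v ->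
  curve_derive (fun s => f (c s)) t (l * v)%C.
Proof.
intros Hf Hc e He. rewrite is_Cderive_iff in Hf.
pose proof (Cmod_ge_0 v) as Nv. pose proof (Cmod_ge_0 l) as Nl.
set (e1 := e / (2 * (Cmod v + 1))).
set (e2 := Rmin 1 (e / (2 * (Cmod l + 1)))).
assert (He1 : 0 < e1) by (apply Rdiv_lt_0_compat; lra).
assert (He2 : 0 < e2).
{ apply Rmin_glb_lt; [lra|]. apply Rdiv_lt_0_compat; lra. }
destruct (Hf e1 He1) as [d1 [Hd1 H1]].
destruct (Hc e2 He2) as [d2 [Hd2 H2]].
exists (Rmin d2 (d1 / (Cmod v + 1))). split.
{ apply Rmin_glb_lt; [exact Hd2|]. apply Rdiv_lt_0_compat; lra. }
intros h Hh.
pose proof (Rmin_l d2 (d1 / (Cmod v + 1))). pose proof (Rmin_r d2 (d1 / (Cmod v + 1))).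
specialize (H2 h ltac:(lra)).
pose proof (Rabs_pos h) as Nh.
assert (Hk : Cmod (c (t + h)%R - c t)%C <= (Cmod v + 1) * Rabs h).
{ pose proof (Cmod_triangle (c (t + h)%R - c t - v * h) (v * h)) as T.
  replace (c (t + h)%R - c t - v * h + v * h)%C with (c (t + h)%R - c t)%C in T by ring.
  rewrite Cmod_mult, Cmod_R in T.
  pose proof (Rmin_l 1 (e / (2 * (Cmod l + 1)))). fold e2 in H3. nra. }
set (k := (c (t + h)%R - c t)%C) in *.
assert (Hkd : Cmod k < d1).
{ apply Rle_lt_trans with (1 := Hk). rewrite Rmult_comm. apply Rlt_div_r; [lra|]. lra. }
specialize (H1 k Hkd).
replace (c t + k)%C with (c (t + h)%R) in H1 by (unfold k; ring).
replace (f (c (t + h)%R) - f (c t) - l * v * h)%C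
  with ((f (c (t + h)%R) - f (c t) - l * k) + l * (k - v * h))%C by ring.
eapply Rle_trans; [apply Cmod_triangle|]. rewrite Cmod_mult.
assert (A : e1 * Cmod k <= e / 2 * Rabs h).
{ apply Rle_trans with (e1 * ((Cmod v + 1) * Rabs h)).
  - apply Rmult_le_compat_l; lra.
  - right; unfold e1; field; lra. }
assert (B : Cmod l * Cmod (k - v * h)%C <= e / 2 * Rabs h).
{ apply Rle_trans with ((Cmod l + 1) * ((e / (2 * (Cmod l + 1))) * Rabs h)).
  - apply Rmult_le_compat; auto using Cmod_ge_0; [lra|].
    eapply Rle_trans; [exact H2|]. apply Rmult_le_compat_r; [lra|apply Rmin_r].
  - right; field; lra. }
lra.
Qed.

Lemma is_derive_R_of_le (f : R -> R) (t l : R) :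
  (forall e, 0 < e -> exists d, 0 < d /\ forall h, Rabs h < d ->
    Rabs (f (t + h) - f t - l * h) <= e * Rabs h) -> is_derive f t l.
Proof.
intros H. apply is_derive_Reals. intros e He.
destruct (H (e / 2)) as [d [Hd Hb]]; [lra|].
exists (mkposreal d Hd). intros h Hh Hhd. specialize (Hb h Hhd).
replace ((f (t + h) - f t) / h - l) with ((f (t + h) - f t - l * h) / h) by (field; auto).
unfold Rdiv. rewrite Rabs_mult, Rabs_inv.
pose proof (Rabs_pos_lt _ Hh).
apply Rle_lt_trans with (e / 2); [|lra].
apply Rle_div_l; auto.
Qed.

Lemma curve_derive_Re (c : R -> C) (t : R) (l : C) :
  curve_derive c t l -> is_derive (fun s => Re (c s)) t (Re l).
Proof.
intro H. apply is_derive_R_of_le. intros e He.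
destruct (H e He) as [d [Hd Hb]]. exists d; split; [exact Hd|].
intros h Hh. specialize (Hb h Hh). eapply Rle_trans; [|exact Hb].
eapply Rle_trans; [|apply re_le_Cmod]. right. f_equal.
unfold Re; simpl. ring.
Qed.

Lemma curve_derive_Im (c : R -> C) (t : R) (l : C) :
  curve_derive c t l -> is_derive (fun s => Im (c s)) t (Im l).
Proof.
intro H. apply is_derive_R_of_le. intros e He.
destruct (H e He) as [d [Hd Hb]]. exists d; split; [exact Hd|].
intros h Hh. specialize (Hb h Hh). eapply Rle_trans; [|exact Hb].
eapply Rle_trans; [|apply im_le_Cmod]. right. f_equal.
unfold Im; simpl. ring.
Qed.

Lemma is_derive_R_le (f : R -> R) (t l : R) : is_derive f t l ->
  forall e, 0 < e -> exists d, 0 < d /\ forall h, Rabs h < d ->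
    Rabs (f (t + h) - f t - l * h) <= e * Rabs h.
Proof.
intros H e He. apply is_derive_Reals in H.
destruct (H e He) as [d Hd]. exists d; split; [apply cond_pos|].
intros h Hh. destruct (Req_dec h 0) as [->|Hn].
- rewrite Rplus_0_r, Rmult_0_r, Rabs_R0.
  replace (f t - f t - 0) with 0 by ring. rewrite Rabs_R0; lra.
- specialize (Hd h Hn Hh).
  replace (f (t + h) - f t - l * h) with (((f (t + h) - f t) / h - l) * h) by (field; auto).
  rewrite Rabs_mult. apply Rmult_le_compat_r; [apply Rabs_pos|lra].
Qed.

Lemma curve_derive_pair (c : R -> C) (t : R) (l : C) :
  is_derive (fun s => Re (c s)) t (Re l) -> is_derive (fun s => Im (c s)) t (Im l) ->
  curve_derive c t l.
Proof.
intros H1 H2 e He.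
destruct (is_derive_R_le _ _ _ H1 (e / 2)) as [d1 [Hd1 Hb1]]; [lra|].
destruct (is_derive_R_le _ _ _ H2 (e / 2)) as [d2 [Hd2 Hb2]]; [lra|].
exists (Rmin d1 d2); split; [now apply Rmin_glb_lt|].
intros h Hh. pose proof (Rmin_l d1 d2). pose proof (Rmin_r d1 d2).
specialize (Hb1 h ltac:(lra)). specialize (Hb2 h ltac:(lra)).
apply Cmod_le_sqr.
- apply Rmult_le_pos; [lra|apply Rabs_pos].
- pose proof (Rabs_pos h).
  set (x := Re (c (t + h)%R) - Re (c t) - Re l * h) in *.
  set (y := Im (c (t + h)%R) - Im (c t) - Im l * h) in *.
  replace (Re (c (t + h)%R - c t - l * h)) with x by (unfold x, Re; simpl; ring).
  replace (Im (c (t + h)%R - c t - l * h)) with y by (unfold y, Im; simpl; ring).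
  apply Rabs_le_between in Hb1. apply Rabs_le_between in Hb2.
  set (q := Rabs h) in *. nra.
Qed.

Lemma curve_derive_line (a b : C) (t : R) : curve_derive (fun s => (a + s * b)%C) t b.
Proof.
intros e He. exists 1; split; [lra|]. intros h _.
replace (a + (t + h)%R * b - (a + t * b) - b * h)%C with (RtoC 0) by (rewrite RtoC_plus; ring).
rewrite Cmod_0. apply Rmult_le_pos; [lra|apply Rabs_pos].
Qed.

Lemma curve_derive_minus (f g : R -> C) (t : R) (a b : C) :
  curve_derive f t a -> curve_derive g t b ->
  curve_derive (fun s => (f s - g s)%C) t (a - b)%C.
Proof.
intros Hf Hg.
apply curve_derive_pair.
- apply (is_derive_ext (fun s => Re (f s) - Re (g s))); [intro; unfold Re; simpl; ring|].
  replace (Re (a - b)) with (Re a - Re b) by (unfold Re; simpl; ring).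
  apply @is_derive_minus; now apply curve_derive_Re.
- apply (is_derive_ext (fun s => Im (f s) - Im (g s))); [intro; unfold Im; simpl; ring|].
  replace (Im (a - b)) with (Im a - Im b) by (unfold Im; simpl; ring).
  apply @is_derive_minus; now apply curve_derive_Im.
Qed.

Lemma curve_derive_Re_scal (c : R -> C) (t : R) (k l : C) :
  curve_derive c t l -> is_derive (fun s => Re (k * c s)) t (Re (k * l)).
Proof.
intro H.
apply (is_derive_ext (fun s => Re k * Re (c s) - Im k * Im (c s)));
  [intro; unfold Re, Im; simpl; ring|].
replace (Re (k * l)) with (Re k * Re l - Im k * Im l) by (unfold Re, Im; simpl; ring).
apply @is_derive_minus; apply is_derive_scal;
  [now apply curve_derive_Re | now apply curve_derive_Im].
Qed.

Lemma is_derive_continuity_pt (f : R -> R) (x l : R) : is_derive f x l -> continuity_pt f x.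
Proof.
intro H. apply derivable_continuous_pt. exists l. now apply is_derive_Reals.
Qed.

(** Mean value theorem for [m - f], in Cauchy's form with [id] as the second function. Derivatives
    are compared on the open interval because along rays the comparison is available for [t > 0]
    only. *)
Lemma increment_le (f m df dm : R -> R) (a b : R) : a <= b ->
  (forall t, a <= t <= b -> continuity_pt f t) ->
  (forall t, a <= t <= b -> continuity_pt m t) ->
  (forall t, a < t < b -> is_derive f t (df t)) ->
  (forall t, a < t < b -> is_derive m t (dm t)) ->
  (forall t, a < t < b -> df t <= dm t) ->
  f b - f a <= m b - m a.
Proof.
intros Hab Cf Cm Df Dm Hle.
destruct (Req_dec a b) as [->|Hne]; [lra|].
assert (Hlt : a < b) by lra.
assert (pr : forall c, a < c < b -> derivable_pt (fun t => m t - f t) c).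
{ intros c Hc. exists (dm c - df c). apply is_derive_Reals.
  apply @is_derive_minus; [now apply Dm | now apply Df]. }
assert (pr' : forall c, a < c < b -> derivable_pt id c).
{ intros; apply derivable_pt_id. }
destruct (MVT (fun t => m t - f t) id a b pr pr' Hlt) as [c [P E]].
- intros c Hc. apply continuity_pt_minus; auto.
- intros c Hc. apply derivable_continuous_pt, derivable_pt_id.
- assert (E1 : derive_pt (fun t => m t - f t) c (pr c P) = dm c - df c).
  { apply derive_pt_eq_0. apply is_derive_Reals.
    apply @is_derive_minus; [now apply Dm | now apply Df]. }
  assert (E2 : derive_pt id c (pr' c P) = 1).
  { apply derive_pt_eq_0. apply derivable_pt_lim_id. }
  rewrite E1, E2 in E. unfold id in E. specialize (Hle c P). nra.
Qed.

(* Project the displacement on its own direction. *)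
Lemma curve_mean_value_le (c dc : R -> C) (m dm : R -> R) (a b : R) : a <= b ->
  (forall t, a <= t <= b -> curve_derive c t (dc t)) ->
  (forall t, a <= t <= b -> is_derive m t (dm t)) ->
  (forall t, a < t < b -> Cmod (dc t) <= dm t) ->
  Cmod (c b - c a)%C <= m b - m a.
Proof.
intros Hab Hc Hm Hle.
set (D := (c b - c a)%C).
(* A zero displacement has no direction to project on; what remains is that [m] does not
   decrease. *)
destruct (Ceq_dec D 0%C) as [E|Hn].
{ rewrite E, Cmod_0.
  pose proof (increment_le (fun _ => 0) m (fun _ => 0) dm a b Hab) as H.
  assert (0 - 0 <= m b - m a); [|lra]. apply H.
  - intros; apply continuity_pt_const. now intros ? ?.
  - intros t Ht; eapply is_derive_continuity_pt; apply Hm; lra.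
  - intros; apply (is_derive_const (V := R_NormedModule)).
  - intros t Ht; apply Hm; lra.
  - intros t Ht. eapply Rle_trans; [apply Cmod_ge_0|]. now apply Hle. }
pose proof (proj1 (Cmod_gt_0 _) Hn) as Np.
pose proof (increment_le (fun t => Re (Cconj D * c t)) (fun t => Cmod D * m t)
  (fun t => Re (Cconj D * dc t)) (fun t => Cmod D * dm t) a b Hab) as H.
assert (H' : Re (Cconj D * c b) - Re (Cconj D * c a) <= Cmod D * m b - Cmod D * m a).
{ apply H.
  - intros t Ht. eapply is_derive_continuity_pt. apply curve_derive_Re_scal. now apply Hc.
  - intros t Ht. eapply is_derive_continuity_pt. apply is_derive_scal. now apply Hm.
  - intros t Ht. apply curve_derive_Re_scal. apply Hc; lra.
  - intros t Ht. apply is_derive_scal. apply Hm; lra.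
  - intros t Ht. eapply Rle_trans; [apply Re_le_Cmod'|].
    rewrite Cmod_mult, Cmod_conj. apply Rmult_le_compat_l; [lra|]. now apply Hle. }
assert (E : Re (Cconj D * c b) - Re (Cconj D * c a) = Cmod D * Cmod D).
{ rewrite Cmod_sqr. unfold D, Re, Im; simpl; ring. }
rewrite E in H'. apply Rmult_le_reg_l with (Cmod D); [exact Np|]. lra.
Qed.

(** Subtract the quadratic polynomial: the difference [q] has derivative f1(x) - f1(z) - c (x - z),
    which is o(|h|) on the segment by differentiability of [f1] at [z] alone. The mean value
    inequality contributes the second factor |h|. *)
Lemma taylor_order2 (f f1 : C -> C) (z c : C) (rho : R) : 0 < rho ->
  (forall h, Cmod h < rho -> is_Cderive f (z + h)%C (f1 (z + h)%C)) ->
  is_Cderive f1 z c ->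
  forall e, 0 < e -> exists d, 0 < d /\ forall h, Cmod h < d ->
    Cmod (f (z + h)%C - (f z + f1 z * h + c / 2 * (h * h)))%C <= e * (Cmod h * Cmod h).
Proof.
intros Hr Hf H1 e He. rewrite is_Cderive_iff in H1.
destruct (H1 e He) as [d [Hd Hb]].
exists (Rmin d rho); split; [now apply Rmin_glb_lt|].
intros h Hh. pose proof (Rmin_l d rho). pose proof (Rmin_r d rho).
pose proof (Cmod_ge_0 h) as Nh.
set (q := fun x : C => (f x - (f1 z * (x - z) + c / 2 * ((x - z) * (x - z))))%C).
set (dq := fun x : C => (f1 x - f1 z - c * (x - z))%C).
assert (Hth : forall t, 0 <= t <= 1 -> Cmod (t * h)%C <= t * Cmod h).
{ intros t Ht. rewrite Cmod_mult, Cmod_R, Rabs_pos_eq; lra. }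
assert (Hq : forall t, 0 <= t <= 1 -> is_Cderive q (z + t * h)%C (dq (z + t * h)%C)).
{ intros t Ht. unfold q, dq. eapply is_Cderive_eq.
  - apply is_Cderive_minus.
    + apply Hf. specialize (Hth t Ht). nra.
    + apply is_Cderive_plus.
      * apply is_Cderive_mult; [apply is_Cderive_const|].
        apply is_Cderive_minus; [apply is_Cderive_id|apply is_Cderive_const].
      * apply is_Cderive_mult; [apply is_Cderive_const|].
        apply is_Cderive_mult; apply is_Cderive_minus;
          try apply is_Cderive_id; apply is_Cderive_const.
  - cbv beta; field. }
pose proof (curve_mean_value_le (fun t => q (z + t * h)%C)
  (fun t => (dq (z + t * h)%C * h)%C)
  (fun t => e * (Cmod h * Cmod h) * t) (fun _ => e * (Cmod h * Cmod h)) 0 1) as M.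
replace (f (z + h)%C - (f z + f1 z * h + c / 2 * (h * h)))%C
  with (q (z + 1 * h)%C - q (z + 0 * h)%C)%C.
2:{ unfold q. replace (z + 0 * h)%C with z by ring. replace (z + 1 * h)%C with (z + h)%C by ring.
    field. }
eapply Rle_trans; [apply M|right; ring].
- lra.
- intros t Ht. apply (curve_derive_comp q (fun t => (z + t * h)%C)); [now apply Hq|].
  apply curve_derive_line.
- intros t Ht. auto_derive; [auto|ring].
- intros t Ht. rewrite Cmod_mult. unfold dq.
  specialize (Hth t ltac:(lra)).
  specialize (Hb (t * h)%C ltac:(nra)).
  replace (z + t * h - z)%C with (t * h)%C by ring.
  apply Rle_trans with (e * Cmod (t * h)%C * Cmod h).
  + apply Rmult_le_compat_r; [exact Nh|exact Hb].
  + assert (Cmod (t * h)%C * Cmod h <= Cmod h * Cmod h) by nra. nra.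
Qed.

(** * Compactness of the closed disk *)

Definition Rcont (W : C -> R) (z : C) : Prop :=
  forall e, 0 < e -> exists d, 0 < d /\ forall h, Cmod h < d ->
    Rabs (W (z + h)%C - W z) <= e.

Definition cis (t : R) : C := (cos t, sin t).

Lemma Cmod_cis (t : R) : Cmod (cis t) = 1.
Proof.
unfold cis, Cmod; simpl.
replace (cos t * (cos t * 1) + sin t * (sin t * 1)) with 1.
- apply sqrt_1.
- pose proof (sin2_cos2 t) as H. unfold Rsqr in H. lra.
Qed.

Lemma cis_plus (s t : R) : cis (s + t) = (cis s * cis t)%C.
Proof. unfold cis, Cmult; simpl. rewrite cos_plus, sin_plus. f_equal; ring. Qed.

Lemma curve_derive_cis (t : R) : curve_derive cis t (Ci * cis t)%C.
Proof.
apply curve_derive_pair; unfold cis, Re, Im; simpl.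
- auto_derive; [auto|ring].
- auto_derive; [auto|ring].
Qed.

Lemma cis_lipschitz (s t : R) : Cmod (cis t - cis s)%C <= Rabs (t - s).
Proof.
assert (H : forall a b, a <= b -> Cmod (cis b - cis a)%C <= b - a).
{ intros a b Hab.
  apply (curve_mean_value_le cis (fun t => (Ci * cis t)%C) (fun t => t) (fun _ => 1)); auto.
  - intros; apply curve_derive_cis.
  - intros; apply (is_derive_id (K := R_AbsRing)).
  - intros x _. rewrite Cmod_mult, Cmod_cis, Cmod_Ci. lra. }
destruct (Rle_dec s t) as [Hl|Hl].
- rewrite Rabs_pos_eq by lra. now apply H.
- rewrite Rabs_left by lra. rewrite Cmod_sub_sym. replace (- (t - s)) with (s - t) by ring.
  apply H; lra.
Qed.

Lemma polar_form (z : C) : exists t, 0 <= t <= 2 * PI /\ z = (Cmod z * cis t)%C.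
Proof.
pose proof PI_RGT_0.
destruct (Req_dec (Cmod z) 0) as [E|Hn].
{ exists 0; split; [lra|]. rewrite (Cmod_eq_0 z E), Cmod_0. ring. }
pose proof (Cmod_ge_0 z). pose proof (Cmod_sqr z) as S.
set (m := Cmod z) in *. set (x := Re z) in *. set (y := Im z) in *.
assert (Hx : x = m * (x / m)) by (field; auto).
assert (Hy : y = m * (y / m)) by (field; auto).
assert (S1 : x / m * (x / m) + y / m * (y / m) = 1).
{ transitivity ((x * x + y * y) / (m * m)); [field; auto|]. rewrite <- S. field; auto. }
set (a := x / m) in *. set (b := y / m) in *.
assert (Ha : -1 <= a <= 1) by nra.
assert (Hs : sqrt (1 - a * a) = Rabs b).
{ replace (1 - a * a) with (Rsqr b) by (unfold Rsqr; lra). apply sqrt_Rsqr_abs. }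
pose proof (acos_bound a).
assert (Hz : z = (x, y)) by apply surjective_pairing.
assert (Hsin : sin (acos a) = Rabs b).
{ rewrite sin_acos by lra. unfold Rsqr. exact Hs. }
destruct (Rle_dec 0 b) as [Hb|Hb].
- exists (acos a). split; [lra|]. rewrite Hz. unfold cis, Cmult; simpl.
  rewrite cos_acos by lra. rewrite Hsin, Rabs_pos_eq by lra.
  rewrite Hx at 1; rewrite Hy at 1. f_equal; ring.
- exists (2 * PI - acos a). split; [lra|]. rewrite Hz. unfold cis, Cmult; simpl.
  rewrite cos_minus, sin_minus, cos_2PI, sin_2PI, cos_acos by lra.
  rewrite Hsin, Rabs_left by lra.
  rewrite Hx at 1; rewrite Hy at 1. f_equal; ring.
Qed.

Lemma polar_lipschitz (r s r' s' : R) :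
  Cmod (r * cis s - r' * cis s')%C <= Rabs (r - r') + Rabs r' * Rabs (s - s').
Proof.
replace (r * cis s - r' * cis s')%C
  with ((r - r')%R * cis s + r' * (cis s - cis s'))%C by (rewrite RtoC_minus; ring).
eapply Rle_trans; [apply Cmod_triangle|].
rewrite !Cmod_mult, Cmod_cis, !Cmod_R.
pose proof (cis_lipschitz s' s). pose proof (Rabs_pos r'). nra.
Qed.

(** Iterated maximum: maximise over [y] for fixed [x], then maximise the resulting function [m] of
    [x], which is continuous because [f] is uniformly continuous on the rectangle. *)
Lemma rectangle_max (f : R -> R -> R) (a b c d : R) : a <= b -> c <= d ->
  (forall x y, a <= x <= b -> c <= y <= d -> continuity_2d_pt f x y) ->
  exists x0 y0, a <= x0 <= b /\ c <= y0 <= d /\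
    forall x y, a <= x <= b -> c <= y <= d -> f x y <= f x0 y0.
Proof.
intros Hab Hcd Hc.
set (P := fun x M => (exists y, c <= y <= d /\ f x y = M) /\
                     forall y, c <= y <= d -> f x y <= M).
assert (HP : forall x, a <= x <= b -> exists M, P x M).
{ intros x Hx.
  destruct (continuity_ab_maj (f x) c d Hcd) as [y0 [H1 H2]].
  - intros y Hy. apply continuity_pt_locally. intro eps.
    destruct (Hc x y Hx Hy eps) as [dl Hd]. exists dl. intros v Hv.
    apply Hd; [|exact Hv]. rewrite Rminus_diag, Rabs_R0. apply cond_pos.
  - exists (f x y0). split; [exists y0; auto|exact H1]. }
(* Clamping to [[a, b]] makes [m] meaningful on the whole line, so that two-sided continuity can be
   proved at the endpoints as well. *)
set (cl := fun x => Rmax a (Rmin b x)).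
assert (Hcl : forall x, a <= cl x <= b).
{ intro x. unfold cl. split; [apply Rmax_l|].
  apply Rmax_lub; [exact Hab|apply Rmin_l]. }
assert (Hcl' : forall x, a <= x <= b -> cl x = x).
{ intros x Hx. unfold cl. rewrite Rmin_right by lra. now rewrite Rmax_right by lra. }
assert (Hlip : forall x u, Rabs (cl u - cl x) <= Rabs (u - x)).
{ intros x u. unfold cl, Rmax, Rmin.
  repeat destruct Rle_dec; unfold Rabs; repeat destruct Rcase_abs; lra. }
set (m := fun x => epsilon (inhabits 0) (P (cl x))).
assert (Hm : forall x, P (cl x) (m x)).
{ intro x. apply epsilon_spec. apply HP, Hcl. }
destruct (continuity_ab_maj m a b Hab) as [x0 [Hx0 Hin]].
- intros x Hx. apply continuity_pt_locally. intro eps.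
  destruct (uniform_continuity_2d f a b c d Hc (pos_div_2 eps)) as [dl Hd].
  exists dl. intros u Hu. change (Rabs (u - x) < dl) in Hu.
  assert (K : forall s t, Rabs (cl s - cl t) < dl -> m s <= m t + eps / 2).
  { intros s t Hst. destruct (Hm s) as [[y [Hy E]] _]. destruct (Hm t) as [_ Ht].
    specialize (Ht y Hy). rewrite <- E.
    specialize (Hd (cl t) y (cl s) y (Hcl t) Hy (Hcl s) Hy Hst).
    rewrite Rminus_diag, Rabs_R0 in Hd. specialize (Hd (cond_pos dl)).
    simpl in Hd. apply Rabs_lt_between in Hd. lra. }
  pose proof (Hlip x u) as L1. pose proof (Hlip u x) as L2.
  rewrite (Rabs_minus_sym x u) in L2.
  pose proof (K u x ltac:(lra)). pose proof (K x u ltac:(lra)).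
  pose proof (cond_pos eps).
  apply Rabs_lt_between. lra.
- destruct (Hm x0) as [[y0 [Hy0 E]] _]. rewrite Hcl' in E by exact Hin.
  exists x0, y0. repeat split; try lra.
  intros x y Hx Hy. rewrite E. specialize (Hx0 x Hx).
  destruct (Hm x) as [_ H]. rewrite Hcl' in H by exact Hx.
  specialize (H y Hy). lra.
Qed.

(** Polar coordinates map a compact rectangle onto the disk and are Lipschitz there. *)
Lemma disk_max (W : C -> R) (r : R) : 0 <= r ->
  (forall z, Cmod z <= r -> Rcont W z) ->
  exists z0, Cmod z0 <= r /\ forall z, Cmod z <= r -> W z <= W z0.
Proof.
intros Hr HW. pose proof PI_RGT_0.
assert (Hpol : forall x y, 0 <= x -> Cmod (x * cis y)%C = x).
{ intros x y Hx. rewrite Cmod_mult, Cmod_cis, Cmod_R, Rabs_pos_eq; lra. }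
destruct (rectangle_max (fun x y => W (x * cis y)%C) 0 r 0 (2 * PI)) as
  [x0 [y0 [Hx0 [Hy0 Hmax]]]]; try lra.
- intros x y Hx Hy eps.
  destruct (HW (x * cis y)%C) with (e := eps / 2) as [d [Hd Hb]].
  { rewrite Hpol; lra. }
  { pose proof (cond_pos eps); lra. }
  assert (Hd' : 0 < d / (2 * (r + 1))) by (apply Rdiv_lt_0_compat; lra).
  exists (mkposreal _ Hd'). simpl. intros u v Hu Hv.
  specialize (Hb (u * cis v - x * cis y)%C).
  replace (x * cis y + (u * cis v - x * cis y))%C with (u * cis v)%C in Hb by ring.
  eapply Rle_lt_trans; [apply Hb|pose proof (cond_pos eps); lra].
  eapply Rle_lt_trans; [apply polar_lipschitz|].
  rewrite (Rabs_pos_eq x) by lra.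
  assert (E : d = (r + 1) * (d / (2 * (r + 1))) + (r + 1) * (d / (2 * (r + 1))))
    by (field; lra).
  set (q := d / (2 * (r + 1))) in *. rewrite E.
  pose proof (Rabs_pos (v - y)). nra.
- exists (x0 * cis y0)%C. rewrite Hpol by lra. split; [lra|].
  intros z Hz. destruct (polar_form z) as [t [Ht E]].
  rewrite E. apply Hmax; auto. split; [apply Cmod_ge_0|exact Hz].
Qed.

Lemma Rcont_Cmod_sqr (f : C -> C) (z : C) : Ccont f z ->
  Rcont (fun x => Cmod (f x) * Cmod (f x)) z.
Proof.
intros Hf e He. pose proof (Cmod_ge_0 (f z)) as Nf.
set (e1 := Rmin 1 (e / (2 * Cmod (f z) + 1))).
assert (He1 : 0 < e1).
{ apply Rmin_glb_lt; [lra|]. apply Rdiv_lt_0_compat; lra. }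
destruct (Hf e1 He1) as [d [Hd Hb]]. exists d; split; [exact Hd|].
intros h Hh. specialize (Hb h Hh).
pose proof (Rmin_l 1 (e / (2 * Cmod (f z) + 1))).
pose proof (Rmin_r 1 (e / (2 * Cmod (f z) + 1))) as H2. fold e1 in H, H2.
assert (H3 : e1 * (2 * Cmod (f z) + 1) <= e).
{ apply Rle_div_r; [lra|exact H2]. }
pose proof (Cmod_ge_sub (f (z + h)%C) (f z)) as T1.
pose proof (Cmod_ge_sub (f z) (f (z + h)%C)) as T2. rewrite Cmod_sub_sym in T2.
pose proof (Cmod_ge_0 (f (z + h)%C)).
apply Rabs_le_between. split; nra.
Qed.

Lemma Rcont_plus_scal (V W : C -> R) (k : R) (z : C) : 0 < k ->
  Rcont V z -> Rcont W z -> Rcont (fun x => V x + k * W x) z.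
Proof.
intros Hk HV HW e He.
destruct (HV (e / 2)) as [d1 [Hd1 H1]]; [lra|].
destruct (HW (e / (2 * k))) as [d2 [Hd2 H2]]; [apply Rdiv_lt_0_compat; lra|].
exists (Rmin d1 d2); split; [now apply Rmin_glb_lt|].
intros h Hh. pose proof (Rmin_l d1 d2). pose proof (Rmin_r d1 d2).
specialize (H1 h ltac:(lra)). specialize (H2 h ltac:(lra)).
replace (V (z + h)%C + k * W (z + h)%C - (V z + k * W z))
  with ((V (z + h)%C - V z) + k * (W (z + h)%C - W z)) by ring.
eapply Rle_trans; [apply Rabs_triang|]. rewrite Rabs_mult, (Rabs_pos_eq k) by lra.
assert (k * Rabs (W (z + h)%C - W z) <= k * (e / (2 * k))) by (apply Rmult_le_compat_l; lra).
replace (k * (e / (2 * k))) with (e / 2) in H3 by (field; lra). lra.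
Qed.

(** * The maximum principle *)

(** The origin is left out so that [/ z] belongs to the class: Schwarz's lemma works with powers of
    [f z / z]. *)
Definition twice_derivable (f : C -> C) : Prop :=
  exists f1 : C -> C, forall z, 0 < Cmod z < 1 ->
    is_Cderive f z (f1 z) /\ ex_Cderive f1 z.

(* The sum of [|f|^2] over the four points [z +- d, z +- i d] exceeds [4 |f z|^2]
   up to [o(d^2)]: the first and second order terms average out. *)
Lemma four_point_lower (k0 a b : C) (d : R) :
  let E h := (k0 + a * h + b * (h * h))%C in
  let N x := Cmod x * Cmod x in
  4 * N k0 <= N (E (RtoC d)) + N (E (- RtoC d)%C) + N (E (Ci * d)%C) + N (E (- (Ci * d))%C).
Proof.
cbv zeta beta. rewrite !Cmod_sqr. destruct k0 as [p q], a as [a1 a2], b as [b1 b2].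
unfold Re, Im; simpl. 
match goal with |- ?l <= ?r => replace r with
  (4 * (p * p + q * q) + 4 * (d * d) * (a1 * a1 + a2 * a2)
   + 4 * (d * d) * (d * d) * (b1 * b1 + b2 * b2)) by ring end.
pose proof (Rle_0_sqr d). pose proof (Rle_0_sqr a1). pose proof (Rle_0_sqr a2).
pose proof (Rle_0_sqr b1). pose proof (Rle_0_sqr b2). unfold Rsqr in *.
assert (0 <= (d * d) * (a1 * a1 + a2 * a2)) by (apply Rmult_le_pos; lra).
assert (0 <= (d * d) * (d * d) * (b1 * b1 + b2 * b2))
  by (apply Rmult_le_pos; [apply Rmult_le_pos|]; lra).
lra.
Qed.

(** Measures the strict gain of the perturbation: the term [eps * |z|^2] contributes [4 * eps * d^2]
    in excess of four times its central value. *)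
Lemma four_point_norms (z : C) (d : R) :
  let N x := Cmod x * Cmod x in
  N (z + RtoC d)%C + N (z + - RtoC d)%C + N (z + Ci * d)%C + N (z + - (Ci * d))%C
  = 4 * N z + 4 * (d * d).
Proof. cbv zeta beta. rewrite !Cmod_sqr. destruct z. unfold Re, Im; simpl. ring. Qed.

(** Sum the maximality inequality over the four points z0 +- d, z0 +- i d. The quadratic Taylor
    polynomial of [k] loses nothing on average, the perturbation gains [4 * eps * d^2], and the
    Taylor remainder costs at most half of that. *)
Lemma not_interior_max (k k1 : C -> C) (z0 : C) (rho eps : R) : 0 < rho -> 0 < eps ->
  (forall h, Cmod h < rho -> is_Cderive k (z0 + h)%C (k1 (z0 + h)%C)) ->
  ex_Cderive k1 z0 ->
  ~ (forall h, Cmod h < rho ->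
       Cmod (k (z0 + h)%C) * Cmod (k (z0 + h)%C)
         + eps * (Cmod (z0 + h)%C * Cmod (z0 + h)%C)
       <= Cmod (k z0) * Cmod (k z0) + eps * (Cmod z0 * Cmod z0)).
Proof.
intros Hr He Hk [c Hc] Hmax.
(* Bounds the Taylor polynomial [E h] for increments of modulus at most 1. *)
set (M := Cmod (k z0) + Cmod (k1 z0) + Cmod (c / 2)%C).
assert (HM : 0 <= M) by (unfold M; pose proof (Cmod_ge_0 (k z0)); pose proof (Cmod_ge_0 (k1 z0));
  pose proof (Cmod_ge_0 (c / 2)%C); lra).
(* Replacing [k] by its Taylor polynomial changes the squared modulus by at most [2 * M * eta * d^2]
   downwards, and this choice makes it at most [eps / 2 * d^2]. *)
set (eta := eps / (4 * (M + 1))).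
assert (Heta : 0 < eta) by (apply Rdiv_lt_0_compat; lra).
destruct (taylor_order2 k k1 z0 c rho Hr Hk Hc eta Heta) as [d0 [Hd0 Hb]].
set (d := Rmin 1 (Rmin d0 rho) / 2).
assert (Hd : 0 < d /\ d < 1 /\ d < d0 /\ d < rho).
{ pose proof (Rmin_l 1 (Rmin d0 rho)). pose proof (Rmin_r 1 (Rmin d0 rho)).
  pose proof (Rmin_l d0 rho). pose proof (Rmin_r d0 rho).
  assert (0 < Rmin 1 (Rmin d0 rho)) by (repeat apply Rmin_glb_lt; lra).
  unfold d. lra. }
destruct Hd as [Hdp [Hd1 [Hdd Hdr]]].
set (E := fun h : C => (k z0 + k1 z0 * h + c / 2 * (h * h))%C).
assert (K : forall h, Cmod h = d ->
  Cmod (E h) * Cmod (E h) - 2 * M * (eta * (d * d)) + eps * (Cmod (z0 + h)%C * Cmod (z0 + h)%C)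
  <= Cmod (k z0) * Cmod (k z0) + eps * (Cmod z0 * Cmod z0)).
{ intros h Hh. specialize (Hmax h ltac:(lra)). specialize (Hb h ltac:(lra)).
  rewrite Hh in Hb. change (k z0 + k1 z0 * h + c / 2 * (h * h))%C with (E h) in Hb.
  assert (HE : Cmod (E h) <= M).
  { unfold E. eapply Rle_trans; [apply Cmod_triangle|].
    apply Rle_trans with (Cmod (k z0) + Cmod (k1 z0) * d + Cmod (c / 2)%C * (d * d)).
    - apply Rplus_le_compat.
      + eapply Rle_trans; [apply Cmod_triangle|]. rewrite Cmod_mult, Hh; lra.
      + rewrite !Cmod_mult, Hh; lra.
    - unfold M. pose proof (Cmod_ge_0 (k1 z0)). pose proof (Cmod_ge_0 (c / 2)%C).
      assert (Cmod (k1 z0) * d <= Cmod (k1 z0) * 1) by (apply Rmult_le_compat_l; lra).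
      assert (Cmod (c / 2)%C * (d * d) <= Cmod (c / 2)%C * 1)
        by (apply Rmult_le_compat_l; nra). lra. }
  rewrite Cmod_sub_sym in Hb.
  pose proof (Cmod_ge_sub (E h) (k (z0 + h)%C)) as T.
  pose proof (Cmod_ge_0 (E h)). pose proof (Cmod_ge_0 (k (z0 + h)%C)).
  set (s := eta * (d * d)) in *.
  assert (0 <= s) by (unfold s; nra).
  assert (Cmod (E h) * s <= M * s) by (apply Rmult_le_compat_r; lra).
  assert (Cmod (E h) * Cmod (E h) - 2 * (Cmod (E h) * s)
          <= Cmod (k (z0 + h)%C) * Cmod (k (z0 + h)%C)).
  { destruct (Rle_dec (Cmod (E h)) s); nra. }
  lra. }
assert (Cd : Cmod (RtoC d) = d) by (rewrite Cmod_R, Rabs_pos_eq; lra).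
assert (Cid : Cmod (Ci * d)%C = d) by (rewrite Cmod_mult, Cmod_Ci, Cd; ring).
pose proof (K (RtoC d) Cd) as K1.
pose proof (K (- RtoC d)%C ltac:(now rewrite Cmod_opp)) as K2.
pose proof (K (Ci * d)%C Cid) as K3.
pose proof (K (- (Ci * d))%C ltac:(now rewrite Cmod_opp)) as K4.
pose proof (four_point_lower (k z0) (k1 z0) (c / 2)%C d) as F1. cbv zeta beta in F1.
pose proof (four_point_norms z0 d) as F2. cbv zeta beta in F2.
unfold E in K1, K2, K3, K4.
assert (F3 : 2 * M * eta <= eps / 2).
{ unfold eta. replace (2 * M * (eps / (4 * (M + 1)))) with (eps / 2 * (M / (M + 1)))
    by (field; lra).
  assert (M / (M + 1) <= 1) by (apply Rle_div_l; lra). nra. }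
assert (0 < d * d) by nra.
assert (F4 : 2 * M * (eta * (d * d)) <= eps / 2 * (d * d)).
{ replace (2 * M * (eta * (d * d))) with (2 * M * eta * (d * d)) by ring.
  apply Rmult_le_compat_r; lra. }
set (s := d * d) in *.
assert (0 < eps * s) by nra.
apply (f_equal (fun x => eps * x)) in F2.
lra.
Qed.

(** A maximum point of [V] cannot be the origin, where [V] vanishes: this is how [k 0 = 0] stands in
    for differentiability there. It cannot lie on the circle by the size of [eps], nor elsewhere by
    [not_interior_max]. *)
Lemma max_principle (k : C -> C) (r B : R) : 0 < r < 1 ->
  twice_derivable k -> k (RtoC 0) = RtoC 0 -> Ccont k (RtoC 0) ->
  (forall z, Cmod z = r -> Cmod (k z) <= B) ->
  forall z, Cmod z <= r -> Cmod (k z) <= B.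
Proof.
intros Hr [k1 Hk] K0 C0 HB z1 Hz1. apply Rnot_lt_le; intro Hl.
assert (HB0 : 0 <= B).
{ eapply Rle_trans; [apply Cmod_ge_0|]. apply (HB (RtoC r)).
  rewrite Cmod_R, Rabs_pos_eq; lra. }
set (D := Cmod (k z1) * Cmod (k z1) - B * B).
assert (HD : 0 < D) by (unfold D; nra).
(* On the circle [V] is then at most [B * B + D / 2], below its value at [z1], which is at least
   [B * B + D]. *)
set (eps := D / 2).
set (V := fun z => Cmod (k z) * Cmod (k z) + eps * (Cmod z * Cmod z)).
assert (Hnz : forall z : C, z = RtoC 0 \/ 0 < Cmod z).
{ intro z. destruct (Ceq_dec z 0%C); [now left|right; now apply Cmod_gt_0]. }
destruct (disk_max V r) as [z0 [Hz0 Hmax]]; [lra| |].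
- intros z Hz. unfold V. apply Rcont_plus_scal.
  + unfold eps; lra.
  + apply Rcont_Cmod_sqr. destruct (Hnz z) as [->|Hp]; [exact C0|].
    eapply is_Cderive_Ccont. apply Hk. lra.
  + apply (Rcont_Cmod_sqr (fun x => x)). eapply is_Cderive_Ccont. apply is_Cderive_id.
- assert (HV : B * B + D <= V z0).
  { eapply Rle_trans; [|apply (Hmax z1 Hz1)]. unfold V, eps.
    pose proof (Cmod_ge_0 z1). unfold D in *. nra. }
  destruct (Hnz z0) as [E|Hp].
  { unfold V in HV. rewrite E, K0, Cmod_0 in HV. nra. }
  destruct (Req_dec (Cmod z0) r) as [Er|Hne].
  { specialize (HB z0 Er). pose proof (Cmod_ge_0 (k z0)). unfold V, eps in HV. rewrite Er in HV.
    assert (Cmod (k z0) * Cmod (k z0) <= B * B) by (apply Rmult_le_compat; lra).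
    assert (D / 2 * (r * r) <= D / 2 * 1) by (apply Rmult_le_compat_l; nra). lra. }
  set (rho := Rmin (Cmod z0) (r - Cmod z0)).
  assert (Hrho : 0 < rho) by (apply Rmin_glb_lt; lra).
  pose proof (Rmin_l (Cmod z0) (r - Cmod z0)) as R1.
  pose proof (Rmin_r (Cmod z0) (r - Cmod z0)) as R2. fold rho in R1, R2.
  apply (not_interior_max k k1 z0 rho eps Hrho).
  + unfold eps; lra.
  + intros h Hh. apply Hk. pose proof (Cmod_triangle z0 h).
    pose proof (Cmod_ge_sub z0 (- h)%C) as T. rewrite Cmod_opp in T.
    replace (z0 - - h)%C with (z0 + h)%C in T by ring. lra.
  + apply Hk. lra.
  + intros h Hh. apply (Hmax (z0 + h)%C). pose proof (Cmod_triangle z0 h). lra.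
Qed.

(** * Closure properties of twice differentiable functions *)

Lemma twice_derivable_const (a : C) : twice_derivable (fun _ => a).
Proof.
exists (fun _ => RtoC 0). intros z _. split; [apply is_Cderive_const|].
eexists; apply is_Cderive_const.
Qed.

Lemma twice_derivable_id : twice_derivable (fun z => z).
Proof.
exists (fun _ => RtoC 1). intros z _. split; [apply is_Cderive_id|].
eexists; apply is_Cderive_const.
Qed.

Lemma twice_derivable_plus (f g : C -> C) : twice_derivable f -> twice_derivable g ->
  twice_derivable (fun z => (f z + g z)%C).
Proof.
intros [f1 Hf] [g1 Hg]. exists (fun z => (f1 z + g1 z)%C). intros z Hz.
destruct (Hf z Hz) as [Hf1 [f2 Hf2]], (Hg z Hz) as [Hg1 [g2 Hg2]].
split; [now apply is_Cderive_plus|]. eexists; apply is_Cderive_plus; eassumption.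
Qed.

Lemma twice_derivable_mult (f g : C -> C) : twice_derivable f -> twice_derivable g ->
  twice_derivable (fun z => (f z * g z)%C).
Proof.
intros [f1 Hf] [g1 Hg]. exists (fun z => (f1 z * g z + f z * g1 z)%C). intros z Hz.
destruct (Hf z Hz) as [Hf1 [f2 Hf2]], (Hg z Hz) as [Hg1 [g2 Hg2]].
split; [now apply is_Cderive_mult|].
eexists; apply is_Cderive_plus; apply is_Cderive_mult; eassumption.
Qed.

Lemma twice_derivable_pow (f : C -> C) (n : nat) : twice_derivable f ->
  twice_derivable (fun z => (f z ^ n)%C).
Proof.
intro Hf. induction n as [|n IH]; simpl.
- apply twice_derivable_const.
- now apply twice_derivable_mult.
Qed.

Lemma twice_derivable_inv (f : C -> C) : twice_derivable f ->
  (forall z, 0 < Cmod z < 1 -> f z <> RtoC 0) -> twice_derivable (fun z => (/ f z)%C).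
Proof.
intros [f1 Hf] Hn. exists (fun z => (- f1 z / (f z * f z))%C). intros z Hz.
destruct (Hf z Hz) as [Hf1 [f2 Hf2]].
split; [now apply is_Cderive_inv; auto|].
apply (ex_derive_ext (K := C_AbsRing) (V := C_NormedModule)
  (fun z => ((RtoC 0 - f1 z) * / (f z * f z))%C)).
{ intro t. unfold Cdiv. f_equal. change ((0 - f1 t)%C = (- f1 t)%C). ring. }
eexists. apply is_Cderive_mult.
- apply is_Cderive_minus; [apply is_Cderive_const|exact Hf2].
- apply is_Cderive_inv; [apply is_Cderive_mult; eassumption|].
  apply Cmult_neq_0; auto.
Qed.

Lemma twice_derivable_rotate (f : C -> C) (a : C) : Cmod a = 1 -> twice_derivable f ->
  twice_derivable (fun z => f (a * z)%C).
Proof.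
intros Ha [f1 Hf]. exists (fun z => (a * f1 (a * z)%C)%C). intros z Hz.
assert (Haz : 0 < Cmod (a * z)%C < 1) by (rewrite Cmod_mult, Ha; lra).
destruct (Hf _ Haz) as [Hf1 [f2 Hf2]].
assert (Hl : is_Cderive (fun x => (a * x)%C) z a).
{ eapply is_Cderive_eq.
  - apply is_Cderive_mult; [apply is_Cderive_const|apply is_Cderive_id].
  - cbv beta. ring. }
split.
- now apply (is_Cderive_comp f (fun x => (a * x)%C)).
- eexists. apply is_Cderive_mult; [apply is_Cderive_const|].
  apply (is_Cderive_comp f1 (fun x => (a * x)%C)); eassumption.
Qed.

(** * Schwarz's lemma *)

(* Apply the maximum principle to [(f z / z)^n * z], which vanishes at 0, and let
   [n] grow: no removable singularity theorem is needed. *)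
Lemma schwarz_twice_derivable (f : C -> C) (r B L d : R) : 0 < r < 1 -> 0 < B -> 0 < d ->
  0 <= L -> twice_derivable f -> f (RtoC 0) = RtoC 0 ->
  (forall h, Cmod h < d -> Cmod (f h) <= L * Cmod h) ->
  (forall z, Cmod z = r -> Cmod (f z) <= B) ->
  forall z, 0 < Cmod z <= r -> Cmod (f z) <= B / r * Cmod z.
Proof.
intros Hr HB Hd HL Hf F0 Hlip Hc z Hz.
set (k := fun (n : nat) (x : C) => ((f x * / x) ^ n * x)%C).
assert (Hquot : forall x, 0 < Cmod x -> Cmod (f x * / x)%C = Cmod (f x) / Cmod x).
{ intros x Hx. rewrite Cmod_mult, Cmod_inv; [reflexivity|now apply Cmod_gt_0]. }
assert (K : forall n, (Cmod (f z) / Cmod z) ^ n * Cmod z <= (B / r) ^ n * r).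
{ intro n. rewrite <- Hquot, <- Cmod_pow, <- Cmod_mult by lra.
  change (Cmod (k n z) <= (B / r) ^ n * r).
  apply (max_principle (k n) r); try lra.
  - apply twice_derivable_mult; [|apply twice_derivable_id].
    apply twice_derivable_pow, twice_derivable_mult; [exact Hf|].
    apply twice_derivable_inv; [apply twice_derivable_id|].
    intros x Hx. apply Cmod_gt_0; lra.
  - unfold k. ring.
  - assert (Hp : 0 < L ^ n + 1) by (pose proof (pow_le L n HL); lra).
    apply (Ccont_of_local_lipschitz _ _ (L ^ n + 1) d Hp Hd).
    intros h Hh. unfold k.
    replace ((f (0 + h)%C * / (0 + h)) ^ n * (0 + h) - (f (RtoC 0) * / 0) ^ n * 0)%C
      with ((f h * / h) ^ n * h)%C by (rewrite Cplus_0_l; ring).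
    rewrite Cmod_mult, Cmod_pow. apply Rmult_le_compat_r; [apply Cmod_ge_0|].
    apply Rle_trans with (L ^ n); [|lra].
    (* At [h = 0] the base is [0 * / 0], hence 0 whatever [/ 0] is. *)
    destruct (Ceq_dec h 0%C) as [->|Hn].
    + rewrite F0, Cmult_0_l, Cmod_0. apply pow_incr; lra.
    + pose proof (proj1 (Cmod_gt_0 h) Hn). rewrite Hquot by lra.
      apply pow_incr. split.
      * apply Rdiv_le_0_compat; [apply Cmod_ge_0|lra].
      * apply Rle_div_l; [lra|]. now apply Hlip.
  - intros x Hx. unfold k. rewrite Cmod_mult, Cmod_pow, Hquot, Hx by lra.
    apply Rmult_le_compat_r; [lra|]. apply pow_incr. split.
    + apply Rdiv_le_0_compat; [apply Cmod_ge_0|lra].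
    + apply Rmult_le_compat_r; [|now apply Hc]. left. apply Rinv_0_lt_compat; lra. }
apply Rnot_lt_le; intro Hl.
assert (HBr : 0 < B / r) by (apply Rdiv_lt_0_compat; lra).
(* Relative excess over the claimed bound. By [K], [(1 + x) ^ n] stays below [r / Cmod z] for all
   [n], against Bernoulli's inequality [poly]. *)
set (x := Cmod (f z) / Cmod z / (B / r) - 1).
assert (Hx : 0 < x).
{ unfold x. apply Rlt_0_minus. apply (Rlt_div_r 1); [exact HBr|]. rewrite Rmult_1_l.
  apply (Rlt_div_r (B / r)); [lra|exact Hl]. }
assert (Ex : Cmod (f z) / Cmod z = B / r * (1 + x)) by (unfold x; field; lra).
destruct (INR_unbounded (r / Cmod z / x)) as [n Hn].
specialize (K n). rewrite Ex, Rpow_mult_distr in K.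
pose proof (poly n x Hx) as P.
pose proof (pow_lt (B / r) n HBr) as Q.
assert (K' : (1 + x) ^ n * Cmod z <= r).
{ apply Rmult_le_reg_l with ((B / r) ^ n); [exact Q|]. rewrite <- Rmult_assoc. exact K. }
apply (Rlt_div_l _ (INR n) x Hx) in Hn.
apply (Rlt_div_l r (INR n * x) (Cmod z) (proj1 Hz)) in Hn.
assert ((1 + INR n * x) * Cmod z <= (1 + x) ^ n * Cmod z) by (apply Rmult_le_compat_r; lra).
lra.
Qed.

(** Uniform closeness on a circle of radius r bounds the approximant by 1 + e there, so it is at
    most (1 + e) |z| / r at z. Let e tend to 0 for fixed r, and only then r to 1. *)
Lemma schwarz_of_approx (w : C -> C) (wt : R -> C -> C) :
  (forall t, 0 < t -> twice_derivable (wt t)) ->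
  (forall t, 0 < t -> wt t (RtoC 0) = RtoC 0) ->
  (forall t, 0 < t -> exists L d, 0 <= L /\ 0 < d /\
     forall h, Cmod h < d -> Cmod (wt t h) <= L * Cmod h) ->
  (forall r e, 0 < r < 1 -> 0 < e -> exists t0, 0 < t0 /\
     forall t z, 0 < t < t0 -> Cmod z = r -> Cmod (wt t z - w z)%C <= e) ->
  (forall z, Cmod z < 1 -> Cmod (w z) <= 1) -> w (RtoC 0) = RtoC 0 ->
  forall z, Cmod z < 1 -> Cmod (w z) <= Cmod z.
Proof.
intros Htw H0 Hlip Happ Hw W0 z Hz.
destruct (Ceq_dec z 0%C) as [->|Hn].
{ rewrite W0. lra. }
pose proof (proj1 (Cmod_gt_0 z) Hn) as Hp.
assert (Hr : forall r, Cmod z < r < 1 -> Cmod (w z) <= Cmod z / r).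
(* One [e] pays for the approximation at [z], the other for the bound [1 + e] on the circle of
   radius [r]. *)
{ intros r Hr. apply (le_of_le_eps _ _ 2); [lra|]. intros e He He1.
  destruct (Happ r e ltac:(lra) He) as [t1 [Ht1 A1]].
  destruct (Happ (Cmod z) e ltac:(lra) He) as [t2 [Ht2 A2]].
  set (t := Rmin t1 t2 / 2).
  pose proof (Rmin_l t1 t2). pose proof (Rmin_r t1 t2).
  assert (0 < Rmin t1 t2) by now apply Rmin_glb_lt.
  assert (Ht : 0 < t) by (unfold t; lra).
  destruct (Hlip t Ht) as [L [d [HL [Hd Hl]]]].
  assert (S : Cmod (wt t z) <= (1 + e) / r * Cmod z).
  { apply (schwarz_twice_derivable (wt t) r (1 + e) L d); auto; try lra.
    intros x Hx. specialize (A1 t x ltac:(unfold t; lra) Hx).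
    specialize (Hw x ltac:(lra)).
    pose proof (Cmod_ge_sub (wt t x) (w x)). lra. }
  specialize (A2 t z ltac:(unfold t; lra) eq_refl).
  rewrite Cmod_sub_sym in A2.
  pose proof (Cmod_ge_sub (w z) (wt t z)).
  assert (Cmod z / r <= 1) by (apply Rle_div_l; lra).
  replace ((1 + e) / r * Cmod z) with (Cmod z / r + e * (Cmod z / r)) in S by (field; lra).
  assert (e * (Cmod z / r) <= e * 1) by (apply Rmult_le_compat_l; lra).
  lra. }
apply Rnot_lt_le; intro Hl.
assert (Hwz := Hw z Hz).
(* If [Cmod z < Cmod (w z)], any radius strictly between the quotient of the two and 1 contradicts
   [Hr]. *)
set (r := (Cmod z / Cmod (w z) + 1) / 2).
assert (A : Cmod z / Cmod (w z) < 1) by (apply Rlt_div_l; lra).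
assert (A2 : Cmod z <= Cmod z / Cmod (w z)).
{ apply Rle_div_r; [lra|]. nra. }
assert (Hrr : Cmod z < r < 1) by (unfold r; lra).
specialize (Hr r Hrr).
apply Rle_div_r in Hr; [|lra].
assert (Cmod z < Cmod (w z) * r); [|lra].
apply Rle_lt_trans with (Cmod (w z) * (Cmod z / Cmod (w z))).
- right; field; lra.
- apply Rmult_lt_compat_l; [lra|unfold r; lra].
Qed.

Lemma Cmod_le_Re_Im (z : C) (e : R) : Rabs (Re z) <= e / 2 -> Rabs (Im z) <= e / 2 -> Cmod z <= e.
Proof.
intros H1 H2. apply Rabs_le_between in H1. apply Rabs_le_between in H2.
apply Cmod_le_sqr; nra.
Qed.

Lemma circle_uniform_continuity (T : C -> C) (r e : R) : 0 < r < 1 -> 0 < e ->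
  (forall z, Cmod z < 1 -> Ccont T z) ->
  exists d, 0 < d /\ forall t s, 0 <= t <= 2 * PI -> 0 <= s < d ->
    Cmod (T (r * cis (t + s))%C - T (r * cis t)%C)%C <= e.
Proof.
intros Hr He HT. pose proof PI_RGT_0.
assert (Hc : forall x, forall eta, 0 < eta -> exists d, 0 < d /\ forall y, Rabs (y - x) < d ->
  Cmod (T (r * cis y)%C - T (r * cis x)%C)%C <= eta).
{ intros x eta Heta. destruct (HT (r * cis x)%C) with (e := eta) as [d [Hd Hb]]; auto.
  { rewrite Cmod_mult, Cmod_cis, Cmod_R, Rabs_pos_eq; lra. }
  exists d; split; [exact Hd|]. intros y Hy.
  specialize (Hb (r * cis y - r * cis x)%C).
  replace (r * cis x + (r * cis y - r * cis x))%C with (r * cis y)%C in Hb by ring.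
  apply Hb. eapply Rle_lt_trans; [apply polar_lipschitz|].
  rewrite Rminus_diag, Rabs_R0, (Rabs_pos_eq r) by lra.
  pose proof (Rabs_pos (y - x)). nra. }
(* The extra unit of length leaves room for [t + s], with [t] up to [2 * PI] and [s] below 1. *)
assert (C1 : forall x, 0 <= x <= 2 * PI + 1 ->
   continuity_pt (fun x => Re (T (r * cis x)%C)) x).
{ intros x _. apply continuity_pt_locally. intro eps.
  destruct (Hc x (eps / 2)) as [d [Hd Hb]]; [pose proof (cond_pos eps); lra|].
  exists (mkposreal d Hd). intros y Hy. specialize (Hb y Hy).
  eapply Rle_lt_trans; [|apply (Rle_lt_trans _ _ eps Hb)].
  - eapply Rle_trans; [|apply re_le_Cmod]. right. f_equal; unfold Re; simpl; ring.
  - pose proof (cond_pos eps); lra. }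
assert (C2 : forall x, 0 <= x <= 2 * PI + 1 ->
   continuity_pt (fun x => Im (T (r * cis x)%C)) x).
{ intros x _. apply continuity_pt_locally. intro eps.
  destruct (Hc x (eps / 2)) as [d [Hd Hb]]; [pose proof (cond_pos eps); lra|].
  exists (mkposreal d Hd). intros y Hy. specialize (Hb y Hy).
  eapply Rle_lt_trans; [|apply (Rle_lt_trans _ _ eps Hb)].
  - eapply Rle_trans; [|apply im_le_Cmod]. right. f_equal; unfold Im; simpl; ring.
  - pose proof (cond_pos eps); lra. }
assert (He2 : 0 < e / 2) by lra.
destruct (Heine_cor2 C1 (mkposreal _ He2)) as [d1 H1].
destruct (Heine_cor2 C2 (mkposreal _ He2)) as [d2 H2].
simpl in H1, H2.
exists (Rmin 1 (Rmin d1 d2)). split.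
{ repeat apply Rmin_glb_lt; [lra|apply cond_pos|apply cond_pos]. }
intros t s Ht Hs.
pose proof (Rmin_l 1 (Rmin d1 d2)). pose proof (Rmin_r 1 (Rmin d1 d2)).
pose proof (Rmin_l d1 d2). pose proof (Rmin_r d1 d2).
assert (Es : Rabs (t + s - t) = s) by (replace (t + s - t) with s by ring; apply Rabs_pos_eq; lra).
apply Cmod_le_Re_Im; left.
- replace (Re (T (r * cis (t + s))%C - T (r * cis t)%C)%C)
    with (Re (T (r * cis (t + s))%C) - Re (T (r * cis t)%C)) by (unfold Re; simpl; ring).
  apply H1; lra.
- replace (Im (T (r * cis (t + s))%C - T (r * cis t)%C)%C)
    with (Im (T (r * cis (t + s))%C) - Im (T (r * cis t)%C)) by (unfold Im; simpl; ring).
  apply H2; lra.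
Qed.

(** * Rotation quotients and Schwarz's lemma for the subordinating function *)

Section RotationQuotient.

Variables (p p' : C -> C).
Hypothesis Hp : forall z, Cmod z < 1 -> is_Cderive p z (p' z).
Hypothesis HT : analytic (fun z => (z * p' z)%C).

Lemma twice_derivable_of_euler : twice_derivable p.
Proof.
exists (fun z => (z * p' z * / z)%C). intros z Hz.
assert (Hn : z <> RtoC 0) by (apply Cmod_gt_0; lra).
split.
- eapply is_Cderive_eq; [apply Hp; lra|]. field. exact Hn.
- destruct (HT z) as [l Hl]; [unfold unit_disk; lra|]. eexists.
  apply (is_Cderive_mult (fun x => (x * p' x)%C) (fun x => (/ x)%C)); [exact Hl|].
  apply is_Cderive_inv; [apply is_Cderive_id|exact Hn].
Qed.

(* The rotation quotient is the mean of [z p'] over an arc, and unlike [z p'] it is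
   twice differentiable. *)
Definition rotation_quotient (t : R) (z : C) : C :=
  ((p (cis t * z) - p z) * / (Ci * t))%C.

(** Along the arc, p(r cis(th + s)) - i Tz s has derivative i (T(r cis(th + s)) - Tz) with T(x) = x
    p'(x), small by uniform continuity of T on the circle. The mean value inequality over an arc of
    length parameter [t] cancels the division by [t]. *)
Lemma rotation_quotient_uniform (r e : R) : 0 < r < 1 -> 0 < e ->
  exists t0, 0 < t0 /\ forall t z, 0 < t < t0 -> Cmod z = r ->
    Cmod (rotation_quotient t z - z * p' z)%C <= e.
Proof.
intros Hr He.
destruct (circle_uniform_continuity (fun z => (z * p' z)%C) r e Hr He) as [d [Hd Hu]].
{ intros z Hz. destruct (HT z Hz) as [l Hl]. eapply is_Cderive_Ccont; exact Hl. }
exists d; split; [exact Hd|]. intros t z Ht Hz.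
destruct (polar_form z) as [th [Hth E]]. rewrite Hz in E.
set (Tz := (z * p' z)%C).
assert (Htn : RtoC t <> RtoC 0) by (intro Q; apply RtoC_inj in Q; lra).
assert (Hin : Ci <> RtoC 0) by (intro Q; injection Q; lra).
replace (rotation_quotient t z - Tz)%C
  with ((p (cis t * z)%C - Ci * t * Tz - p z) / (Ci * t))%C
  by (unfold rotation_quotient; field; auto).
rewrite Cmod_div by now apply Cmult_neq_0.
rewrite Cmod_mult, Cmod_Ci, Cmod_R, Rabs_pos_eq, Rmult_1_l by lra.
apply Rle_div_l; [lra|].
assert (M : Cmod (p (r * cis (th + t))%C - Ci * Tz * t - (p (r * cis (th + 0))%C - Ci * Tz * 0))%C
            <= e * t - e * 0).
{ apply (curve_mean_value_le (fun s => p (r * cis (th + s))%C - Ci * Tz * s)%C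
    (fun s => (p' (r * cis (th + s))%C * (r * (Ci * cis (th + s))) - Ci * Tz)%C)
    (fun s => e * s) (fun _ => e)).
  - lra.
  - intros s _. apply curve_derive_minus.
    + apply (curve_derive_comp p (fun s => (r * cis (th + s))%C)).
      * apply Hp. rewrite Cmod_mult, Cmod_cis, Cmod_R, Rabs_pos_eq; lra.
      * apply curve_derive_pair; unfold cis, Re, Im; simpl; auto_derive; auto; ring.
    + apply curve_derive_pair; unfold Re, Im; simpl; auto_derive; auto; ring.
  - intros s _. auto_derive; auto; ring.
  - intros s Hs.
    replace (p' (r * cis (th + s))%C * (r * (Ci * cis (th + s))) - Ci * Tz)%C
      with (Ci * (r * cis (th + s) * p' (r * cis (th + s))%C - Tz))%C by ring.
    rewrite Cmod_mult, Cmod_Ci, Rmult_1_l.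
    unfold Tz. rewrite E. apply Hu; lra. }
rewrite Rplus_0_r in M. rewrite <- E in M.
rewrite cis_plus in M.
replace (r * (cis th * cis t))%C with (cis t * z)%C in M by (rewrite E; ring).
replace (p (cis t * z)%C - Ci * t * Tz - p z)%C
  with (p (cis t * z)%C - Ci * Tz * t - (p z - Ci * Tz * 0))%C by ring.
lra.
Qed.

Lemma rotation_quotient_lipschitz (t : R) : 0 < t -> exists L d, 0 <= L /\ 0 < d /\
  forall h, Cmod h < d -> Cmod (rotation_quotient t h) <= L * Cmod h.
Proof.
intro Ht.
destruct (is_Cderive_local_lipschitz p (RtoC 0) (p' (RtoC 0))) as [d [Hd Hb]].
{ apply Hp. rewrite Cmod_0; lra. }
set (K := Cmod (p' (RtoC 0)) + 1) in *.
assert (HK : 0 < K) by (unfold K; pose proof (Cmod_ge_0 (p' (RtoC 0))); lra).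
exists (2 * K / t), d. split; [apply Rdiv_le_0_compat; lra|]. split; [exact Hd|].
intros h Hh. unfold rotation_quotient.
assert (Htn : RtoC t <> RtoC 0) by (intro Q; apply RtoC_inj in Q; lra).
assert (Hin : Ci <> RtoC 0) by (intro Q; injection Q; lra).
rewrite Cmod_mult, Cmod_inv by now apply Cmult_neq_0.
rewrite (Cmod_mult Ci), Cmod_Ci, Cmod_R, (Rabs_pos_eq t), Rmult_1_l by lra.
assert (Hc : Cmod (cis t * h)%C = Cmod h) by (rewrite Cmod_mult, Cmod_cis; ring).
pose proof (Hb h Hh) as B1. pose proof (Hb (cis t * h)%C ltac:(lra)) as B2.
rewrite Cplus_0_l in B1, B2. rewrite Hc in B2.
replace (2 * K / t * Cmod h) with (2 * K * Cmod h * / t) by (field; lra).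
apply Rmult_le_compat_r; [left; apply Rinv_0_lt_compat; lra|].
replace (p (cis t * h) - p h)%C with ((p (cis t * h)%C - p (RtoC 0)) - (p h - p (RtoC 0)))%C by ring.
eapply Rle_trans; [apply Cmod_sub_triangle|]. lra.
Qed.

(** [R] stands for beta / p^n, and the equation for [w] is 1 + R z p' = sqrt(1 + w) with the root
    removed. *)
Variables (R : C -> C) (w : C -> C).
Hypothesis HR : twice_derivable R.
Hypothesis HRc : forall z, Cmod z < 1 -> Ccont R z.
Hypothesis Hw : forall z, Cmod z < 1 ->
  w z = ((1 + R z * (z * p' z)) * (1 + R z * (z * p' z)) - 1)%C.
Hypothesis Hw1 : forall z, Cmod z < 1 -> Cmod (w z) < 1.

(** Squared, the hypothesis makes [w] a polynomial in [R] and z p', so putting the rotation quotient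
    for z p' yields twice differentiable approximants and no root has to be approximated. *)
Lemma schwarz_square_form (z : C) : Cmod z < 1 -> Cmod (w z) <= Cmod z.
Proof.
set (u := fun t z => (R z * rotation_quotient t z)%C).
apply (schwarz_of_approx w (fun t z => (1 + u t z) * (1 + u t z) + - (1))%C).
- intros t Ht.
  assert (Hu : twice_derivable (fun z => (1 + u t z)%C)).
  { apply twice_derivable_plus; [apply twice_derivable_const|].
    apply twice_derivable_mult; [exact HR|].
    apply twice_derivable_mult; [|apply twice_derivable_const].
    apply (twice_derivable_plus (fun z => p (cis t * z)%C) (fun z => (- p z)%C)).
    - apply twice_derivable_rotate; [apply Cmod_cis|apply twice_derivable_of_euler].
    - replace (fun z => (- p z)%C) with (fun z => (- (1) * p z)%C)
        by (apply functional_extensionality; intro; ring).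
      apply twice_derivable_mult; [apply twice_derivable_const|apply twice_derivable_of_euler]. }
  apply twice_derivable_plus; [|apply twice_derivable_const].
  now apply twice_derivable_mult.
- intros t Ht. unfold u, rotation_quotient.
  replace (cis t * 0)%C with (RtoC 0) by ring. ring.
- intros t Ht. destruct (rotation_quotient_lipschitz t Ht) as [L [d [HL [Hd Hb]]]].
  destruct (HRc (RtoC 0)) with (e := 1) as [d1 [Hd1 Hb1]]; [rewrite Cmod_0; lra|lra|].
  set (K := (Cmod (R (RtoC 0)) + 1) * L).
  pose proof (Cmod_ge_0 (R (RtoC 0))).
  assert (HK : 0 <= K) by (unfold K; apply Rmult_le_pos; lra).
  exists (K * (2 + K)), (Rmin 1 (Rmin d d1)).
  split; [apply Rmult_le_pos; lra|]. split.
  { repeat apply Rmin_glb_lt; lra. }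
  intros h Hh. pose proof (Rmin_l 1 (Rmin d d1)). pose proof (Rmin_r 1 (Rmin d d1)).
  pose proof (Rmin_l d d1). pose proof (Rmin_r d d1).
  specialize (Hb h ltac:(lra)). specialize (Hb1 h ltac:(lra)).
  rewrite Cplus_0_l in Hb1. pose proof (Cmod_ge_sub (R h) (R (RtoC 0))).
  pose proof (Cmod_ge_0 h).
  assert (Hu : Cmod (u t h) <= K * Cmod h).
  { unfold u, K. rewrite Cmod_mult, Rmult_assoc.
    apply Rmult_le_compat; auto using Cmod_ge_0; lra. }
  replace ((1 + u t h) * (1 + u t h) + - (1))%C with (u t h * (2 + u t h))%C by ring.
  rewrite Cmod_mult.
  assert (Cmod (2 + u t h)%C <= 2 + K).
  { eapply Rle_trans; [apply Cmod_triangle|]. rewrite Cmod_R, Rabs_pos_eq by lra. nra. }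
  replace (K * (2 + K) * Cmod h) with (K * Cmod h * (2 + K)) by ring.
  apply Rmult_le_compat; auto using Cmod_ge_0.
- intros r e Hr He.
  destruct (disk_max (fun z => Cmod (R z) * Cmod (R z)) r) as [z0 [_ Hz0]]; [lra| |].
  { intros x Hx. apply Rcont_Cmod_sqr. apply HRc; lra. }
  set (M := Cmod (R z0) + 1).
  assert (HM : 0 < M) by (unfold M; pose proof (Cmod_ge_0 (R z0)); lra).
  (* The error is D (2 E + D) with |D| <= [dl] <= 1. From |E^2 - 1| < 1 follows |E| <= 2, so the
     second factor is at most 5. *)
  set (dl := Rmin 1 (e / 5)).
  assert (Hdl : 0 < dl) by (apply Rmin_glb_lt; lra).
  destruct (rotation_quotient_uniform r (dl / M) Hr) as [t0 [Ht0 Hq]].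
  { now apply Rdiv_lt_0_compat. }
  exists t0; split; [exact Ht0|]. intros t x Ht Hx.
  specialize (Hq t x Ht Hx).
  assert (HRx : Cmod (R x) <= M).
  { specialize (Hz0 x ltac:(lra)). unfold M.
    pose proof (Cmod_ge_0 (R z0)). pose proof (Cmod_ge_0 (R x)). nra. }
  assert (Hd : Cmod (u t x - R x * (x * p' x))%C <= dl).
  { unfold u.
    replace (R x * rotation_quotient t x - R x * (x * p' x))%C
      with (R x * (rotation_quotient t x - x * p' x))%C by ring.
    rewrite Cmod_mult. apply Rle_trans with (M * (dl / M)).
    - apply Rmult_le_compat; auto using Cmod_ge_0.
    - right; field; lra. }
  pose proof (Hw1 x ltac:(lra)) as W1. rewrite Hw by lra. rewrite Hw in W1 by lra.
  set (E := (1 + R x * (x * p' x))%C) in *.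
  assert (HE : Cmod E <= 2).
  { pose proof (Cmod_ge_sub (E * E) 1) as T. rewrite Cmod_mult, Cmod_1 in T.
    pose proof (Cmod_ge_0 E). nra. }
  set (D := (u t x - R x * (x * p' x))%C) in *.
  replace ((1 + u t x) * (1 + u t x) + - (1) - (E * E - 1))%C with (D * (2 * E + D))%C
    by (unfold D, E; ring).
  rewrite Cmod_mult.
  assert (H1 : Cmod (2 * E + D)%C <= 5).
  { eapply Rle_trans; [apply Cmod_triangle|]. rewrite Cmod_mult, Cmod_R, Rabs_pos_eq by lra.
    pose proof (Rmin_l 1 (e / 5)). fold dl in H. lra. }
  apply Rle_trans with (dl * 5).
  + apply Rmult_le_compat; auto using Cmod_ge_0.
  + pose proof (Rmin_r 1 (e / 5)). fold dl in H. lra.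
- intros x Hx. left. now apply Hw1.
- rewrite Hw by (rewrite Cmod_0; lra). ring.
Qed.

End RotationQuotient.

(** [auto_derive] leaves the derivative of an unknown function in this eta-expanded form. *)
Lemma Derive_eta (f : R -> R) (t l : R) : is_derive f t l -> Derive (fun s => f s) t = l.
Proof. apply is_derive_unique. Qed.

(** * Estimates along rays *)

Lemma Re_Csqrt_ge (z : C) (q : R) : 0 <= q -> q <= Re z -> sqrt q <= Re (Csqrt z).
Proof.
intros Hq Hz. unfold Csqrt, Re at 1; simpl. apply sqrt_le_1_alt.
pose proof (Re_le_Cmod' z). lra.
Qed.

(** With v = [phi_L z], (v - 1)(v + 1) = z and |v + 1| >= 1 + Re v. The bound is 1 - sqrt(1-s),
    written so that the factor [s] is visible. *)
Lemma phi_L_sub1_bound (z : C) (s : R) : Cmod z <= s -> s < 1 ->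
  Cmod (phi_L z - 1)%C <= s / (1 + sqrt (1 - s)).
Proof.
intros Hz Hs. pose proof (Cmod_ge_0 z).
set (q := sqrt (1 - s)).
assert (Hq : 0 <= q) by apply sqrt_pos.
assert (Hv : q <= Re (phi_L z)).
{ apply Re_Csqrt_ge; [lra|].
  pose proof (re_le_Cmod z) as T. apply Rabs_le_between in T. unfold Re in *; simpl. lra. }
pose proof (phi_L_sqr z) as E. set (v := phi_L z) in *.
assert (P : (Cmod (v - 1)%C * Cmod (v + 1)%C <= s)).
{ rewrite <- Cmod_mult. replace ((v - 1) * (v + 1))%C with (v ^ 2 - 1)%C by (simpl; ring).
  rewrite E. replace (1 + z - 1)%C with z by ring. exact Hz. }
assert (Hd : 1 + q <= Cmod (v + 1)%C).
{ eapply Rle_trans; [|apply Re_le_Cmod'].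
  change (1 + q <= Re v + 1). lra. }
apply Rle_div_r; [lra|].
pose proof (Cmod_ge_0 (v - 1)%C). nra.
Qed.

(** The right side equals sqrt(1+s) - 1, and Re v <= |v| with |v|^2 = |1 + z| <= 1 + s. *)
Lemma Re_phi_L_sub1_bound (z : C) (s : R) : Cmod z <= s ->
  Re (phi_L z - 1)%C <= s / (1 + sqrt (1 + s)).
Proof.
intros Hz. pose proof (Cmod_ge_0 z).
pose proof (phi_L_sqr z) as E. set (v := phi_L z) in *.
set (y := sqrt (1 + s)).
assert (Hy : y * y = 1 + s) by (apply sqrt_sqrt; lra).
assert (Hy0 : 0 <= y) by apply sqrt_pos.
assert (Hv : Cmod v <= y).
{ apply (f_equal Cmod) in E. rewrite Cmod_pow in E.
  pose proof (Cmod_triangle 1 z) as T. rewrite Cmod_1 in T. simpl in E.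
  pose proof (Cmod_ge_0 v). nra. }
pose proof (Re_le_Cmod' v).
change (Re (v - 1)%C) with (Re v - 1).
apply Rle_div_r; nra.
Qed.

(** This and [re_majorant] are antiderivatives in [t] of (1 - sqrt(1-tr))/t and (sqrt(1+tr) - 1)/t,
    found by taking the square root as the new variable. *)
Definition abs_majorant (r t : R) : R := 2 * (ln (1 + sqrt (1 - t * r)) - sqrt (1 - t * r)).
Definition re_majorant (r t : R) : R := 2 * (sqrt (1 + t * r) - ln (1 + sqrt (1 + t * r))).

Lemma is_derive_abs_majorant (r t : R) : t * r < 1 ->
  is_derive (abs_majorant r) t (r / (1 + sqrt (1 - t * r))).
Proof.
intro H. unfold abs_majorant.
assert (Hq : 0 < sqrt (1 - t * r)) by (apply sqrt_lt_R0; lra).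
auto_derive.
- replace (1 + - (t * r)) with (1 - t * r) by ring. repeat split; lra.
- replace (1 + - (t * r)) with (1 - t * r) by ring.
  field. split; lra.
Qed.

Lemma is_derive_re_majorant (r t : R) : -1 < t * r ->
  is_derive (re_majorant r) t (r / (1 + sqrt (1 + t * r))).
Proof.
intro H. unfold re_majorant.
assert (Hq : 0 < sqrt (1 + t * r)) by (apply sqrt_lt_R0; lra).
auto_derive; [repeat split; lra|]. field. split; lra.
Qed.

Lemma ln_lt_sub1 (x : R) : 0 < x -> x <> 1 -> ln x < x - 1.
Proof.
intros Hx Hn. pose proof (exp_ineq1 (ln x)) as H.
rewrite exp_ln in H by exact Hx.
assert (ln x <> 0); [|specialize (H H0); lra].
intro E. apply Hn. rewrite <- (exp_ln x Hx), E. apply exp_0.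
Qed.

(** The right side is the increment for r = 1. Strictness for r < 1 is what makes the final
    estimates strict even when [beta] equals its bound. *)
Lemma abs_majorant_total (r : R) : 0 <= r < 1 ->
  abs_majorant r 1 - abs_majorant r 0 < 2 * (1 - ln 2).
Proof.
intro Hr. unfold abs_majorant.
rewrite Rmult_1_l, Rmult_0_l, Rminus_0_r, sqrt_1.
replace (1 + 1) with 2 by ring.
assert (Hq : 0 < sqrt (1 - r)) by (apply sqrt_lt_R0; lra).
pose proof (ln_lt_sub1 (1 + sqrt (1 - r)) ltac:(lra) ltac:(lra)). lra.
Qed.

Definition log_const : R := sqrt 2 + ln 2 - 1 - ln (1 + sqrt 2).

Lemma sub_ln_1p_lt (a b : R) : 0 <= a < b -> a - ln (1 + a) < b - ln (1 + b).
Proof.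
intro H.
assert (ln (1 + b) - ln (1 + a) < b - a); [|lra].
rewrite <- ln_div by lra.
eapply Rlt_le_trans; [apply ln_lt_sub1|].
- apply Rdiv_lt_0_compat; lra.
- intro E. apply (f_equal (fun x => x * (1 + a))) in E. field_simplify in E; lra.
- replace ((1 + b) / (1 + a) - 1) with ((b - a) / (1 + a)) by (field; lra).
  apply Rle_div_l; [lra|]. nra.
Qed.

Lemma re_majorant_total (r : R) : 0 <= r < 1 ->
  re_majorant r 1 - re_majorant r 0 < 2 * log_const.
Proof.
intro Hr. unfold re_majorant, log_const.
rewrite Rmult_1_l, Rmult_0_l, Rplus_0_r, sqrt_1.
replace (1 + 1) with 2 by ring.
assert (H : sqrt (1 + r) < sqrt 2) by (apply sqrt_lt_1_alt; lra).
pose proof (sqrt_pos (1 + r)).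
pose proof (sub_ln_1p_lt (sqrt (1 + r)) (sqrt 2) ltac:(lra)). lra.
Qed.

(** All that is kept of k = phi_L(w) - 1 once Schwarz's lemma has been applied to w. *)
Definition ray_bounded (k : C -> C) : Prop := forall z, Cmod z < 1 ->
  Cmod (k z) <= Cmod z / (1 + sqrt (1 - Cmod z)) /\
  Re (k z) <= Cmod z / (1 + sqrt (1 + Cmod z)).

Lemma curve_derive_ray (u du : C -> C) (z : C) (t : R) :
  is_Cderive u (t * z)%C (du (t * z)%C) ->
  curve_derive (fun s => u (s * z)%C) t (du (t * z)%C * z)%C.
Proof.
intro H. apply (curve_derive_comp u (fun s => (s * z)%C)); [exact H|].
apply curve_derive_pair; unfold Re, Im; simpl; auto_derive; auto; ring.
Qed.

Lemma Cmod_ray (z : C) (t : R) : Cmod z < 1 -> 0 <= t <= 1 ->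
  Cmod (t * z)%C = t * Cmod z /\ Cmod (t * z)%C < 1 /\ 0 <= t * Cmod z.
Proof.
intros Hz Ht. rewrite Cmod_mult, Cmod_R, Rabs_pos_eq by lra.
pose proof (Cmod_ge_0 z). repeat split; nra.
Qed.

(* The factor [1 / t] produced by [z u' = k] is absorbed by the factor [|t z|] in
   [ray_bounded], so that nothing is singular at [t = 0]. *)
Lemma ray_speed (k : C -> C) (z d : C) (t beta : R) : ray_bounded k -> 0 < beta ->
  Cmod z < 1 -> 0 < t <= 1 -> (beta * (t * d))%C = k (t * z)%C ->
  Cmod d <= / beta * (Cmod z / (1 + sqrt (1 - t * Cmod z))) /\
  Re d <= / beta * (Cmod z / (1 + sqrt (1 + t * Cmod z))).
Proof.
intros Hk Hb Hz Ht E.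
destruct (Cmod_ray z t Hz ltac:(lra)) as [E1 [Hl Hp]].
destruct (Hk _ Hl) as [K1 K2]. rewrite <- E, E1 in K1, K2.
assert (S1 : 0 < 1 + sqrt (1 - t * Cmod z)) by (pose proof (sqrt_pos (1 - t * Cmod z)); lra).
assert (S2 : 0 < 1 + sqrt (1 + t * Cmod z)) by (pose proof (sqrt_pos (1 + t * Cmod z)); lra).
assert (Hbt : 0 < beta * t) by (apply Rmult_lt_0_compat; lra).
split.
- rewrite !Cmod_mult, !Cmod_R, !Rabs_pos_eq in K1 by lra.
  apply Rmult_le_reg_l with (beta * t); [exact Hbt|].
  rewrite Rmult_assoc. eapply Rle_trans; [exact K1|]. right. field. lra.
- replace (Re (beta * (t * d))%C) with (beta * (t * Re d)) in K2 by (unfold Re; simpl; ring).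
  apply Rmult_le_reg_l with (beta * t); [exact Hbt|].
  rewrite Rmult_assoc. eapply Rle_trans; [exact K2|]. right. field. lra.
Qed.

Lemma is_derive_scaled_abs_majorant (z : C) (beta t : R) : Cmod z < 1 -> 0 <= t <= 1 ->
  is_derive (fun t => / beta * abs_majorant (Cmod z) t) t
    (/ beta * (Cmod z / (1 + sqrt (1 - t * Cmod z)))).
Proof.
intros Hz Ht. apply is_derive_scal. apply is_derive_abs_majorant.
pose proof (Cmod_ge_0 z). nra.
Qed.

Lemma is_derive_scaled_re_majorant (z : C) (beta t : R) : 0 <= t <= 1 ->
  is_derive (fun t => / beta * re_majorant (Cmod z) t) t
    (/ beta * (Cmod z / (1 + sqrt (1 + t * Cmod z)))).
Proof.
intros Ht. apply is_derive_scal. apply is_derive_re_majorant.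
pose proof (Cmod_ge_0 z). nra.
Qed.

Lemma scaled_total_lt (beta a b c : R) : 0 < beta -> a - b < c -> / beta * a - / beta * b < c / beta.
Proof.
intros Hb H. rewrite <- Rmult_minus_distr_l. unfold Rdiv. rewrite (Rmult_comm c).
apply Rmult_lt_compat_l; [apply Rinv_0_lt_compat; lra|exact H].
Qed.

(** Serves three functions: [p] in case a, [1 - / p] in case c and [best_dominant] in the sharpness
    proof of case c. *)
Lemma ray_increment_bounds (u du k : C -> C) (beta : R) (z : C) : 0 < beta -> ray_bounded k ->
  (forall x, Cmod x < 1 -> is_Cderive u x (du x)) ->
  (forall x, Cmod x < 1 -> (beta * (x * du x))%C = k x) ->
  Cmod z < 1 ->
  Cmod (u z - u (RtoC 0))%C < 2 * (1 - ln 2) / beta /\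
  Re (u z) - Re (u (RtoC 0)) < 2 * log_const / beta.
Proof.
intros Hb Hk Hu He Hz.
assert (E1 : u z = u (1 * z)%C) by (f_equal; ring).
assert (E0 : u (RtoC 0) = u (0 * z)%C) by (f_equal; ring).
assert (Hc : forall t, 0 <= t <= 1 ->
  curve_derive (fun s => u (s * z)%C) t (du (t * z)%C * z)%C).
{ intros t Ht. apply curve_derive_ray. apply Hu. now apply Cmod_ray. }
assert (Hs : forall t, 0 < t < 1 -> (beta * (t * (du (t * z)%C * z)))%C = k (t * z)%C).
{ intros t Ht. rewrite <- He by (apply Cmod_ray; [exact Hz|lra]). ring. }
pose proof (Cmod_ge_0 z).
split.
- rewrite E1, E0.
  eapply Rle_lt_trans; [|apply (scaled_total_lt beta _ _ _ Hb (abs_majorant_total (Cmod z) ltac:(lra)))].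
  apply (curve_mean_value_le (fun s => u (s * z)%C) (fun t => (du (t * z)%C * z)%C)
    (fun t => / beta * abs_majorant (Cmod z) t)
    (fun t => / beta * (Cmod z / (1 + sqrt (1 - t * Cmod z))))).
  + lra.
  + exact Hc.
  + intros t Ht. now apply is_derive_scaled_abs_majorant.
  + intros t Ht. apply (ray_speed k z _ t beta); auto; lra.
- rewrite E1, E0.
  eapply Rle_lt_trans; [|apply (scaled_total_lt beta _ _ _ Hb (re_majorant_total (Cmod z) ltac:(lra)))].
  apply (increment_le (fun s => Re (u (s * z)%C)) (fun t => / beta * re_majorant (Cmod z) t)
    (fun t => Re (du (t * z)%C * z)%C)
    (fun t => / beta * (Cmod z / (1 + sqrt (1 + t * Cmod z))))).
  + lra.
  + intros t Ht. eapply is_derive_continuity_pt. apply curve_derive_Re. now apply Hc.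
  + intros t Ht. eapply is_derive_continuity_pt. now apply is_derive_scaled_re_majorant.
  + intros t Ht. apply curve_derive_Re. apply Hc; lra.
  + intros t Ht. apply is_derive_scaled_re_majorant; lra.
  + intros t Ht. apply (ray_speed k z _ t beta); auto; lra.
Qed.

(* With [x + i y = exp u] this is [cosh (Re u) - cos (Im u) + 1]: a bound on [|u|] that
   needs no branch of the logarithm, since [|X'| <= sqrt (X^2 - 1) |u'|] along curves. *)
Definition log_gauge (x y : R) : R :=
  (x * x + y * y + 1 - 2 * x) / (2 * sqrt (x * x + y * y)) + 1.

Lemma log_gauge_ge1 (x y : R) : 0 < x * x + y * y -> 1 <= log_gauge x y.
Proof.
intro H. unfold log_gauge.
pose proof (sqrt_lt_R0 _ H).
assert (0 <= (x * x + y * y + 1 - 2 * x) / (2 * sqrt (x * x + y * y))); [|lra].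
apply Rdiv_le_0_compat; [|lra]. pose proof (Rle_0_sqr (x - 1)). pose proof (Rle_0_sqr y).
unfold Rsqr in *. lra.
Qed.

(** Here a + ib is the logarithmic derivative of x + iy. In terms of [Ch], [Sh] = cosh, sinh of ln n
    and [c], [s] = cos, sin of the argument, the gauge is X = Ch - c + 1 and X' = a Sh + b s.
    Cauchy-Schwarz gives the factor Sh^2 + s^2 = Ch^2 - c^2, and X^2 - 1 exceeds it by 2 (Ch - c)(1
    - c) >= 0. *)
Lemma log_gauge_derive (x y : R -> R) (t a b : R) : 0 < x t * x t + y t * y t ->
  is_derive x t (a * x t - b * y t) -> is_derive y t (a * y t + b * x t) ->
  exists l, is_derive (fun s => log_gauge (x s) (y s)) t l /\
    l * l <= (log_gauge (x t) (y t) * log_gauge (x t) (y t) - 1) * (a * a + b * b).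
Proof.
intros H Hx Hy.
pose proof (sqrt_lt_R0 _ H) as Hn. pose proof (sqrt_sqrt _ (Rlt_le _ _ H)) as Hs.
exists (a * (sqrt (x t * x t + y t * y t) - / sqrt (x t * x t + y t * y t)) / 2
        + b * (y t / sqrt (x t * x t + y t * y t))). split.
- unfold log_gauge.
  assert (Ex : ex_derive x t) by (eexists; exact Hx).
  assert (Ey : ex_derive y t) by (eexists; exact Hy).
  auto_derive; [repeat split; auto; lra|].
  rewrite (Derive_eta _ _ _ Hx), (Derive_eta _ _ _ Hy).
  set (n := sqrt (x t * x t + y t * y t)) in *.
  set (X := x t) in *. set (Y := y t) in *.
  assert (EY : Y * Y = n * n - X * X) by lra.
  field_simplify_eq; [|lra].
  replace (Y ^ 2) with (n * n - X * X) by (rewrite <- EY; ring).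
  ring_simplify.
  try replace (Y ^ 4) with ((n * n - X * X) * (n * n - X * X)) by (rewrite <- EY; ring).
  try replace (Y ^ 3) with ((n * n - X * X) * Y) by (rewrite <- EY; ring).
  try replace (Y ^ 2) with (n * n - X * X) by (rewrite <- EY; ring).
  ring.
- unfold log_gauge.
  set (n := sqrt (x t * x t + y t * y t)) in *.
  set (X := x t) in *. set (Y := y t) in *. rewrite <- Hs.
  set (Ch := (n + / n) / 2). set (c := X / n). set (s := Y / n). set (Sh := (n - / n) / 2).
  assert (E1 : c * c + s * s = 1).
  { unfold c, s. transitivity ((X * X + Y * Y) / (n * n)); [field; lra|].
    rewrite <- Hs. field; lra. }
  assert (E2 : Ch * Ch - Sh * Sh = 1) by (unfold Ch, Sh; field; lra).
  replace ((n * n + 1 - 2 * X) / (2 * n) + 1) with (Ch - c + 1)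
    by (unfold Ch, c; field; lra).
  replace (a * (n - / n) / 2 + b * s) with (a * Sh + b * s) by (unfold Sh; field; lra).
  assert (Hc : -1 <= c <= 1) by nra.
  assert (HC : 1 <= Ch).
  { unfold Ch. assert (0 <= (n - 1) * (n - 1) * / n).
    { apply Rmult_le_pos; [apply (Rle_0_sqr (n - 1))|]. left; now apply Rinv_0_lt_compat. }
    replace ((n - 1) * (n - 1) * / n) with (n + / n - 2) in * by (field; lra). lra. }
  assert (CS : (a * Sh + b * s) * (a * Sh + b * s) <= (Sh * Sh + s * s) * (a * a + b * b)).
  { pose proof (Rle_0_sqr (a * s - b * Sh)) as Q. unfold Rsqr in Q. lra. }
  eapply Rle_trans; [exact CS|]. apply Rmult_le_compat_r; [nra|].
  assert (0 <= (Ch - c) * (1 - c)) by (apply Rmult_le_pos; lra).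
  nra.
Qed.

(* The constant 9999/10000 < 1 keeps [ln (X + sqrt (X^2 - 9999/10000))], a perturbed
   [arcosh X], differentiable at the starting value [X = 1]; it starts at [ln (101/100)]. *)
Lemma ray_log_bounds (p dp k : C -> C) (beta : R) (z : C) : 0 < beta -> ray_bounded k ->
  (forall x, Cmod x < 1 -> is_Cderive p x (dp x)) ->
  (forall x, Cmod x < 1 -> p x <> RtoC 0) ->
  (forall x, Cmod x < 1 -> (beta * (x * dp x))%C = (k x * p x)%C) ->
  p (RtoC 0) = RtoC 1 -> Cmod z < 1 ->
  ln (Cmod (p z)) < 2 * log_const / beta /\
  log_gauge (Re (p z)) (Im (p z))
    + sqrt (log_gauge (Re (p z)) (Im (p z)) * log_gauge (Re (p z)) (Im (p z)) - 9999 / 10000)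
  < 101 / 100 * exp (2 * (1 - ln 2) / beta).
Proof.
intros Hb Hk Hp Hnz He P0 Hz. pose proof (Cmod_ge_0 z) as Nz.
set (x := fun t : R => Re (p (t * z)%C)). set (y := fun t : R => Im (p (t * z)%C)).
(* Logarithmic derivative of [p] along the ray; [beta * (t * d t)] equals [k (t * z)], so
   [ray_speed] applies to it. *)
set (d := fun t : R => (dp (t * z)%C * z / p (t * z)%C)%C).
assert (Hin : forall t, 0 <= t <= 1 -> Cmod (t * z)%C < 1) by (intros; now apply Cmod_ray).
assert (HN : forall t, 0 <= t <= 1 -> 0 < x t * x t + y t * y t).
{ intros t Ht. unfold x, y. rewrite <- Cmod_sqr.
  pose proof (proj1 (Cmod_gt_0 _) (Hnz _ (Hin t Ht))). nra. }
assert (Hc : forall t, 0 <= t <= 1 ->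
  curve_derive (fun s => p (s * z)%C) t (d t * p (t * z)%C)%C).
{ intros t Ht. replace (d t * p (t * z)%C)%C with (dp (t * z)%C * z)%C
    by (unfold d; field; apply Hnz; auto).
  apply curve_derive_ray. apply Hp; auto. }
assert (Hx : forall t, 0 <= t <= 1 -> is_derive x t (Re (d t) * x t - Im (d t) * y t)).
{ intros t Ht. exact (curve_derive_Re _ _ _ (Hc t Ht)). }
assert (Hy : forall t, 0 <= t <= 1 -> is_derive y t (Re (d t) * y t + Im (d t) * x t)).
{ intros t Ht. exact (curve_derive_Im _ _ _ (Hc t Ht)). }
assert (Hs : forall t, 0 < t < 1 -> (beta * (t * d t))%C = k (t * z)%C).
{ intros t Ht. assert (Hn := Hnz _ (Hin t ltac:(lra))).
  transitivity (beta * (t * z * dp (t * z)%C) / p (t * z)%C)%C; [unfold d; field; exact Hn|].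
  rewrite He by (apply Hin; lra). field; exact Hn. }
assert (E1 : p z = p (1 * z)%C) by (f_equal; ring).
assert (E0 : p (0 * z)%C = RtoC 1) by (rewrite <- P0; f_equal; ring).
assert (X0 : x 0 = 1) by (unfold x; rewrite E0; reflexivity).
assert (Y0 : y 0 = 0) by (unfold y; rewrite E0; reflexivity).
split.
- set (lnn := fun t => / 2 * ln (x t * x t + y t * y t)).
  assert (Hl : forall t, 0 <= t <= 1 -> is_derive lnn t (Re (d t))).
  { intros t Ht. specialize (HN t Ht).
    pose proof (Hx t Ht) as Dx. pose proof (Hy t Ht) as Dy.
    assert (Ex : ex_derive x t) by (eexists; exact Dx).
    assert (Ey : ex_derive y t) by (eexists; exact Dy).
    (* Made opaque, [x] and [y] are differentiated as unknown functions instead of being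
       unfolded. *)
    unfold lnn. clearbody x y. auto_derive; [repeat split; auto|].
    rewrite (Derive_eta _ _ _ Dx), (Derive_eta _ _ _ Dy). field. lra. }
  assert (M : lnn 1 - lnn 0 < 2 * log_const / beta).
  { eapply Rle_lt_trans; [|apply (scaled_total_lt beta _ _ _ Hb (re_majorant_total (Cmod z) ltac:(lra)))].
    apply (increment_le lnn (fun t => / beta * re_majorant (Cmod z) t)
      (fun t => Re (d t))
      (fun t => / beta * (Cmod z / (1 + sqrt (1 + t * Cmod z))))).
    + lra.
    + intros t Ht. eapply is_derive_continuity_pt. now apply Hl.
    + intros t Ht. eapply is_derive_continuity_pt. now apply is_derive_scaled_re_majorant.
    + intros t Ht. apply Hl; lra.
    + intros t Ht. apply is_derive_scaled_re_majorant; lra.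
    + intros t Ht. apply (ray_speed k z _ t beta); auto; lra. }
  unfold lnn in M. rewrite X0, Y0 in M.
  replace (1 * 1 + 0 * 0) with 1 in M by ring. rewrite ln_1 in M.
  unfold x, y in M. rewrite <- E1, <- Cmod_sqr in M.
  pose proof (proj1 (Cmod_gt_0 _) (Hnz z Hz)).
  rewrite ln_mult in M by lra. lra.
- set (X := fun t => log_gauge (x t) (y t)).
  set (g := fun t => ln (X t + sqrt (X t * X t - 9999 / 10000))).
  assert (HX : forall t, 0 <= t <= 1 -> 1 <= X t) by (intros t Ht; apply log_gauge_ge1; auto).
  (* With q^2 = X^2 - 9999/10000 one has X'^2 <= (X^2 - 1) |d|^2 <= q^2 |d|^2, and g' = X'/q. *)
  assert (Hdiff : forall t, 0 <= t <= 1 -> exists l, is_derive g t l /\ l <= Cmod (d t)).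
  { intros t Ht.
    destruct (log_gauge_derive x y t _ _ (HN t Ht) (Hx t Ht) (Hy t Ht)) as [l [Dl Hl]].
    change (is_derive X t l) in Dl. fold (X t) in Hl. rewrite <- Cmod_sqr in Hl.
    specialize (HX t Ht).
    assert (HXX : 1 <= X t * X t) by nra.
    assert (Hq : 0 < X t * X t - 9999 / 10000) by lra.
    pose proof (sqrt_lt_R0 _ Hq) as Hsq. pose proof (sqrt_sqrt _ (Rlt_le _ _ Hq)) as Hss.
    set (q := sqrt (X t * X t - 9999 / 10000)) in *.
    exists (l / q). split.
    - assert (ED : ex_derive X t) by (eexists; exact Dl).
      unfold g. clearbody X. auto_derive.
      + replace (X t * X t + - (9999 / 10000)) with (X t * X t - 9999 / 10000) by ring.
        fold q. repeat split; auto; lra.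
      + rewrite (Derive_eta _ _ _ Dl).
        replace (X t * X t + - (9999 / 10000)) with (X t * X t - 9999 / 10000) by ring.
        fold q. field. lra.
    - apply Rle_div_l; [exact Hsq|].
      pose proof (Cmod_ge_0 (d t)).
      assert (l * l <= (Cmod (d t) * q) * (Cmod (d t) * q)).
      { eapply Rle_trans; [exact Hl|]. 
        replace (Cmod (d t) * q * (Cmod (d t) * q)) with (q * q * (Cmod (d t) * Cmod (d t))) by ring.
        apply Rmult_le_compat_r; [nra|lra]. }
      assert (0 <= Cmod (d t) * q) by (apply Rmult_le_pos; lra). nra. }
  assert (M : g 1 - g 0 < 2 * (1 - ln 2) / beta).
  { eapply Rle_lt_trans; [|apply (scaled_total_lt beta _ _ _ Hb (abs_majorant_total (Cmod z) ltac:(lra)))].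
    apply (increment_le g (fun t => / beta * abs_majorant (Cmod z) t)
      (Derive g) (fun t => / beta * (Cmod z / (1 + sqrt (1 - t * Cmod z))))).
    + lra.
    + intros t Ht. destruct (Hdiff t Ht) as [l [Dl _]]. eapply is_derive_continuity_pt; exact Dl.
    + intros t Ht. eapply is_derive_continuity_pt. now apply is_derive_scaled_abs_majorant.
    + intros t Ht. destruct (Hdiff t ltac:(lra)) as [l [Dl _]].
      apply Derive_correct. eexists; exact Dl.
    + intros t Ht. apply is_derive_scaled_abs_majorant; lra.
    + intros t Ht. destruct (Hdiff t ltac:(lra)) as [l [Dl Hl]].
      rewrite (is_derive_unique _ _ _ Dl). eapply Rle_trans; [exact Hl|].
      apply (ray_speed k z _ t beta); auto; lra. }
  assert (G0 : X 0 = 1).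
  { unfold X, log_gauge. rewrite X0, Y0. replace (1 * 1 + 0 * 0) with 1 by ring.
    rewrite sqrt_1. field. }
  unfold g in M. rewrite G0 in M.
  replace (1 * 1 - 9999 / 10000) with ((1 / 100) * (1 / 100)) in M by field.
  rewrite sqrt_square in M by lra.
  rewrite E1. change (log_gauge (Re (p (1 * z)%C)) (Im (p (1 * z)%C))) with (X 1).
  specialize (HX 1 ltac:(lra)).
  set (A := X 1 + sqrt (X 1 * X 1 - 9999 / 10000)) in *.
  assert (HA : 0 < A) by (unfold A; pose proof (sqrt_pos (X 1 * X 1 - 9999 / 10000)); lra).
  replace (1 + 1 / 100) with (101 / 100) in M by field.
  rewrite <- (exp_ln A HA), <- (exp_ln (101 / 100)) by lra.
  rewrite <- exp_plus. apply exp_increasing. lra.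
Qed.

(* At a zero of [p] the derivative of [|p|^2] vanishes as well, so the differential
   inequality holds with no case distinction on the path. *)
Lemma nonvanishing_of_euler (p dp : C -> C) (M : R) (n : nat) : 0 <= M ->
  (forall x, Cmod x < 1 -> is_Cderive p x (dp x)) ->
  (forall x, Cmod x < 1 -> p x <> RtoC 0 -> Cmod (x * dp x)%C <= M * Cmod (p x) ^ S n) ->
  p (RtoC 0) = RtoC 1 -> forall z, Cmod z < 1 -> p z <> RtoC 0.
Proof.
intros HM Hp Hd P0 z Hz.
destruct (disk_max (fun x => Cmod (p x) * Cmod (p x)) (Cmod z)) as [x0 [_ Hx0]].
{ apply Cmod_ge_0. }
{ intros x Hx. apply Rcont_Cmod_sqr. eapply is_Cderive_Ccont. apply Hp; lra. }
(* A bound for [p] on the closed disk through [z]: it turns the power [S n] into [B ^ n] times a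
   linear factor, as Gronwall's argument requires. *)
set (B := Cmod (p x0)) in *. pose proof (Cmod_ge_0 (p x0)) as NB. fold B in NB.
assert (HB : forall x, Cmod x <= Cmod z -> Cmod (p x) <= B).
{ intros x Hx. specialize (Hx0 x Hx). pose proof (Cmod_ge_0 (p x)). nra. }
pose proof (Cmod_ge_0 z) as Nz.
(* The hypothesis controls [x * dp x], hence [dp x] only away from the origin. The argument
   therefore starts at some [t0 > 0], where continuity at 0 still gives a nonzero value. *)
assert (exists t0, 0 < t0 <= 1 /\ p (t0 * z)%C <> RtoC 0) as [t0 [Ht0 Hn0]].
{ destruct (is_Cderive_Ccont p (RtoC 0) (dp (RtoC 0))) with (e := / 2) as [d [Hdp Hb]].
  - apply Hp. rewrite Cmod_0; lra.
  - lra.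
  - exists (Rmin 1 (d / 2)). pose proof (Rmin_l 1 (d / 2)). pose proof (Rmin_r 1 (d / 2)).
    assert (0 < Rmin 1 (d / 2)) by (apply Rmin_glb_lt; lra).
    split; [lra|]. intro E. specialize (Hb (Rmin 1 (d / 2) * z)%C).
    rewrite Cplus_0_l, E, P0 in Hb.
    replace (0 - 1)%C with (- (1))%C in Hb by ring. rewrite Cmod_opp, Cmod_1 in Hb.
    assert (1 <= / 2); [apply Hb|lra].
    rewrite Cmod_mult, Cmod_R, Rabs_pos_eq by lra. nra. }
set (N := fun t : R => Re (p (t * z)%C) * Re (p (t * z)%C) + Im (p (t * z)%C) * Im (p (t * z)%C)).
set (K := 2 * M * B ^ n / t0).
set (dN := fun t : R => 2 * (Re (p (t * z)%C) * Re (dp (t * z)%C * z)%C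
                           + Im (p (t * z)%C) * Im (dp (t * z)%C * z)%C)).
assert (HN : forall t, 0 <= t <= 1 -> is_derive N t (dN t)).
{ intros t Ht. destruct (Cmod_ray z t Hz Ht) as [_ [Hin _]].
  pose proof (curve_derive_ray p dp z t (Hp _ Hin)) as Hc.
  pose proof (curve_derive_Re _ _ _ Hc) as D1. pose proof (curve_derive_Im _ _ _ Hc) as D2.
  assert (Q : forall f : R -> R, forall l, is_derive f t l -> is_derive (fun s => f s * f s) t (2 * (f t * l))).
  { intros f l Df. assert (ex_derive f t) by (eexists; exact Df).
    auto_derive; [repeat split; auto|]. rewrite (Derive_eta _ _ _ Df). ring. }
  unfold N, dN. rewrite Rmult_plus_distr_l.
  apply (is_derive_plus (V := R_NormedModule)); now apply Q. }
assert (HdN : forall t, t0 <= t <= 1 -> - K * N t <= dN t).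
{ intros t Ht. destruct (Cmod_ray z t Hz ltac:(lra)) as [E [Hin _]].
  unfold N. rewrite <- Cmod_sqr.
  destruct (Ceq_dec (p (t * z)%C) 0%C) as [Ez|Hn].
  { unfold dN. rewrite Ez, Cmod_0. simpl. lra. }
  specialize (Hd _ Hin Hn).
  assert (Hle : Cmod (p (t * z)%C) <= B).
  { apply HB. rewrite E. nra. }
  set (g := p (t * z)%C) in *. set (v := (dp (t * z)%C * z)%C).
  assert (Ev : (t * z * dp (t * z)%C)%C = (t * v)%C) by (unfold v; ring).
  rewrite Ev, Cmod_mult, Cmod_R, Rabs_pos_eq in Hd by lra.
  pose proof (Cmod_ge_0 g) as Ng. pose proof (Cmod_ge_0 v) as Nv.
  assert (Hpow : Cmod g ^ n <= B ^ n) by (apply pow_incr; lra).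
  assert (Hv : Cmod v <= M * B ^ n / t0 * Cmod g).
  { apply Rmult_le_reg_l with t0; [lra|].
    replace (t0 * (M * B ^ n / t0 * Cmod g)) with (M * (Cmod g * B ^ n)) by (field; lra).
    apply Rle_trans with (t * Cmod v); [apply Rmult_le_compat_r; lra|].
    eapply Rle_trans; [exact Hd|]. apply Rmult_le_compat_l; [exact HM|].
    simpl. apply Rmult_le_compat_l; lra. }
  assert (CS : - (Cmod g * Cmod v) <= Re g * Re v + Im g * Im v).
  { replace (Re g * Re v + Im g * Im v) with (Re (Cconj g * v)%C) by (unfold Re, Im; simpl; ring).
    pose proof (re_le_Cmod (Cconj g * v)%C) as T. rewrite Cmod_mult, Cmod_conj in T.
    apply Rabs_le_between in T. lra. }
  assert (Cmod g * Cmod v <= Cmod g * (M * B ^ n / t0 * Cmod g)) by (apply Rmult_le_compat_l; lra).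
  change (- K * (Cmod g * Cmod g) <= 2 * (Re g * Re v + Im g * Im v)).
  unfold K.
  replace (- (2 * M * B ^ n / t0) * (Cmod g * Cmod g))
    with (- (2 * (Cmod g * (M * B ^ n / t0 * Cmod g)))) by (field; lra).
  lra. }
(* Gronwall: since N' >= - K N, the product of [N] with [exp (K * t)] does not decrease, so [N 1]
   inherits positivity from [N t0]. *)
assert (HI : 0 - 0 <= exp (K * 1) * N 1 - exp (K * t0) * N t0).
{ apply (increment_le (fun _ => 0) (fun t => exp (K * t) * N t) (fun _ => 0)
    (fun t => exp (K * t) * (K * N t + dN t))).
  - lra.
  - intros; apply continuity_pt_const. now intros ? ?.
  - intros t Ht. apply continuity_pt_mult.
    + apply (is_derive_continuity_pt _ _ (K * exp (K * t))). auto_derive; [auto|ring].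
    + eapply is_derive_continuity_pt. apply HN; lra.
  - intros; apply (is_derive_const (V := R_NormedModule)).
  - intros t Ht. pose proof (HN t ltac:(lra)) as D. assert (ex_derive N t) by (eexists; exact D).
    clearbody N. auto_derive; [repeat split; auto|]. rewrite (Derive_eta _ _ _ D). ring.
  - intros t Ht. apply Rmult_le_pos; [left; apply exp_pos|].
    specialize (HdN t ltac:(lra)). lra. }
assert (HN0 : 0 < N t0).
{ unfold N. rewrite <- Cmod_sqr. pose proof (proj1 (Cmod_gt_0 _) Hn0). nra. }
assert (HN1 : 0 < N 1).
{ pose proof (exp_pos (K * 1)). pose proof (exp_pos (K * t0)).
  assert (0 < exp (K * t0) * N t0) by now apply Rmult_lt_0_compat. nra. }
unfold N in HN1. replace (1 * z)%C with z in HN1 by ring.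
intro E. rewrite E in HN1. simpl in HN1. lra.
Qed.

(** * The nephroid *)

Lemma phi_Ne_sub (a b : C) :
  (phi_Ne a - phi_Ne b)%C = ((a - b) * (1 - (a * a + a * b + b * b) / 3))%C.
Proof. unfold phi_Ne. field. Qed.

Lemma is_Cderive_phi_Ne (z : C) : is_Cderive phi_Ne z (1 - z * z)%C.
Proof.
unfold phi_Ne.
eapply is_Cderive_eq.
- apply (is_Cderive_minus (fun z => (1 + z)%C) (fun z => (z ^ 3 * / 3)%C)).
  + apply is_Cderive_plus; [apply is_Cderive_const|apply is_Cderive_id].
  + apply (is_Cderive_mult (fun z => (z * (z * (z * 1)))%C)); [|apply is_Cderive_const].
    do 3 (apply is_Cderive_mult; [apply is_Cderive_id|]). apply is_Cderive_const.
- cbv beta. field.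
Qed.

Lemma phi_Ne_analytic : analytic phi_Ne.
Proof. intros z _. eexists. apply is_Cderive_phi_Ne. Qed.

(** A quantitative injectivity: the factor is positive for |a| < 1 and independent of b, which also
    yields local Lipschitz bounds for the inverse. *)
Lemma phi_Ne_sub_lower (a b : C) : Cmod a <= 1 -> Cmod b <= 1 ->
  Cmod (a - b)%C * (1 - (Cmod a * Cmod a + Cmod a + 1) / 3) <= Cmod (phi_Ne a - phi_Ne b)%C.
Proof.
intros Ha Hb. rewrite phi_Ne_sub, Cmod_mult. apply Rmult_le_compat_l; [apply Cmod_ge_0|].
pose proof (Cmod_ge_sub 1 ((a * a + a * b + b * b) / 3)) as T. rewrite Cmod_1 in T.
eapply Rle_trans; [|exact T].
rewrite Cmod_div, (Cmod_R 3), (Rabs_pos_eq 3) by (lra || (intro E; apply RtoC_inj in E; lra)).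
pose proof (Cmod_triangle (a * a + a * b) (b * b)) as T1.
pose proof (Cmod_triangle (a * a) (a * b)) as T2.
rewrite (Cmod_mult b b) in T1. rewrite (Cmod_mult a a), (Cmod_mult a b) in T2.
pose proof (Cmod_ge_0 a). pose proof (Cmod_ge_0 b).
assert (Cmod a * Cmod b <= Cmod a * 1) by (apply Rmult_le_compat_l; lra).
assert (Cmod b * Cmod b <= 1) by nra.
lra.
Qed.

Lemma phi_Ne_inj (a b : C) : Cmod a < 1 -> Cmod b < 1 -> phi_Ne a = phi_Ne b -> a = b.
Proof.
intros Ha Hb E.
pose proof (phi_Ne_sub_lower a b ltac:(lra) ltac:(lra)) as H.
rewrite E in H. replace (phi_Ne b - phi_Ne b)%C with (RtoC 0) in H by ring.
rewrite Cmod_0 in H. pose proof (Cmod_ge_0 (a - b)%C). pose proof (Cmod_ge_0 a).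
assert (Cmod (a - b)%C = 0) as Z.
{ assert (0 < 1 - (Cmod a * Cmod a + Cmod a + 1) / 3) by nra. nra. }
apply Cmod_eq_0 in Z. replace a with (a - b + b)%C by ring. rewrite Z. ring.
Qed.

(** Up to the factor 2, the hypothesis is the sign of the derivative at s = 0 of |phi_Ne(z0 + s h) -
    v|^2. *)
Lemma phi_Ne_descent (z0 h v : C) :
  Re (Cconj (phi_Ne z0 - v) * ((1 - z0 * z0) * h))%C < 0 ->
  exists d, 0 < d /\ forall s, 0 < s < d ->
    Cmod (phi_Ne (z0 + s * h)%C - v)%C < Cmod (phi_Ne z0 - v)%C.
Proof.
intro Hneg.
set (g := fun s : R => (phi_Ne (z0 + s * h)%C - v)%C).
assert (G0 : g 0 = (phi_Ne z0 - v)%C) by (unfold g; do 2 f_equal; ring).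
assert (Hg : curve_derive g 0 ((1 - z0 * z0) * h)%C).
{ unfold g.
  replace ((1 - z0 * z0) * h)%C with ((1 - (z0 + 0 * h) * (z0 + 0 * h)) * h - 0)%C by ring.
  apply curve_derive_minus.
  - apply (curve_derive_comp phi_Ne (fun s => (z0 + s * h)%C)).
    + apply is_Cderive_phi_Ne.
    + apply curve_derive_line.
  - apply curve_derive_pair; unfold Re, Im; simpl; apply (is_derive_const (V := R_NormedModule)). }
set (l := ((1 - z0 * z0) * h)%C) in *.
pose proof (curve_derive_Re _ _ _ Hg) as D1. pose proof (curve_derive_Im _ _ _ Hg) as D2.
set (x := fun s => Re (g s)). set (y := fun s => Im (g s)).
change (is_derive x 0 (Re l)) in D1. change (is_derive y 0 (Im l)) in D2.
assert (D : is_derive (fun s => x s * x s + y s * y s) 0 (2 * (x 0 * Re l + y 0 * Im l))).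
{ assert (ex_derive x 0) by (eexists; exact D1). assert (ex_derive y 0) by (eexists; exact D2).
  clearbody x y. auto_derive; [repeat split; auto|].
  rewrite (Derive_eta _ _ _ D1), (Derive_eta _ _ _ D2). ring. }
set (m := 2 * (x 0 * Re l + y 0 * Im l)) in *.
assert (Hm : m < 0).
{ unfold m, x, y. rewrite G0. 
  replace (Re (phi_Ne z0 - v)%C * Re l + Im (phi_Ne z0 - v)%C * Im l)
    with (Re (Cconj (phi_Ne z0 - v) * l)%C) by (unfold Re, Im; simpl; ring). lra. }
destruct (is_derive_R_le _ _ _ D (- m / 2)) as [d [Hd Hb]]; [lra|].
exists d; split; [exact Hd|]. intros s Hs.
specialize (Hb s). rewrite Rabs_pos_eq in Hb by lra. specialize (Hb ltac:(lra)).
rewrite Rplus_0_l in Hb. apply Rabs_le_between in Hb.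
unfold x, y in Hb. rewrite <- !Cmod_sqr, G0 in Hb.
change (Cmod (g s) < Cmod (phi_Ne z0 - v)%C).
pose proof (Cmod_ge_0 (g s)). pose proof (Cmod_ge_0 (phi_Ne z0 - v)%C).
assert (m * s < 0) by nra. nra.
Qed.

(* A point [v] whose nearest point on the nephroid boundary is [phi_Ne (c + i s)] lies
   on the normal there: [nu] is the position on the outer normal ray. *)
Lemma outer_normal_escape (c s nu x y : R) : c * c + s * s = 1 -> 0 <= nu ->
  x = 1 + 2 * c - 4 / 3 * (c * c * c) + 2 * c * (s * s) * nu ->
  y = s * (4 / 3 * (s * s) + nu * (s * s - c * c)) ->
  1 / 3 < x -> x * x + y * y < 25 / 9 -> y * y < 1 -> False.
Proof.
intros Hcs Hnu Hx Hy Hx1 Hn Hy1.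
set (S := s * s) in *. assert (HS : S = 1 - c * c) by lra.
assert (HS0 : 0 <= S) by (unfold S; nra).
assert (Hc : -1 <= c <= 1) by nra.
set (X := 1 + 2 * c - 4 / 3 * (c * c * c)) in *.
assert (Hyy : y * y = S * ((4 / 3 * S + nu * (S - c * c)) * (4 / 3 * S + nu * (S - c * c)))).
{ rewrite Hy. unfold S. ring. }
destruct (Rle_dec 0 c) as [H0|H0].
(* Right half of the curve: each term after 25/9 is nonnegative, so the outer normal stays outside
   the disk of radius 5/3. *)
- assert (E : x * x + y * y = 25 / 9 + 4 * (c * (1 - c)) * (1 + 2 / 3 * c)
     + 2 * nu * S * (2 * c + 4 / 3)
     + nu * nu * (S * (4 * (c * c) * S + (S - c * c) * (S - c * c)))).
  { rewrite Hyy, Hx. unfold X. rewrite HS. field. }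
  assert (0 <= c * (1 - c)) by nra.
  assert (0 <= 4 * (c * (1 - c)) * (1 + 2 / 3 * c)) by (apply Rmult_le_pos; lra).
  assert (0 <= nu * S) by nra.
  assert (0 <= 2 * (nu * S) * (2 * c + 4 / 3)) by (apply Rmult_le_pos; lra).
  assert (0 <= nu * nu * (S * (4 * (c * c) * S + (S - c * c) * (S - c * c)))).
  { apply Rmult_le_pos; [nra|]. apply Rmult_le_pos; [exact HS0|].
    pose proof (Rle_0_sqr (S - c * c)). unfold Rsqr in *.
    assert (0 <= c * c * S) by (apply Rmult_le_pos; nra). lra. }
  lra.
- assert (HcS : 0 <= (- c) * (S * nu)) by (apply Rmult_le_pos; [lra|now apply Rmult_le_pos]).
  (* Left half: this sign decides whether the curve point has real part at most 1/3. If so, moving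
     outwards keeps the real part there, since [c < 0]. *)
  destruct (Rle_dec 0 (2 * (c * c) - 2 * c - 1)) as [H1|H1].
  + assert (E : 1 / 3 - X = 2 / 3 * ((c + 1) * (2 * (c * c) - 2 * c - 1)))
      by (unfold X; field).
    assert (0 <= (c + 1) * (2 * (c * c) - 2 * c - 1)) by (apply Rmult_le_pos; lra).
    lra.
  (* Otherwise c exceeds (1 - sqrt 3)/2, about -0.366. Then s^2 >= 863/1000, and the imaginary part
     has modulus above 1. *)
  + assert (Hc37 : -37 / 100 < c) by nra.
    assert (HS1 : 863 / 1000 <= S) by nra.
    assert (A : 4 / 3 * (863 / 1000) <= 4 / 3 * S + nu * (S - c * c)).
    { assert (0 <= nu * (S - c * c)) by (apply Rmult_le_pos; nra). lra. }
    assert (B : 4 / 3 * (863 / 1000) * (4 / 3 * (863 / 1000)) <=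
      (4 / 3 * S + nu * (S - c * c)) * (4 / 3 * S + nu * (S - c * c)))
      by (apply Rmult_le_compat; lra).
    nra.
Qed.

(** For a point on the circle: [a < 0] points into the disk and the second inequality decreases the
    distance. If [g2 <> 0], take [b = g2] with [a] a small negative number. *)
Lemma halfplanes_meet (g1 g2 : R) : 0 < g1 \/ g2 <> 0 ->
  exists a b, a < 0 /\ g1 * a - g2 * b < 0.
Proof.
intros [H|H].
- exists (-1), 0. lra.
- exists (- (g2 * g2 / (2 * (Rabs g1 + 1)))), g2.
  pose proof (Rabs_pos g1).
  assert (0 < g2 * g2) by (destruct (Rtotal_order g2 0) as [Q|[Q|Q]]; nra).
  assert (Hq : 0 < g2 * g2 / (2 * (Rabs g1 + 1))) by (apply Rdiv_lt_0_compat; lra).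
  split; [lra|].
  assert (- g1 <= Rabs g1) by (unfold Rabs; destruct Rcase_abs; lra).
  assert (E : (Rabs g1 + 1) * (g2 * g2 / (2 * (Rabs g1 + 1))) = g2 * g2 / 2) by (field; lra).
  set (q := g2 * g2 / (2 * (Rabs g1 + 1))) in *.
  assert (- g1 * q <= Rabs g1 * q) by (apply Rmult_le_compat_r; lra). lra.
Qed.

(** A minimiser [z0] of the distance to [v] over the closed disk cannot lie on the circle. Inside,
    the derivative 1 - z0^2 is nonzero, so a positive distance could be decreased. *)
Lemma nephroid_contains (v : C) : 1 / 3 < Re v -> Cmod v < 5 / 3 -> Rabs (Im v) < 1 ->
  exists z, Cmod z < 1 /\ phi_Ne z = v.
Proof.
intros Hre Hmod Him.
destruct (disk_max (fun z => - (Cmod (phi_Ne z - v)%C * Cmod (phi_Ne z - v)%C)) 1)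
  as [z0 [Hz0 Hmax]]; [lra| |].
{ intros z _ e He.
  destruct (Rcont_Cmod_sqr (fun z => (phi_Ne z - v)%C) z) with (e := e) as [d [Hd Hb]]; auto.
  - eapply is_Cderive_Ccont. apply is_Cderive_minus; [apply is_Cderive_phi_Ne|apply is_Cderive_const].
  - exists d; split; [exact Hd|]. intros h Hh. specialize (Hb h Hh).
    rewrite <- Rabs_Ropp. eapply Rle_trans; [|exact Hb]. right; f_equal; ring. }
assert (Hmin : forall z, Cmod z <= 1 -> Cmod (phi_Ne z0 - v)%C <= Cmod (phi_Ne z - v)%C).
{ intros z Hz. specialize (Hmax z Hz).
  pose proof (Cmod_ge_0 (phi_Ne z0 - v)%C). pose proof (Cmod_ge_0 (phi_Ne z - v)%C). nra. }
clear Hmax.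
assert (Hdir : forall h, Re (Cconj (phi_Ne z0 - v) * ((1 - z0 * z0) * h))%C < 0 ->
  forall d', 0 < d' -> (forall s, 0 < s < d' -> Cmod (z0 + s * h)%C <= 1) -> False).
{ intros h Hneg d' Hd' Hin.
  destruct (phi_Ne_descent z0 h v Hneg) as [d [Hd Hb]].
  set (s := Rmin d d' / 2).
  pose proof (Rmin_l d d'). pose proof (Rmin_r d d').
  assert (0 < Rmin d d') by now apply Rmin_glb_lt.
  specialize (Hb s ltac:(unfold s; lra)).
  specialize (Hmin _ (Hin s ltac:(unfold s; lra))). lra. }
assert (Him2 : Im v * Im v < 1).
{ apply Rabs_lt_between in Him. nra. }
assert (Hmod2 : Re v * Re v + Im v * Im v < 25 / 9).
{ rewrite <- Cmod_sqr. pose proof (Cmod_ge_0 v). nra. }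
destruct (Req_dec (Cmod z0) 1) as [H1|H1].
- exfalso.
  pose proof (Cmod_sqr z0) as Hcs. rewrite H1 in Hcs.
  assert (Ez : z0 = (Re z0, Im z0)) by apply surjective_pairing.
  set (c := Re z0) in *. set (s := Im z0) in *.
  assert (EN : phi_Ne z0 = (1 + 2 * c - 4 / 3 * (c * c * c), s * (4 / 3 * (s * s)))).
  { assert (En : phi_Ne z0 = (1 + c - (c * c * c - 3 * (c * (s * s))) / 3,
                            s - (3 * (c * c * s) - s * s * s) / 3)).
    { rewrite Ez. unfold phi_Ne, Cdiv, Cinv, Cminus, Copp, Cplus, Cmult; simpl. f_equal; field. }
    rewrite En. replace (s * s) with (1 - c * c) by lra.
    f_equal; [field|]. replace (c * c) with (1 - s * s) by lra. field. }
  (* The points +-1 are critical for [phi_Ne], so first-order descent is silent at the cusps; there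
     the comparison is made along the real axis. *)
  destruct (Req_dec s 0) as [Hs|Hs].
  + assert (Hc : c = 1 \/ c = -1).
    { rewrite Hs in Hcs. assert ((c - 1) * (c + 1) = 0) by lra.
      apply Rmult_integral in H. destruct H; [left|right]; lra. }
    assert (Hreal : forall t : R, phi_Ne (RtoC t) = RtoC (1 + t - t * t * t / 3)).
    { intro t. unfold phi_Ne. rewrite RtoC_minus, RtoC_plus, RtoC_div, !RtoC_mult by lra.
      simpl. field. }
    assert (Hcmp : forall a b : R, (a - Re v) * (a - Re v) < (b - Re v) * (b - Re v) ->
       Cmod (RtoC a - v)%C < Cmod (RtoC b - v)%C).
    { intros a b Hab. pose proof (Cmod_sqr (RtoC a - v)%C) as Q1.
      pose proof (Cmod_sqr (RtoC b - v)%C) as Q2.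
      replace (Re (RtoC a - v)%C) with (a - Re v) in Q1 by (unfold Re; simpl; ring).
      replace (Re (RtoC b - v)%C) with (b - Re v) in Q2 by (unfold Re; simpl; ring).
      replace (Im (RtoC a - v)%C) with (- Im v) in Q1 by (unfold Im; simpl; ring).
      replace (Im (RtoC b - v)%C) with (- Im v) in Q2 by (unfold Im; simpl; ring).
      pose proof (Cmod_ge_0 (RtoC a - v)%C). pose proof (Cmod_ge_0 (RtoC b - v)%C). nra. }
    assert (Hre2 : Re v < 5 / 3) by (pose proof (Re_le_Cmod' v); lra).
    assert (Ez' : z0 = RtoC c) by (rewrite Ez, Hs; reflexivity).
    assert (Hd : exists d, 0 < d <= 1 /\ d <= 5 / 3 - Re v /\ d <= Re v - 1 / 3).
    { exists (Rmin 1 (Rmin (5 / 3 - Re v) (Re v - 1 / 3))).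
      pose proof (Rmin_l 1 (Rmin (5 / 3 - Re v) (Re v - 1 / 3))).
      pose proof (Rmin_r 1 (Rmin (5 / 3 - Re v) (Re v - 1 / 3))).
      pose proof (Rmin_l (5 / 3 - Re v) (Re v - 1 / 3)).
      pose proof (Rmin_r (5 / 3 - Re v) (Re v - 1 / 3)).
      repeat split; try lra. repeat apply Rmin_glb_lt; lra. }
    destruct Hd as [d [Hd [Hd1 Hd2]]].
    (* The distance that the value moves from its cusp when the argument moves by [d] into the disk;
       [m <= d] prevents passing beyond [Re v]. *)
    set (m := d * d - d * d * d / 3).
    assert (Hdd : d * d <= d) by nra.
    assert (Hm : 0 < m /\ m <= d).
    { assert (0 < d * d) by nra. assert (d * d * d <= d * d) by nra.
      assert (0 < d * d * d) by (apply Rmult_lt_0_compat; lra).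
      unfold m; lra. }
    destruct Hc as [Hc|Hc].
    * assert (Hin : Cmod (RtoC (1 - d)) <= 1) by (rewrite Cmod_R, Rabs_pos_eq; lra).
      specialize (Hmin _ Hin). rewrite Ez', Hc, !Hreal in Hmin.
      assert (Q := Hcmp (1 + (1 - d) - (1 - d) * (1 - d) * (1 - d) / 3) (1 + 1 - 1 * 1 * 1 / 3)).
      apply Rle_not_lt in Hmin. apply Hmin, Q.
      replace (1 + (1 - d) - (1 - d) * (1 - d) * (1 - d) / 3) with (5 / 3 - m) by (unfold m; field).
      replace (1 + 1 - 1 * 1 * 1 / 3) with (5 / 3) by field. nra.
    * assert (Hin : Cmod (RtoC (d - 1)) <= 1).
      { rewrite Cmod_R. apply Rabs_le_between; lra. }
      specialize (Hmin _ Hin). rewrite Ez', Hc, !Hreal in Hmin.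
      assert (Q := Hcmp (1 + (d - 1) - (d - 1) * (d - 1) * (d - 1) / 3) (1 + -1 - -1 * -1 * -1 / 3)).
      apply Rle_not_lt in Hmin. apply Hmin, Q.
      replace (1 + (d - 1) - (d - 1) * (d - 1) * (d - 1) / 3) with (1 / 3 + m) by (unfold m; field).
      replace (1 + -1 - -1 * -1 * -1 / 3) with (1 / 3) by field. nra.
  (* Cosine and sine of twice the angle of [z0]: z0 (1 - z0^2) = 2 s (Q - i P), so Q - i P is normal
     to the boundary curve. *)
  + set (P := c * c - s * s). set (Q := 2 * c * s).
    set (d1 := Re (phi_Ne z0 - v)%C). set (d2 := Im (phi_Ne z0 - v)%C).
    assert (PQ : P * P + Q * Q = 1).
    { unfold P, Q. replace 1 with ((c * c + s * s) * (c * c + s * s)) by (rewrite <- Hcs; ring).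
      ring. }
    (* Either some inward direction decreases the distance, or the tangential component of the
       difference vanishes and its normal component has a definite sign. *)
    destruct (classic (0 < 2 * s * (d1 * Q - d2 * P) \/ - 2 * s * (d1 * P + d2 * Q) <> 0))
      as [HG|HG].
    * destruct (halfplanes_meet _ _ HG) as [a [b [Ha Hab]]].
      assert (Hh2 : 0 < a * a + b * b) by nra.
      (* The squared modulus of 1 + t (a + ib) is at most 1 as long as t (a^2 + b^2) <= -2a. *)
      apply (Hdir (z0 * (a, b))%C) with (d' := - (2 * a) / (a * a + b * b)).
      -- replace (Re (Cconj (phi_Ne z0 - v) * ((1 - z0 * z0) * (z0 * (a, b))))%C)
           with (2 * s * (d1 * Q - d2 * P) * a - - 2 * s * (d1 * P + d2 * Q) * b); [exact Hab|].
         assert (Ek : ((1 - z0 * z0) * z0)%C = ((2 * s * Q)%R, (- 2 * s * P)%R)).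
         { replace (RtoC 1) with (RtoC (c * c + s * s)) by (rewrite <- Hcs; f_equal; ring).
           rewrite Ez. unfold P, Q, Cminus, Copp, Cplus, Cmult, RtoC; simpl. f_equal; ring. }
         replace ((1 - z0 * z0) * (z0 * (a, b)))%C with ((1 - z0 * z0) * z0 * (a, b))%C by ring.
         rewrite Ek. unfold d1, d2. clear.
         destruct (phi_Ne z0 - v)%C as [u1 u2]. unfold Re, Im; simpl. ring.
      -- apply Rdiv_lt_0_compat; lra.
      -- intros t Ht. apply Cmod_le_sqr; [lra|].
         assert (Ht2 : t * (a * a + b * b) < - (2 * a)) by (apply Rlt_div_r; lra).
         replace (z0 + t * (z0 * (a, b)))%C with (z0 * ((1 + t * a)%R, (t * b)%R))%C.
         2:{ rewrite Ez. unfold Cplus, Cmult, RtoC; simpl. f_equal; ring. }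
         rewrite <- Cmod_sqr, Cmod_mult, H1, Rmult_1_l, Cmod_sqr.
         unfold Re, Im; simpl. nra.
    * assert (HG1 : s * (d1 * Q - d2 * P) <= 0).
      { apply Rnot_lt_le; intro K; apply HG; left; lra. }
      assert (HG2 : d1 * P + d2 * Q = 0).
      { apply NNPP; intro K; apply HG; right. intro K2. apply K.
        apply Rmult_eq_reg_l with (- 2 * s); [|lra]. lra. }
      set (kap := d1 * Q - d2 * P) in *.
      assert (E1 : d1 = kap * Q).
      { transitivity (d1 * (P * P + Q * Q) - P * (d1 * P + d2 * Q)); [rewrite PQ, HG2; ring|].
        unfold kap; ring. }
      assert (E2 : d2 = - kap * P).
      { transitivity (d2 * (P * P + Q * Q) - Q * (d1 * P + d2 * Q)); [rewrite PQ, HG2; ring|].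
        unfold kap; ring. }
      assert (Hss : 0 < s * s) by (destruct (Rtotal_order s 0) as [K|[K|K]]; nra).
      (* This is - kap / s, written so that its sign follows from [HG1]. *)
      apply (outer_normal_escape c s (- (s * kap) / (s * s)) (Re v) (Im v)); auto; try lra.
      -- apply Rdiv_le_0_compat; lra.
      -- replace (Re v) with (Re (phi_Ne z0) - d1) by (unfold d1, Re; simpl; ring).
         rewrite E1, EN. unfold Re, Q; simpl. field; exact Hs.
      -- replace (Im v) with (Im (phi_Ne z0) - d2) by (unfold d2, Im; simpl; ring).
         rewrite E2, EN. unfold Im, P; simpl. field; exact Hs.
- exists z0. split; [lra|].
  destruct (Ceq_dec (phi_Ne z0 - v)%C 0%C) as [E|Hn].
  { replace (phi_Ne z0) with (phi_Ne z0 - v + v)%C by ring. rewrite E. ring. }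
  exfalso.
  set (D := (phi_Ne z0 - v)%C) in *. set (a := (1 - z0 * z0)%C).
  assert (Ha : 0 < Cmod a).
  { pose proof (Cmod_ge_sub 1 (z0 * z0)) as T. rewrite Cmod_1, Cmod_mult in T. fold a in T.
    pose proof (Cmod_ge_0 z0). nra. }
  pose proof (proj1 (Cmod_gt_0 D) Hn) as HD.
  (* Steepest descent: the product tested by [Hdir] becomes -|D|^2 |a|^2. *)
  set (h := (- (D * Cconj a))%C).
  apply (Hdir h) with (d' := (1 - Cmod z0) / (Cmod h + 1)).
  + fold a. replace (Cconj D * (a * h))%C with (- RtoC (Cmod D ^ 2 * Cmod a ^ 2))%C.
    * assert (0 < Cmod D ^ 2 * Cmod a ^ 2) by (simpl; repeat apply Rmult_lt_0_compat; lra).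
      unfold Re; simpl in *. lra.
    * rewrite RtoC_mult, !Cmod2_conj. unfold h. ring.
  + pose proof (Cmod_ge_0 h). apply Rdiv_lt_0_compat; lra.
  + intros s Hs. pose proof (Cmod_ge_0 h).
    eapply Rle_trans; [apply Cmod_triangle|]. rewrite Cmod_mult, Cmod_R, Rabs_pos_eq by lra.
    assert (s * (Cmod h + 1) < 1 - Cmod z0) by (apply Rlt_div_r; lra). nra.
Qed.

(** Preimages chosen pointwise form [w]. From p(y) - p(z) = (w(y) - a) m(y) with a = w(z), [w] is
    [a] plus an increment of [p] times the factor 1/m. The lower bound for [phi_Ne] makes [w]
    Lipschitz, hence m continuous, and m(z) = 1 - a^2 is nonzero: Carathéodory's form applies. *)
Lemma subordinate_phi_Ne (p : C -> C) : analytic p -> p (RtoC 0) = RtoC 1 ->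
  (forall z, Cmod z < 1 -> 1 / 3 < Re (p z) /\ Cmod (p z) < 5 / 3 /\ Rabs (Im (p z)) < 1) ->
  subordinate p phi_Ne.
Proof.
intros Hp P0 Hreg. split; [exact Hp|]. split; [exact phi_Ne_analytic|].
set (w := fun z => epsilon (inhabits (RtoC 0)) (fun x => Cmod x < 1 /\ phi_Ne x = p z)).
assert (Hw : forall z, Cmod z < 1 -> Cmod (w z) < 1 /\ phi_Ne (w z) = p z).
{ intros z Hz. unfold w. apply epsilon_spec.
  destruct (Hreg z Hz) as [A [B D]]. now apply nephroid_contains. }
exists w. split; [|split; [|split]].
- intros z Hz. unfold unit_disk in Hz. destruct (Hp z Hz) as [l Hl].
  destruct (Hw z Hz) as [Ha Ea]. set (a := w z) in *.
  pose proof (Cmod_ge_0 a) as Na.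
  set (c0 := 1 - (Cmod a * Cmod a + Cmod a + 1) / 3).
  assert (Hc0 : 0 < c0) by (unfold c0; nra).
  destruct (is_Cderive_local_lipschitz p z l Hl) as [d1 [Hd1 L1]].
  set (d := Rmin d1 (1 - Cmod z)).
  assert (Hd : 0 < d) by (apply Rmin_glb_lt; lra).
  assert (Hin : forall h, Cmod h < d -> Cmod h < d1 /\ Cmod (z + h)%C < 1).
  { intros h Hh. pose proof (Rmin_l d1 (1 - Cmod z)). pose proof (Rmin_r d1 (1 - Cmod z)).
    pose proof (Cmod_triangle z h). fold d in H, H0. split; lra. }
  assert (HL : 0 < (Cmod l + 1) / c0) by (pose proof (Cmod_ge_0 l); apply Rdiv_lt_0_compat; lra).
  assert (Lw : forall h, Cmod h < d -> Cmod (w (z + h)%C - a)%C <= (Cmod l + 1) / c0 * Cmod h).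
  { intros h Hh. destruct (Hin h Hh) as [Hh1 Hz1]. destruct (Hw _ Hz1) as [Hb Eb].
    pose proof (phi_Ne_sub_lower a (w (z + h)%C) ltac:(lra) ltac:(lra)) as T.
    rewrite Ea, Eb, Cmod_sub_sym, (Cmod_sub_sym (p z)) in T. specialize (L1 h Hh1). fold c0 in T.
    apply Rmult_le_reg_r with c0; [exact Hc0|].
    replace ((Cmod l + 1) / c0 * Cmod h * c0) with ((Cmod l + 1) * Cmod h) by (field; lra).
    lra. }
  set (m := fun y => (1 - (a * a + a * w y + w y * w y) / 3)%C).
  assert (Hmz : m z <> RtoC 0).
  { apply Cmod_gt_0. unfold m. fold a.
    pose proof (Cmod_ge_sub 1 ((a * a + a * a + a * a) / 3)) as T.
    replace ((a * a + a * a + a * a) / 3)%C with (a * a)%C in T |- *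
      by (field).
    rewrite Cmod_1, Cmod_mult in T. nra. }
  assert (Hm : Ccont m z).
  { apply (Ccont_of_local_lipschitz _ _ ((Cmod l + 1) / c0) d HL Hd).
    intros h Hh. specialize (Lw h Hh). destruct (Hin h Hh) as [_ Hz1].
    destruct (Hw _ Hz1) as [Hb _]. unfold m. fold a.
    replace (1 - (a * a + a * w (z + h)%C + w (z + h)%C * w (z + h)%C) / 3
             - (1 - (a * a + a * a + a * a) / 3))%C
      with (- ((w (z + h)%C - a) * ((a + a + w (z + h)%C) / 3)))%C
      by (field).
    rewrite Cmod_opp, Cmod_mult, (Cmod_div (a + a + w (z + h)%C)), (Cmod_R 3), (Rabs_pos_eq 3)
      by (lra || (intro E; apply RtoC_inj in E; lra)).
    pose proof (Cmod_triangle (a + a) (w (z + h)%C)). pose proof (Cmod_triangle a a).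
    pose proof (Cmod_ge_0 (w (z + h)%C - a)%C).
    assert (Cmod (a + a + w (z + h)%C)%C / 3 <= 1) by lra.
    eapply Rle_trans; [|exact Lw]. nra. }
  exists (RtoC 0 + l * / m z)%C.
  apply (is_Cderive_ext_loc (fun y => (a + (p y - p z) * / m y)%C)) with d; [exact Hd| |].
  + intros h Hh. destruct (Hin h Hh) as [_ Hz1]. destruct (Hw _ Hz1) as [Hb Eb].
    rewrite <- Ea, <- Eb.
    assert (Hmn : m (z + h)%C <> RtoC 0).
    { apply Cmod_gt_0. unfold m.
      pose proof (Cmod_ge_sub 1 ((a * a + a * w (z + h)%C + w (z + h)%C * w (z + h)%C) / 3)) as T.
      rewrite Cmod_1, Cmod_div, (Cmod_R 3), (Rabs_pos_eq 3) in T
        by (lra || (intro E; apply RtoC_inj in E; lra)).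
      pose proof (Cmod_triangle (a * a + a * w (z + h)%C) (w (z + h)%C * w (z + h)%C)) as T1.
      pose proof (Cmod_triangle (a * a) (a * w (z + h)%C)) as T2.
      set (b := w (z + h)%C) in *.
      rewrite (Cmod_mult b b) in T1. rewrite (Cmod_mult a a), (Cmod_mult a b) in T2.
      pose proof (Cmod_ge_0 b). nra. }
    rewrite phi_Ne_sub.
    replace (1 - (w (z + h)%C * w (z + h)%C + w (z + h)%C * a + a * a) / 3)%C
      with (m (z + h)%C) by (unfold m; field).
    field. exact Hmn.
  + apply is_Cderive_plus; [apply is_Cderive_const|].
    apply (is_Cderive_increment_mult p (fun y => (/ m y)%C)); [exact Hl|].
    now apply Ccont_inv.
- destruct (Hw (RtoC 0)) as [Ha Ea]; [rewrite Cmod_0; lra|].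
  apply phi_Ne_inj; [exact Ha|rewrite Cmod_0; lra|].
  rewrite Ea, P0. unfold phi_Ne. simpl. field.
- intros z Hz. now apply Hw.
- intros z Hz. symmetry. now apply Hw.
Qed.

(** * Numerical bounds *)

(** Two terms of the series of ln((1+y)/(1-y)), with remainder. Both sides follow by comparing the
    derivative 2/(1-t^2) with 2 + 2t^2 and with 2 + 2t^2/(1-y^2). *)
Lemma ln_ratio_bounds (y : R) : 0 <= y < 1 ->
  2 * y + 2 / 3 * (y * y * y) <= ln ((1 + y) / (1 - y))
    <= 2 * y + 2 / 3 * (y * y * y) / (1 - y * y).
Proof.
intro Hy. rewrite ln_div by lra.
set (f := fun t => ln (1 + t) - ln (1 - t)).
assert (Df : forall t, 0 <= t <= y -> is_derive f t (2 / (1 - t * t))).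
{ intros t Ht. unfold f. auto_derive; [repeat split; lra|]. field. repeat split; nra. }
assert (F0 : f 0 = 0) by (unfold f; rewrite Rminus_0_r, Rplus_0_r; ring).
change (ln (1 + y) - ln (1 - y)) with (f y).
assert (Cf : forall t, 0 <= t <= y -> continuity_pt f t).
{ intros t Ht. eapply is_derive_continuity_pt; now apply Df. }
assert (Hyy : 0 < 1 - y * y) by nra.
split.
- set (g := fun t => 2 * t + 2 / 3 * (t * t * t)).
  assert (Dg : forall t, is_derive g t (2 + 2 * (t * t))).
  { intro t. unfold g. auto_derive; [auto|field]. }
  assert (g y - g 0 <= f y - f 0); [|unfold g in *; lra].
  apply (increment_le g f (fun t => 2 + 2 * (t * t)) (fun t => 2 / (1 - t * t))); auto; try lra.
  + intros; eapply is_derive_continuity_pt; apply Dg.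
  + intros t Ht; apply Df; lra.
  + intros t Ht. apply Rle_div_r; [nra|].
    assert (0 <= t * t * (t * t)) by (pose proof (Rle_0_sqr (t * t)); unfold Rsqr in *; lra). lra.
- set (g := fun t => 2 * t + 2 / 3 * (t * t * t) / (1 - y * y)).
  assert (Dg : forall t, is_derive g t (2 + 2 * (t * t) / (1 - y * y))).
  { intro t. unfold g. auto_derive; [lra|field; lra]. }
  assert (f y - f 0 <= g y - g 0); [|unfold g in *; lra].
  apply (increment_le f g (fun t => 2 / (1 - t * t)) (fun t => 2 + 2 * (t * t) / (1 - y * y)));
    auto; try lra.
  + intros; eapply is_derive_continuity_pt; apply Dg.
  + intros t Ht; apply Df; lra.
  + intros t Ht. apply Rle_div_l; [nra|].
    assert (0 <= t * t) by nra.
    assert (t * t <= y * y) by nra.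
    replace ((2 + 2 * (t * t) / (1 - y * y)) * (1 - t * t))
      with (2 * (1 - t * t) + 2 * (t * t) * ((1 - t * t) / (1 - y * y))) by (field; lra).
    assert (1 <= (1 - t * t) / (1 - y * y)) by (apply Rle_div_r; lra). nra.
Qed.

Lemma ln_2_bounds : 691 / 1000 <= ln 2 <= 7 / 10.
Proof.
pose proof (ln_ratio_bounds (1 / 3) ltac:(lra)) as H.
replace ((1 + 1 / 3) / (1 - 1 / 3)) with 2 in H by field. lra.
Qed.

Lemma ln_5_3_bounds : 1 / 2 <= ln (5 / 3) <= 512 / 1000.
Proof.
pose proof (ln_ratio_bounds (1 / 4) ltac:(lra)) as H.
replace ((1 + 1 / 4) / (1 - 1 / 4)) with (5 / 3) in H by field. lra.
Qed.

Lemma sqrt_2_bounds : 14142 / 10000 <= sqrt 2 <= 14143 / 10000.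
Proof.
split.
- rewrite <- (sqrt_square (14142 / 10000)) by lra. apply sqrt_le_1_alt; lra.
- rewrite <- (sqrt_square (14143 / 10000)) by lra. apply sqrt_le_1_alt; lra.
Qed.

Lemma log_const_bounds : 219 / 1000 <= log_const <= 3 / 10.
Proof.
unfold log_const. pose proof sqrt_2_bounds as Hs. pose proof ln_2_bounds.
pose proof (sqrt_sqrt 2 ltac:(lra)) as Q.
set (s := sqrt 2) in *.
(* Taking y = sqrt 2 - 1 reaches 1 + sqrt 2, and the cube of y is linear in sqrt 2. *)
assert (E : (1 + (s - 1)) / (1 - (s - 1)) = 1 + s).
{ replace (1 + (s - 1)) with s by ring. replace (1 - (s - 1)) with (2 - s) by ring.
  apply Rmult_eq_reg_r with (2 - s); [|lra]. unfold Rdiv.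
  rewrite Rmult_assoc, Rinv_l by lra. lra. }
pose proof (ln_ratio_bounds (s - 1) ltac:(lra)) as B. rewrite E in B. clear E.
assert (Q3 : (s - 1) * (s - 1) * (s - 1) = 5 * s - 7).
{ replace ((s - 1) * (s - 1) * (s - 1)) with (s * s * s - 3 * (s * s) + 3 * s - 1) by ring.
  rewrite Q. ring. }
rewrite Q3 in B.
assert (U : 2 / 3 * (5 * s - 7) / (1 - (s - 1) * (s - 1)) <= 577 / 10000).
{ apply Rle_div_l; lra. }
split; lra.
Qed.

(** * The three implications *)

Lemma analytic_ext_disk (f g : C -> C) : (forall z, Cmod z < 1 -> f z = g z) ->
  analytic f -> analytic g.
Proof.
intros He Hf z Hz. destruct (Hf z Hz) as [l Hl]. exists l. unfold unit_disk in Hz.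
apply (is_Cderive_ext_loc f) with (1 - Cmod z); [lra| |exact Hl].
intros h Hh. apply He. pose proof (Cmod_triangle z h). lra.
Qed.

(** Covers the three cases by n = 0, 1, 2. Analyticity of [E] is what makes z p' = (E - 1) p^n /
    beta differentiable, the input of Schwarz's lemma. *)
Lemma ray_bounded_of_subordinate (p dp w E : C -> C) (n : nat) (beta : R) : beta <> 0 ->
  (forall z, Cmod z < 1 -> is_Cderive p z (dp z)) ->
  (forall z, Cmod z < 1 -> (p z ^ n)%C <> RtoC 0) ->
  analytic E ->
  (forall z, Cmod z < 1 -> E z = (1 + beta * (z * dp z / p z ^ n))%C) ->
  (forall z, Cmod z < 1 -> Cmod (w z) < 1) ->
  (forall z, Cmod z < 1 -> E z = phi_L (w z)) ->
  ray_bounded (fun z => (beta * (z * dp z / p z ^ n))%C).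
Proof.
intros Hb Hp Hn HE EE Hw Ew.
assert (Hbn : RtoC beta <> RtoC 0) by (intro Q; apply RtoC_inj in Q; lra).
assert (Dpow : forall m z, Cmod z < 1 -> exists l, is_Cderive (fun z => (p z ^ m)%C) z l).
{ intros m z Hz. induction m as [|m [l IH]]; simpl.
  - eexists; apply is_Cderive_const.
  - eexists; apply is_Cderive_mult; [now apply Hp|exact IH]. }
assert (HT : analytic (fun z => (z * dp z)%C)).
{ apply (analytic_ext_disk (fun z => ((E z - 1) * p z ^ n * / beta)%C)).
  - intros z Hz. rewrite EE by exact Hz. field. split; [exact Hbn|now apply Hn].
  - intros z Hz. destruct (HE z Hz) as [l Hl]. destruct (Dpow n z Hz) as [l' Hl'].
    eexists.
    apply (is_Cderive_mult (fun z => ((E z - 1) * p z ^ n)%C) (fun _ => (/ beta)%C));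
      [|apply is_Cderive_const].
    apply (is_Cderive_mult (fun z => (E z - 1)%C) (fun z => (p z ^ n)%C)); [|exact Hl'].
    apply is_Cderive_minus; [exact Hl|apply is_Cderive_const]. }
assert (Hsch : forall z, Cmod z < 1 -> Cmod (w z) <= Cmod z).
{ intros z Hz.
  apply (schwarz_square_form p dp Hp HT (fun z => (beta * / p z ^ n)%C) w); auto.
  - apply twice_derivable_mult; [apply twice_derivable_const|].
    apply twice_derivable_inv.
    + apply twice_derivable_pow. now apply (twice_derivable_of_euler p dp).
    + intros x Hx. apply Hn; lra.
  - intros x Hx. destruct (Dpow n x Hx) as [l Hl].
    apply Ccont_mult.
    + eapply is_Cderive_Ccont. apply is_Cderive_const.
    + apply Ccont_inv; [eapply is_Cderive_Ccont; exact Hl|now apply Hn].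
  - intros x Hx.
    assert (Q : (E x * E x - 1)%C = w x).
    { rewrite Ew by exact Hx. pose proof (phi_L_sqr (w x)) as S. simpl in S.
      rewrite Cmult_1_r in S. rewrite S. ring. }
    rewrite <- Q, EE by exact Hx. unfold Cdiv. ring. }
intros z Hz.
assert (Ek : (beta * (z * dp z / p z ^ n))%C = (phi_L (w z) - 1)%C).
{ rewrite <- Ew, EE by exact Hz. ring. }
cbv beta. rewrite Ek. split.
- apply phi_L_sub1_bound; auto.
- apply Re_phi_L_sub1_bound; auto.
Qed.

(** Since |phi_L(w) - 1| <= 1, the modulus of beta z p' is at most |p|^(n+1) where p is nonzero. At
    a zero the totalised quotient would only give the value 1, so zeros are excluded through the
    values along the way from the origin. *)
Lemma nonvanishing_of_subordinate (p dp w : C -> C) (n : nat) (beta : R) : 0 < beta ->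
  (forall z, Cmod z < 1 -> is_Cderive p z (dp z)) -> p (RtoC 0) = RtoC 1 ->
  (forall z, Cmod z < 1 -> Cmod (w z) < 1) ->
  (forall z, Cmod z < 1 -> (1 + beta * (z * dp z / p z ^ S n))%C = phi_L (w z)) ->
  forall z, Cmod z < 1 -> p z <> RtoC 0.
Proof.
intros Hb Hp P0 Hw E.
apply (nonvanishing_of_euler p dp (/ beta) n).
- left; now apply Rinv_0_lt_compat.
- exact Hp.
- intros x Hx Hn. specialize (E x Hx). specialize (Hw x Hx).
  assert (Hbn : RtoC beta <> RtoC 0) by (intro Q; apply RtoC_inj in Q; lra).
  assert (Hpn : (p x ^ S n)%C <> RtoC 0) by now apply Cpow_nz.
  pose proof (phi_L_sub1_bound (w x) (Cmod (w x)) (Rle_refl _) Hw) as B.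
  rewrite <- E in B.
  replace (1 + beta * (x * dp x / p x ^ S n) - 1)%C
    with (beta * (x * dp x) / p x ^ S n)%C in B by (unfold Cdiv; ring).
  rewrite Cmod_div, Cmod_mult, Cmod_R, Rabs_pos_eq, Cmod_pow in B by (auto; lra).
  pose proof (proj1 (Cmod_gt_0 _) Hn) as Hpp.
  pose proof (pow_lt _ (S n) Hpp) as Hpw.
  assert (B1 : beta * Cmod (x * dp x)%C / Cmod (p x) ^ S n <= 1).
  { eapply Rle_trans; [exact B|]. pose proof (sqrt_pos (1 - Cmod (w x))).
    apply Rle_div_l; lra. }
  apply (Rle_div_l _ 1 _ Hpw) in B1.
  apply Rmult_le_reg_l with beta; [exact Hb|].
  replace (beta * (/ beta * Cmod (p x) ^ S n)) with (1 * Cmod (p x) ^ S n) by (field; lra).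
  exact B1.
- exact P0.
Qed.

Lemma analytic_C_derive (p : C -> C) : analytic p ->
  forall z, Cmod z < 1 -> is_Cderive p z (C_derive p z).
Proof. intros Hp z Hz. apply C_derive_correct; [exact z|now apply Hp]. Qed.

(** The bound on [beta] makes |p - 1| < 2/3, the distance from 1 to each cusp; that disk lies in the
    region. *)
Lemma implication_a : implication_from expr_a (3 * (1 - ln 2)).
Proof.
intros p beta Hp P0 Hb [HE [_ [w [_ [_ [Hw1 Ew]]]]]].
pose proof ln_2_bounds as L2. pose proof (analytic_C_derive p Hp) as Dp.
assert (Hb0 : 0 < beta) by lra.
apply subordinate_phi_Ne; auto. intros z Hz.
assert (Hk : ray_bounded (fun z => (beta * (z * C_derive p z / p z ^ 0))%C)).
{ apply (ray_bounded_of_subordinate p (C_derive p) w (expr_a beta p)); auto; try lra.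
  - intros x _. simpl. intro Q; apply RtoC_inj in Q; lra.
  - intros x _. unfold expr_a. simpl. field. }
destruct (ray_increment_bounds p (C_derive p) _ beta z Hb0 Hk Dp) as [B _]; auto.
{ intros x _. simpl. field. }
rewrite P0 in B.
assert (B2 : Cmod (p z - 1)%C < 2 / 3).
{ eapply Rlt_le_trans; [exact B|]. apply Rle_div_l; lra. }
clear B. set (q := (p z - 1)%C) in *.
replace (p z) with (1 + q)%C by (unfold q; ring).
pose proof (re_le_Cmod q) as R1. pose proof (im_le_Cmod q) as I1.
apply Rabs_le_between in R1. split; [|split].
- change (Re (1 + q)%C) with (1 + Re q). lra.
- pose proof (Cmod_triangle 1 q) as T. rewrite Cmod_1 in T. lra.
- change (Im (1 + q)%C) with (0 + Im q). rewrite Rplus_0_l. lra.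
Qed.

(** The bound on [beta] is used sharply only for |p| < 5/3; the rest of the region follows from a
    rough bound on the gauge. *)
Lemma implication_b : implication_from expr_b
  (2 * (sqrt 2 + ln 2 - 1 - ln (1 + sqrt 2)) / ln (5 / 3)).
Proof.
change (sqrt 2 + ln 2 - 1 - ln (1 + sqrt 2)) with log_const.
intros p beta Hp P0 Hb [HE [_ [w [_ [_ [Hw1 Ew]]]]]].
pose proof ln_2_bounds as L2. pose proof ln_5_3_bounds as L5. pose proof log_const_bounds as LC.
pose proof (analytic_C_derive p Hp) as Dp.
assert (Hl5 : 0 < ln (5 / 3)) by lra.
apply (Rle_div_l _ beta _ Hl5) in Hb.
assert (Hb0 : 0 < beta) by nra.
assert (EE : forall z, expr_b beta p z = (1 + beta * (z * C_derive p z / p z ^ 1))%C).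
{ intro x. unfold expr_b. now rewrite Cpow_1_r. }
assert (Hn : forall z, Cmod z < 1 -> p z <> RtoC 0).
{ apply (nonvanishing_of_subordinate p (C_derive p) w 0 beta); auto.
  intros x Hx. rewrite <- EE. now apply Ew. }
apply subordinate_phi_Ne; auto. intros z Hz.
assert (Hk : ray_bounded (fun z => (beta * (z * C_derive p z / p z ^ 1))%C)).
{ apply (ray_bounded_of_subordinate p (C_derive p) w (expr_b beta p)); auto; try lra.
  intros x Hx. rewrite Cpow_1_r. auto. }
destruct (ray_log_bounds p (C_derive p) _ beta z Hb0 Hk Dp Hn) as [B1 B2]; auto.
{ intros x Hx. rewrite Cpow_1_r. field. auto. }
pose proof (proj1 (Cmod_gt_0 _) (Hn z Hz)) as Hpz.
assert (Hn53 : Cmod (p z) < 5 / 3).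
{ apply ln_lt_inv; try lra. eapply Rlt_le_trans; [exact B1|]. apply Rle_div_l; lra. }
(* The exponent is below 73/100, since [beta] is at least 438/512, and 73/100 is below ln(21/10). *)
assert (He : exp (2 * (1 - ln 2) / beta) <= 21 / 10).
{ rewrite <- (exp_ln (21 / 10)) by lra. 
  pose proof (ln_ratio_bounds (11 / 31) ltac:(lra)) as Q.
  replace ((1 + 11 / 31) / (1 - 11 / 31)) with (21 / 10) in Q by field.
  apply Rlt_le, exp_increasing. apply Rlt_div_l; [exact Hb0|].
  assert (73 / 100 * beta <= ln (21 / 10) * beta) by (apply Rmult_le_compat_r; lra).
  assert (beta * ln (5 / 3) <= beta * (512 / 1000)) by (apply Rmult_le_compat_l; lra).
  lra. }
set (X := log_gauge (Re (p z)) (Im (p z))) in *.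
(* Otherwise the left side of [B2] would be at least 1.3 + 0.83 = 2.13, above 1.01 * 2.1 = 2.121. *)
assert (HX : X < 13 / 10).
{ apply Rnot_le_lt; intro K.
  assert (83 / 100 <= sqrt (X * X - 9999 / 10000)).
  { rewrite <- (sqrt_square (83 / 100)) by lra. apply sqrt_le_1_alt. nra. }
  lra. }
unfold X, log_gauge in HX. rewrite <- Cmod_sqr, sqrt_square in HX by lra.
pose proof (Cmod_sqr (p z)) as S.
set (m := Cmod (p z)) in *. set (x := Re (p z)) in *. set (y := Im (p z)) in *.
(* Hence 2x > (m - 3/10)^2 + 91/100, so x > 1/3, and y^2 = m^2 - x^2 < 6m/10 - (x-1)^2 < 1 because m
   < 5/3. *)
assert (HX2 : (m * m + 1 - 2 * x) / (2 * m) < 3 / 10) by lra.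
apply (Rlt_div_l _ (3 / 10) (2 * m) ltac:(lra)) in HX2.
pose proof (Rle_0_sqr (m - 3 / 10)) as Q. unfold Rsqr in Q.
split; [lra|]. split; [exact Hn53|].
pose proof (Rle_0_sqr (x - 1)) as Q1. unfold Rsqr in Q1.
assert (y * y < 1) by lra. apply Rabs_lt_between. split; nra.
Qed.

(** For q = 1/p the ray estimates give |1 - q| < 1 and Re q > 3/5. Inversion turns the first into Re
    p > 1/2 and the second implies |p| < 5/3; the latter is the tight one. *)
Lemma implication_c : implication_from expr_c
  (5 * (sqrt 2 + ln 2 - 1 - ln (1 + sqrt 2))).
Proof.
change (sqrt 2 + ln 2 - 1 - ln (1 + sqrt 2)) with log_const.
intros p beta Hp P0 Hb [HE [_ [w [_ [_ [Hw1 Ew]]]]]].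
pose proof ln_2_bounds as L2. pose proof log_const_bounds as LC.
pose proof (analytic_C_derive p Hp) as Dp.
assert (Hb0 : 0 < beta) by lra.
assert (Hn : forall z, Cmod z < 1 -> p z <> RtoC 0).
{ apply (nonvanishing_of_subordinate p (C_derive p) w 1 beta); auto. }
apply subordinate_phi_Ne; auto. intros z Hz.
assert (Hk : ray_bounded (fun z => (beta * (z * C_derive p z / p z ^ 2))%C)).
{ apply (ray_bounded_of_subordinate p (C_derive p) w (expr_c beta p)); auto; try lra.
  intros x Hx. apply Cpow_nz; auto. }
destruct (ray_increment_bounds (fun x => (1 - / p x)%C)
  (fun x => (0 - - C_derive p x / (p x * p x))%C) _ beta z Hb0 Hk) as [B1 B2]; auto.
{ intros x Hx. apply is_Cderive_minus; [apply is_Cderive_const|].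
  apply is_Cderive_inv; auto. }
{ intros x Hx. simpl. field. auto. }
rewrite P0 in B1, B2.
pose proof (Hn z Hz) as Hpz. pose proof (proj1 (Cmod_gt_0 _) Hpz) as Hpm.
set (q := (/ p z)%C) in *.
assert (Eq : p z = (/ q)%C) by (unfold q; field; exact Hpz).
assert (Hqp : 0 < Cmod q).
{ unfold q. rewrite Cmod_inv by exact Hpz. now apply Rinv_0_lt_compat. }
assert (Hqn : q <> RtoC 0) by now apply Cmod_gt_0.
replace (1 - q - (1 - / 1))%C with (1 - q)%C in B1 by field.
assert (C1 : Cmod (1 - q)%C < 1).
{ eapply Rlt_le_trans; [exact B1|]. apply Rle_div_l; lra. }
replace (1 - / 1)%C with (RtoC 0) in B2 by field.
change (Re (RtoC 0)) with 0 in B2. change (Re (1 - q)%C) with (1 - Re q) in B2.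
assert (C2 : 3 / 5 < Re q).
{ assert (2 * log_const / beta <= 2 / 5) by (apply Rle_div_l; lra). lra. }
assert (C3 : Re q * Re q + Im q * Im q < 2 * Re q).
{ pose proof (Cmod_sqr (1 - q)%C) as Q. change (Re (1 - q)%C) with (1 - Re q) in Q.
  replace (Im (1 - q)%C) with (- Im q) in Q by (unfold Im; simpl; ring).
  pose proof (Cmod_ge_0 (1 - q)%C) as Q0. set (c := Cmod (1 - q)%C) in *.
  assert (c * c < 1) by nra. lra. }
rewrite Eq. clearbody q.
set (N := Re q * Re q + Im q * Im q) in *.
assert (HN : 0 < N).
{ assert (0 < Re q * Re q) by (apply Rmult_lt_0_compat; lra).
  pose proof (Rle_0_sqr (Im q)) as Q. unfold N, Rsqr in *. lra. }
assert (ER : Re (/ q)%C = Re q / N) by (unfold N, Re, Im; simpl; f_equal; ring).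
assert (EI : Im (/ q)%C = - Im q / N) by (unfold N, Re, Im; simpl; f_equal; ring).
rewrite ER, EI, Cmod_inv by exact Hqn.
split; [|split].
- apply (proj1 (Rlt_div_r (1 / 3) (Re q) N HN)). lra.
- pose proof (Re_le_Cmod' q). replace (5 / 3) with (/ (3 / 5)) by field.
  apply Rinv_lt_contravar; [|lra]. apply Rmult_lt_0_compat; lra.
- unfold Rdiv. rewrite Rabs_mult, Rabs_Ropp, (Rabs_pos_eq (/ N)) by (left; now apply Rinv_0_lt_compat).
  (* Completing the square, |Im q| <= (Im q)^2 + 1/4, and (Re q)^2 > 9/25 > 1/4. *)
  change (Rabs (Im q) / N < 1). apply Rlt_div_l; [exact HN|]. unfold N.
  pose proof (Rle_0_sqr (Im q - 1 / 2)) as Q1. pose proof (Rle_0_sqr (Im q + 1 / 2)) as Q2.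
  assert (9 / 25 < Re q * Re q) by nra.
  unfold Rsqr in *. apply Rabs_lt_between. split; lra.
Qed.

(** * Complex logarithm and exponential *)

(** Directional derivatives of the form f1 h, with f1 continuous at z, give a complex derivative by
    the mean value inequality. Exponential and logarithm are thus reduced to real calculus on
    segments. *)
Lemma is_Cderive_of_segments (f f1 : C -> C) (z : C) (rho : R) : 0 < rho ->
  (forall h t, Cmod h < rho -> 0 <= t <= 1 ->
     curve_derive (fun s => f (z + s * h)%C) t (f1 (z + t * h)%C * h)%C) ->
  Ccont f1 z -> is_Cderive f z (f1 z).
Proof.
intros Hr Hseg Hc. apply is_Cderive_iff. intros e He.
destruct (Hc e He) as [d [Hd Hb]].
exists (Rmin d rho). split; [now apply Rmin_glb_lt|].
intros h Hh. pose proof (Rmin_l d rho). pose proof (Rmin_r d rho).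
replace (f (z + h)%C - f z - f1 z * h)%C
  with (f (z + 1 * h)%C - f1 z * h * 1 - (f (z + 0 * h)%C - f1 z * h * 0))%C.
2:{ replace (z + 0 * h)%C with z by ring. replace (z + 1 * h)%C with (z + h)%C by ring. ring. }
replace (e * Cmod h) with (e * Cmod h * 1 - e * Cmod h * 0) by ring.
apply (curve_mean_value_le (fun s => (f (z + s * h)%C - f1 z * h * s)%C)
  (fun t => (f1 (z + t * h)%C * h - f1 z * h)%C)
  (fun t => e * Cmod h * t) (fun _ => e * Cmod h)).
- lra.
- intros t Ht. apply curve_derive_minus; [apply Hseg; [lra|exact Ht]|].
  apply curve_derive_pair; unfold Re, Im; simpl; auto_derive; auto; ring.
- intros t Ht. auto_derive; auto; ring.
- intros t Ht. replace (f1 (z + t * h)%C * h - f1 z * h)%C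
    with ((f1 (z + t * h)%C - f1 z) * h)%C by ring.
  rewrite Cmod_mult. apply Rmult_le_compat_r; [apply Cmod_ge_0|].
  apply Hb. rewrite Cmod_mult, Cmod_R, Rabs_pos_eq by lra.
  pose proof (Cmod_ge_0 h). nra.
Qed.

Definition Cexp (z : C) : C := (exp (Re z) * cos (Im z), exp (Re z) * sin (Im z)).

Lemma Cmod_Cexp (z : C) : Cmod (Cexp z) = exp (Re z).
Proof.
replace (Cexp z) with (exp (Re z) * cis (Im z))%C.
- rewrite Cmod_mult, Cmod_cis, Cmod_R, Rabs_pos_eq; [ring|left; apply exp_pos].
- unfold Cexp, cis, Cmult, RtoC; simpl. f_equal; ring.
Qed.

Lemma curve_derive_Cexp (z h : C) (t : R) :
  curve_derive (fun s => Cexp (z + s * h)%C) t (Cexp (z + t * h)%C * h)%C.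
Proof.
destruct z as [x y], h as [a b].
assert (E : forall s : R, ((x, y) + s * (a, b))%C = ((x + s * a)%R, (y + s * b)%R)).
{ intro s. unfold Cplus, Cmult, RtoC; simpl. f_equal; ring. }
rewrite E.
apply curve_derive_pair.
- apply (is_derive_ext (fun s => exp (x + s * a) * cos (y + s * b))).
  + intro s. now rewrite E.
  + unfold Cexp, Re, Im; simpl. auto_derive; auto; ring.
- apply (is_derive_ext (fun s => exp (x + s * a) * sin (y + s * b))).
  + intro s. now rewrite E.
  + unfold Cexp, Re, Im; simpl. auto_derive; auto; ring.
Qed.

Lemma is_Cderive_Cexp (z : C) : is_Cderive Cexp z (Cexp z).
Proof.
apply is_Cderive_of_segments with 1; [lra| |].
- intros; apply curve_derive_Cexp.
- apply (Ccont_of_local_lipschitz Cexp z (exp (Re z + 1)) 1); [apply exp_pos|lra|].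
  intros h Hh.
  replace (Cexp (z + h)%C - Cexp z)%C with (Cexp (z + 1 * h)%C - Cexp (z + 0 * h)%C)%C
    by (do 2 f_equal; ring || (f_equal; ring)).
  replace (exp (Re z + 1) * Cmod h)
    with (exp (Re z + 1) * Cmod h * 1 - exp (Re z + 1) * Cmod h * 0) by ring.
  apply (curve_mean_value_le (fun s => Cexp (z + s * h)%C) (fun t => (Cexp (z + t * h)%C * h)%C)
    (fun t => exp (Re z + 1) * Cmod h * t) (fun _ => exp (Re z + 1) * Cmod h)).
  + lra.
  + intros; apply curve_derive_Cexp.
  + intros t Ht. auto_derive; auto; ring.
  + intros t Ht. rewrite Cmod_mult, Cmod_Cexp. apply Rmult_le_compat_r; [apply Cmod_ge_0|].
    left. apply exp_increasing.
    replace (Re (z + t * h)%C) with (Re z + t * Re h) by (unfold Re; simpl; ring).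
    pose proof (Re_le_Cmod' h). nra.
Qed.

Lemma Cexp_RtoC (x : R) : Cexp (RtoC x) = RtoC (exp x).
Proof. unfold Cexp, RtoC; simpl. rewrite cos_0, sin_0. f_equal; ring. Qed.

(* Principal branch, meaningful on the right half plane only. *)
Definition Clog (z : C) : C := (/ 2 * ln (Re z * Re z + Im z * Im z), atan (Im z / Re z)).

Lemma is_Cderive_Clog (z : C) : 0 < Re z -> is_Cderive Clog z (/ z)%C.
Proof.
intro Hz.
assert (Hn : z <> RtoC 0) by (intro E; rewrite E in Hz; simpl in Hz; lra).
apply (is_Cderive_of_segments Clog (fun z => (/ z)%C)) with (Re z); [exact Hz| |].
- intros h t Hh Ht.
  assert (Hp : 0 < Re z + t * Re h).
  { pose proof (re_le_Cmod h) as T. apply Rabs_le_between in T. nra. }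
  clear Hn Hh. destruct z as [x y], h as [a b]. unfold Re in Hz, Hp; simpl in Hz, Hp.
  assert (HN : 0 < (x + t * a) * (x + t * a) + (y + t * b) * (y + t * b)).
  { pose proof (Rmult_lt_0_compat _ _ Hp Hp). pose proof (Rle_0_sqr (y + t * b)) as Q.
    unfold Rsqr in Q. lra. }
  assert (E : forall s : R, ((x, y) + s * (a, b))%C = ((x + s * a)%R, (y + s * b)%R)).
  { intro s. unfold Cplus, Cmult, RtoC; simpl. f_equal; ring. }
  rewrite E.
  apply curve_derive_pair.
  + apply (is_derive_ext (fun s => / 2 * ln ((x + s * a) * (x + s * a) + (y + s * b) * (y + s * b)))).
    { intro s. now rewrite E. }
    unfold Re, Im; simpl. auto_derive; [auto|field; nra].
  + apply (is_derive_ext (fun s => atan ((y + s * b) / (x + s * a)))).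
    { intro s. now rewrite E. }
    unfold Re, Im; simpl. auto_derive; [lra|field; repeat split; nra].
- apply (Ccont_inv (fun z => z)); [|exact Hn].
  eapply is_Cderive_Ccont; apply is_Cderive_id.
Qed.

Lemma Clog_RtoC (x : R) : 0 < x -> Clog (RtoC x) = RtoC (ln x).
Proof.
intro Hx. unfold Clog, RtoC; simpl. f_equal.
- replace (x * x + 0 * 0) with (x * x) by ring. rewrite ln_mult by lra. field.
- unfold Rdiv. rewrite Rmult_0_l. apply atan_0.
Qed.

(** * The extremal functions *)

Lemma Re_phi_L_pos (z : C) : Cmod z < 1 -> 0 < Re (phi_L z).
Proof.
intro Hz. apply Re_Csqrt_gt0. pose proof (re_le_Cmod z) as T. apply Rabs_le_between in T.
change (Re (1 + z)%C) with (1 + Re z). lra.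
Qed.

Lemma is_Cderive_phi_L (z : C) : Cmod z < 1 -> is_Cderive phi_L z (/ (2 * phi_L z))%C.
Proof.
intro Hz. eapply is_Cderive_eq.
- apply (is_Cderive_comp Csqrt (fun z => (1 + z)%C)).
  + apply is_derive_Csqrt. pose proof (re_le_Cmod z) as T. apply Rabs_le_between in T.
    change (Re (1 + z)%C) with (1 + Re z). lra.
  + apply is_Cderive_plus; [apply is_Cderive_const|apply is_Cderive_id].
- change (Csqrt (1 + z)) with (phi_L z). ring.
Qed.

(** The solution of z Q' = phi_L(z) - 1 with Q(0) = 0. In the variable v = phi_L(z), where z = v^2 -
    1, the integrand becomes 2v/(1+v). The extremal functions are 1 + Q/beta, exp(Q/beta) and 1/(1 -
    Q/beta). *)
Definition best_dominant (z : C) : C :=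
  (2 * (phi_L z - 1 - Clog ((1 + phi_L z) * / 2)))%C.

Lemma is_Cderive_best_dominant (z : C) : Cmod z < 1 ->
  is_Cderive best_dominant z (/ (1 + phi_L z))%C.
Proof.
intro Hz. pose proof (Re_phi_L_pos z Hz) as Hp.
assert (H1 : phi_L z <> RtoC 0) by (intro E; rewrite E in Hp; simpl in Hp; lra).
assert (H2 : (1 + phi_L z)%C <> RtoC 0).
{ intro E. apply (f_equal Re) in E. change (1 + Re (phi_L z) = 0) in E. lra. }
pose proof (is_Cderive_phi_L z Hz) as D.
unfold best_dominant. eapply is_Cderive_eq.
- apply is_Cderive_mult; [apply is_Cderive_const|].
  apply (is_Cderive_minus (fun z => (phi_L z - 1)%C)).
  + apply is_Cderive_minus; [exact D|apply is_Cderive_const].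
  + apply (is_Cderive_comp Clog (fun z => ((1 + phi_L z) * / 2)%C)).
    * apply is_Cderive_Clog.
      replace (Re ((1 + phi_L z) * / 2)%C) with ((1 + Re (phi_L z)) / 2); [lra|].
      unfold Re; simpl. field.
    * apply (is_Cderive_mult (fun z => (1 + phi_L z)%C) (fun _ => (/ 2)%C));
        [|apply is_Cderive_const].
      apply is_Cderive_plus; [apply is_Cderive_const|exact D].
- cbv beta. field. auto.
Qed.

Lemma best_dominant_euler (z : C) : Cmod z < 1 ->
  (z * / (1 + phi_L z))%C = (phi_L z - 1)%C.
Proof.
intro Hz. pose proof (Re_phi_L_pos z Hz) as Hp. pose proof (phi_L_sqr z) as S.
assert (H2 : (1 + phi_L z)%C <> RtoC 0).
{ intro E. apply (f_equal Re) in E. change (1 + Re (phi_L z) = 0) in E. lra. }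
replace z with (phi_L z ^ 2 - 1)%C at 1 by (rewrite S; ring).
simpl. field. exact H2.
Qed.

(** Values on the real diameter, parametrised by y = sqrt(1+x), so that -1 < x < 1 becomes 0 < y <
    sqrt 2. *)
Definition best_dominant_real (y : R) : R := 2 * (y - 1 - ln ((1 + y) / 2)).

Lemma phi_L_real (y : R) : 0 < y -> phi_L (RtoC (y * y - 1)) = RtoC y.
Proof.
intro Hy. unfold phi_L.
replace (1 + RtoC (y * y - 1))%C with (RtoC (y * y)) by (rewrite RtoC_minus; ring).
unfold Csqrt. rewrite Cmod_R, Rabs_pos_eq by nra. simpl.
destruct (Rlt_dec 0 0); [lra|].
replace ((y * y + y * y) / 2) with (y * y) by field.
replace ((y * y - y * y) / 2) with 0 by field.
rewrite sqrt_0, sqrt_square by lra. reflexivity.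
Qed.

Lemma best_dominant_RtoC (y : R) : 0 < y ->
  best_dominant (RtoC (y * y - 1)) = RtoC (best_dominant_real y).
Proof.
intro Hy. unfold best_dominant, best_dominant_real. rewrite phi_L_real by exact Hy.
replace ((1 + y) * / 2)%C with (RtoC ((1 + y) / 2)).
- rewrite Clog_RtoC by lra. rewrite RtoC_mult, !RtoC_minus. reflexivity.
- rewrite RtoC_div, RtoC_plus by lra. reflexivity.
Qed.

Lemma best_dominant_0 : best_dominant (RtoC 0) = RtoC 0.
Proof.
replace (RtoC 0) with (RtoC (1 * 1 - 1)) at 1 by (f_equal; ring).
rewrite best_dominant_RtoC by lra. unfold best_dominant_real.
replace ((1 + 1) / 2) with 1 by field. rewrite ln_1. f_equal; ring.
Qed.

(** The threshold is the limit as y tends to 0. As ln(1+y) > 0, the value exceeds this limit by less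
    than 2y, and the witness keeps 2y within half of the gap. *)
Lemma best_dominant_near_left (tau : R) : - 2 * (1 - ln 2) < tau ->
  exists y, 0 < y < 1 /\ best_dominant_real y < tau.
Proof.
intro H. exists (Rmin (1 / 2) ((tau + 2 * (1 - ln 2)) / 4)).
pose proof (Rmin_l (1 / 2) ((tau + 2 * (1 - ln 2)) / 4)).
pose proof (Rmin_r (1 / 2) ((tau + 2 * (1 - ln 2)) / 4)).
assert (0 < Rmin (1 / 2) ((tau + 2 * (1 - ln 2)) / 4)) by (apply Rmin_glb_lt; lra).
set (y := Rmin (1 / 2) ((tau + 2 * (1 - ln 2)) / 4)) in *.
split; [lra|]. unfold best_dominant_real. rewrite ln_div by lra.
assert (0 < ln (1 + y)) by (rewrite <- ln_1; apply ln_increasing; lra).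
lra.
Qed.

Lemma best_dominant_near_right (tau : R) : tau < 2 * log_const ->
  exists y, 0 < y < sqrt 2 /\ tau < best_dominant_real y.
Proof.
intro H. pose proof sqrt_2_bounds as S.
exists (sqrt 2 - Rmin (1 / 2) ((2 * log_const - tau) / 4)).
pose proof (Rmin_l (1 / 2) ((2 * log_const - tau) / 4)).
pose proof (Rmin_r (1 / 2) ((2 * log_const - tau) / 4)).
assert (0 < Rmin (1 / 2) ((2 * log_const - tau) / 4)) by (apply Rmin_glb_lt; lra).
set (d := Rmin (1 / 2) ((2 * log_const - tau) / 4)) in *.
split; [lra|]. unfold best_dominant_real. rewrite ln_div by lra.
assert (ln (1 + (sqrt 2 - d)) < ln (1 + sqrt 2)) by (apply ln_increasing; lra).
unfold log_const in *. lra.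
Qed.

Lemma ray_bounded_phi_L : ray_bounded (fun z => (phi_L z - 1)%C).
Proof.
intros z Hz. split.
- apply phi_L_sub1_bound; [lra|exact Hz].
- apply Re_phi_L_sub1_bound; lra.
Qed.

(** Keeps the denominator 1 - Q/beta of the extremal function of case c away from zero: Q(z) = beta
    would force beta < 2L. *)
Lemma Re_best_dominant_lt (z : C) : Cmod z < 1 -> Re (best_dominant z) < 2 * log_const.
Proof.
intro Hz.
destruct (ray_increment_bounds best_dominant (fun z => (/ (1 + phi_L z))%C) _ 1 z Rlt_0_1
  ray_bounded_phi_L) as [_ B]; auto.
- intros x Hx. now apply is_Cderive_best_dominant.
- intros x Hx. rewrite best_dominant_euler by exact Hx. ring.
- rewrite best_dominant_0 in B. change (Re (RtoC 0)) with 0 in B. lra.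
Qed.

(** * Sharpness *)

(** The imaginary part is y (1 - x^2 + y^2/3) with a positive second factor, so w is real. The
    distances to the cusps are then (x+1)^2 (2-x)/3 and (1-x)^2 (2+x)/3. *)
Lemma phi_Ne_real_range (w : C) : Cmod w < 1 -> Im (phi_Ne w) = 0 ->
  1 / 3 < Re (phi_Ne w) < 5 / 3.
Proof.
intros Hw. pose proof (Cmod_sqr w) as S. pose proof (Cmod_ge_0 w).
assert (Hs : Re w * Re w + Im w * Im w < 1) by nra. clear S H Hw.
destruct w as [x y]. unfold Re, Im in Hs; simpl in Hs.
assert (E : phi_Ne (x, y) = (1 + x - (x * x * x - 3 * (x * (y * y))) / 3,
                            y * (1 - x * x + y * y / 3))).
{ unfold phi_Ne, Cdiv, Cinv, Cminus, Copp, Cplus, Cmult; simpl. f_equal; field. }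
rewrite E. unfold Re, Im; simpl. intro HI.
assert (Hy : y = 0).
{ apply Rmult_integral in HI. destruct HI as [HI|HI]; [exact HI|].
  pose proof (Rle_0_sqr y) as Q. unfold Rsqr in Q. lra. }
rewrite Hy in *. assert (-1 < x < 1) by nra.
split.
- assert (0 < (x + 1) * (x + 1) * (2 - x)) by (repeat apply Rmult_lt_0_compat; lra). lra.
- assert (0 < (1 - x) * (1 - x) * (2 + x)) by (repeat apply Rmult_lt_0_compat; lra). lra.
Qed.

Lemma not_subordinate_phi_Ne (p : C -> C) (x v : R) : -1 < x < 1 ->
  p (RtoC x) = RtoC v -> v <= 1 / 3 \/ 5 / 3 <= v -> ~ subordinate p phi_Ne.
Proof.
intros Hx Ev Hv [_ [_ [w [_ [_ [Hw Ew]]]]]].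
assert (Hd : Cmod (RtoC x) < 1) by (rewrite Cmod_R; apply Rabs_lt_between; lra).
specialize (Ew _ Hd). specialize (Hw _ Hd). rewrite Ev in Ew.
pose proof (phi_Ne_real_range _ Hw) as R0. rewrite <- Ew in R0.
specialize (R0 eq_refl). simpl in R0. lra.
Qed.

(** For an extremal [p] the expression is [phi_L] itself, subordinate to [phi_L] through the
    identity map, while [p] takes a real value that [phi_Ne] omits. *)
Lemma not_implication_from (expr : R -> (C -> C) -> C -> C) (b beta : R) (p : C -> C) (y v : R) :
  b <= beta -> analytic p -> p (RtoC 0) = RtoC 1 ->
  (forall z, Cmod z < 1 -> phi_L z = expr beta p z) ->
  0 < y < sqrt 2 -> p (RtoC (y * y - 1)) = RtoC v -> v <= 1 / 3 \/ 5 / 3 <= v ->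
  ~ implication_from expr b.
Proof.
intros Hb Hp P0 E Hy Ev Hv Himp.
apply (not_subordinate_phi_Ne p (y * y - 1) v); auto.
- pose proof (sqrt_sqrt 2 ltac:(lra)). split; nra.
- apply (Himp p beta); auto. split; [|split; [exact phi_L_analytic|]].
  + now apply (analytic_ext_disk phi_L); [|exact phi_L_analytic].
  + exists (fun z => z). repeat split; auto.
    * intros z _. eexists. apply is_Cderive_id.
    * intros z Hz. symmetry. now apply E.
Qed.

Lemma sharp_a : sharp (implication_from expr_a) (3 * (1 - ln 2)).
Proof.
intros b Hb. pose proof ln_2_bounds as L2. pose proof sqrt_2_bounds as S2.
(* Since [b] may be zero or negative, the maximum with half the bound gives a positive [beta] still
   below the bound. *)
set (beta := Rmax b (3 * (1 - ln 2) / 2)).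
assert (H1 : b <= beta) by apply Rmax_l.
assert (H2 : 3 * (1 - ln 2) / 2 <= beta) by apply Rmax_r.
assert (H3 : beta < 3 * (1 - ln 2)) by (apply Rmax_lub_lt; lra).
assert (Hbn : RtoC beta <> RtoC 0) by (intro Q; apply RtoC_inj in Q; lra).
set (p := fun z => (1 + best_dominant z * / beta)%C).
assert (Dp : forall z, Cmod z < 1 -> is_Cderive p z (/ (1 + phi_L z) * / beta)%C).
{ intros z Hz. eapply is_Cderive_eq.
  - apply is_Cderive_plus; [apply is_Cderive_const|].
    apply is_Cderive_mult; [now apply is_Cderive_best_dominant|apply is_Cderive_const].
  - cbv beta. ring. }
destruct (best_dominant_near_left (- 2 / 3 * beta)) as [y [Hy Hlt]]; [lra|].
apply (not_implication_from expr_a b beta p y (1 + best_dominant_real y / beta)).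
- exact H1.
- intros z Hz. eexists. now apply Dp.
- unfold p. rewrite best_dominant_0. ring.
- intros z Hz. unfold expr_a. rewrite (is_C_derive_unique _ _ _ (Dp z Hz)).
  replace (1 + beta * (z * (/ (1 + phi_L z) * / beta)))%C
    with (1 + beta * / beta * (z * / (1 + phi_L z)))%C by ring.
  rewrite best_dominant_euler, Cinv_r by auto. ring.
- lra.
- unfold p. rewrite best_dominant_RtoC by lra.
  rewrite RtoC_plus, RtoC_div by lra. reflexivity.
- left. assert (best_dominant_real y / beta < - 2 / 3); [|lra].
  apply (proj2 (Rlt_div_l (best_dominant_real y) (- 2 / 3) beta ltac:(lra))). exact Hlt.
Qed.

(** For exp(Q/beta) the logarithmic derivative is Q'/beta. Near x = 1 the value of Q approaches 2L >
    beta ln(5/3), so the function passes 5/3. *)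
Lemma sharp_b : sharp (implication_from expr_b)
  (2 * (sqrt 2 + ln 2 - 1 - ln (1 + sqrt 2)) / ln (5 / 3)).
Proof.
change (sqrt 2 + ln 2 - 1 - ln (1 + sqrt 2)) with log_const.
intros b Hb. pose proof log_const_bounds as LC. pose proof ln_5_3_bounds as L5.
assert (Hl5 : 0 < ln (5 / 3)) by lra.
set (b0 := 2 * log_const / ln (5 / 3)) in *.
assert (Hb0 : 0 < b0) by (apply Rdiv_lt_0_compat; lra).
set (beta := Rmax b (b0 / 2)).
assert (H1 : b <= beta) by apply Rmax_l.
assert (H2 : b0 / 2 <= beta) by apply Rmax_r.
assert (H3 : beta < b0) by (apply Rmax_lub_lt; lra).
assert (Hbn : RtoC beta <> RtoC 0) by (intro Q; apply RtoC_inj in Q; lra).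
set (p := fun z => Cexp (best_dominant z * / beta)%C).
assert (Hpn : forall z, p z <> RtoC 0).
{ intro z. apply Cmod_gt_0. unfold p. rewrite Cmod_Cexp. apply exp_pos. }
assert (Dp : forall z, Cmod z < 1 -> is_Cderive p z (/ (1 + phi_L z) * / beta * p z)%C).
{ intros z Hz. eapply is_Cderive_eq.
  - apply (is_Cderive_comp Cexp (fun z => (best_dominant z * / beta)%C)).
    + apply is_Cderive_Cexp.
    + apply is_Cderive_mult; [now apply is_Cderive_best_dominant|apply is_Cderive_const].
  - cbv beta. unfold p. ring. }
destruct (best_dominant_near_right (beta * ln (5 / 3))) as [y [Hy Hlt]].
{ apply (Rlt_div_r beta (2 * log_const)) in H3; lra. }
apply (not_implication_from expr_b b beta p y (exp (best_dominant_real y / beta))).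
- exact H1.
- intros z Hz. eexists. now apply Dp.
- unfold p. rewrite best_dominant_0, Cmult_0_l, Cexp_RtoC, exp_0. reflexivity.
- intros z Hz. unfold expr_b. rewrite (is_C_derive_unique _ _ _ (Dp z Hz)).
  replace (1 + beta * (z * (/ (1 + phi_L z) * / beta * p z) / p z))%C
    with (1 + beta * / beta * (z * / (1 + phi_L z)) * (p z * / p z))%C
    by (unfold Cdiv; ring).
  rewrite best_dominant_euler, !Cinv_r by auto. ring.
- lra.
- unfold p. rewrite best_dominant_RtoC by lra. rewrite <- Cexp_RtoC.
  rewrite RtoC_div by lra. reflexivity.
- right. rewrite <- (exp_ln (5 / 3)) by lra. left. apply exp_increasing.
  apply (proj1 (Rlt_div_r (ln (5 / 3)) (best_dominant_real y) beta ltac:(lra))). lra.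
Qed.

(** For p = 1/(1 - Q/beta) one has p'/p^2 = Q'/beta. Near x = 1 the quotient Q/beta exceeds 2/5,
    which pushes p beyond 5/3. *)
Lemma sharp_c : sharp (implication_from expr_c)
  (5 * (sqrt 2 + ln 2 - 1 - ln (1 + sqrt 2))).
Proof.
change (sqrt 2 + ln 2 - 1 - ln (1 + sqrt 2)) with log_const.
intros b Hb. pose proof log_const_bounds as LC.
(* Half the bound already exceeds 2L, the supremum of Re Q, so 1 - Q/beta has no zero in the
   disk. *)
set (beta := Rmax b (5 * log_const / 2)).
assert (H1 : b <= beta) by apply Rmax_l.
assert (H2 : 5 * log_const / 2 <= beta) by apply Rmax_r.
assert (H3 : beta < 5 * log_const) by (apply Rmax_lub_lt; lra).
assert (Hbn : RtoC beta <> RtoC 0) by (intro Q; apply RtoC_inj in Q; lra).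
set (q := fun z => (1 - best_dominant z * / beta)%C).
assert (Hq : forall z, Cmod z < 1 -> q z <> RtoC 0).
{ intros z Hz E. pose proof (Re_best_dominant_lt z Hz) as B.
  assert (E2 : best_dominant z = RtoC beta).
  { transitivity ((1 - q z) * beta)%C; [unfold q; field; exact Hbn|]. rewrite E. ring. }
  rewrite E2 in B. simpl in B. lra. }
assert (Dq : forall z, Cmod z < 1 -> is_Cderive q z (- (/ (1 + phi_L z) * / beta))%C).
{ intros z Hz. eapply is_Cderive_eq.
  - apply is_Cderive_minus; [apply is_Cderive_const|].
    apply is_Cderive_mult; [now apply is_Cderive_best_dominant|apply is_Cderive_const].
  - cbv beta. ring. }
set (p := fun z => (/ q z)%C).
assert (Dp : forall z, Cmod z < 1 -> is_Cderive p z (/ (1 + phi_L z) * / beta * (p z * p z))%C).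
{ intros z Hz. eapply is_Cderive_eq.
  - apply is_Cderive_inv; [now apply Dq|now apply Hq].
  - unfold p. pose proof (Hq z Hz).
    unfold Cdiv. replace (/ (q z * q z))%C with (/ q z * / q z)%C by (field; auto). ring. }
destruct (best_dominant_near_right (2 / 5 * beta)) as [y [Hy Hlt]]; [lra|].
assert (Hin : Cmod (RtoC (y * y - 1)) < 1).
{ pose proof (sqrt_sqrt 2 ltac:(lra)). rewrite Cmod_R. apply Rabs_lt_between. split; nra. }
assert (Hlt2 : best_dominant_real y < 2 * log_const).
{ pose proof (Re_best_dominant_lt _ Hin) as B. rewrite best_dominant_RtoC in B by lra. exact B. }
assert (G1 : best_dominant_real y / beta < 1) by (apply Rlt_div_l; lra).
assert (G2 : 2 / 5 < best_dominant_real y / beta).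
{ apply (proj1 (Rlt_div_r (2 / 5) (best_dominant_real y) beta ltac:(lra))). exact Hlt. }
apply (not_implication_from expr_c b beta p y (/ (1 - best_dominant_real y / beta))).
- exact H1.
- intros z Hz. eexists. now apply Dp.
- unfold p, q. rewrite best_dominant_0. field. exact Hbn.
- intros z Hz. unfold expr_c. rewrite (is_C_derive_unique _ _ _ (Dp z Hz)).
  assert (Hpn : p z <> RtoC 0).
  { unfold p. intro E. apply (f_equal (fun c => (c * q z)%C)) in E.
    rewrite Cinv_l, Cmult_0_l in E by now apply Hq. apply RtoC_inj in E. lra. }
  replace (1 + beta * (z * (/ (1 + phi_L z) * / beta * (p z * p z)) / p z ^ 2))%C
    with (1 + beta * / beta * (z * / (1 + phi_L z)) * (p z * p z * / (p z * p z)))%C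
    by (simpl; rewrite Cmult_1_r; unfold Cdiv; ring).
  rewrite best_dominant_euler, !Cinv_r by auto using Cmult_neq_0. ring.
- lra.
- unfold p, q. rewrite best_dominant_RtoC by lra.
  rewrite RtoC_inv, RtoC_minus, RtoC_div by lra. reflexivity.
- right. replace (5 / 3) with (/ (3 / 5)) by field. left.
  apply Rinv_lt_contravar; [|lra]. apply Rmult_lt_0_compat; lra.
Qed.

Theorem theorem2p1 :
  (implication_from expr_a (3 * (1 - ln 2)) /\
   implication_from expr_b
     (2 * (sqrt 2 + ln 2 - 1 - ln (1 + sqrt 2)) / ln (5 / 3)) /\
   implication_from expr_c
     (5 * (sqrt 2 + ln 2 - 1 - ln (1 + sqrt 2)))) /\
  (sharp (implication_from expr_a) (3 * (1 - ln 2)) /\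
   sharp (implication_from expr_b)
     (2 * (sqrt 2 + ln 2 - 1 - ln (1 + sqrt 2)) / ln (5 / 3)) /\
   sharp (implication_from expr_c)
     (5 * (sqrt 2 + ln 2 - 1 - ln (1 + sqrt 2)))).
Proof.
split; (split; [|split]).
- exact implication_a.
- exact implication_b.
- exact implication_c.
- exact sharp_a.
- exact sharp_b.
- exact sharp_c.
Qed.
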